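(* Let $n\geq 1$ be an integer and set $q=\frac{2n+1}{2n-1}$, let $p$ be determined by $\frac1p+\frac nq=n$ (so $p=\frac{2n+1}{2n}$), and set $\beta=\frac{2q}{q+1}$. Then the estimate $$\left\|\sum_{j\in J}n_j\left|e^{-it\mathcal{L}}f_j\right|^2\right\|_{L^p((-\pi,\pi),L^q(\mathbb{C}^n))}\leq C\left(\sum_{j\in J}|n_j|^\beta\right)^{1/\beta}$$ fails; that is, there is no constant $C>0$ for which it holds for all orthonormal systems $(f_j)_{j\in J}$ in $L^2(\mathbb{C}^n)$ and all sequences $(n_j)_{j\in J}\subset\mathbb{C}$.
   Context: The special Hermite operator (twisted Laplacian) on $\mathbb{C}^n$ is $$\mathcal{L}=-\Delta_z+\frac14|z|^2-i\sum_{j=1}^n\left(x_j\frac{\partial}{\partial y_j}-y_j\frac{\partial}{\partial x_j}\right),\qquad z=x+iy.$$ It is self-adjoint on $L^2(\mathbb{C}^n)$ with discrete spectrum $\{2k+n:k=0,1,2,\dots\}$. With $\mathcal{Q}_k$ the orthogonal projection onto the eigenspace for $2k+n$, $e^{-it\mathcal{L}}f=\sum_{k=0}^\infty e^{-it(2k+n)}\mathcal{Q}_kf$. *)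

(* Defs.v *)
From HB Require Import structures.
From mathcomp Require Import all_boot all_order all_algebra.
From mathcomp Require Import complex.
From mathcomp Require Import all_classical all_reals all_analysis.

Set Implicit Arguments.
Unset Strict Implicit.
Unset Printing Implicit Defensive.

Import Order.TTheory GRing.Theory Num.Theory.
Import numFieldNormedType.Exports.

Local Open Scope classical_set_scope.
Local Open Scope complex_scope.
Local Open Scope ring_scope.

(* The library has no sigma-algebra on row vectors.  We use the Borel one,
   generated by the coordinates, as the library does for [n.-tuple]. *)
Definition rV_display : measure_display. Proof. exact. Qed.

Section measurable_rV.
Context (R : realType) (n : nat).

Let coors : 'I_n -> 'rV[R]_n -> measurableTypeR R := fun i x => x ord0 i.

Let rV_set0 : g_sigma_preimage coors set0.
Proof. exact: sigma_algebra0. Qed.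

Let rV_setC A : g_sigma_preimage coors A -> g_sigma_preimage coors (~` A).
Proof. exact: sigma_algebraC. Qed.

Let rV_bigcup (F : (set 'rV[R]_n)^nat) :
  (forall i, g_sigma_preimage coors (F i)) ->
  g_sigma_preimage coors (\bigcup_i (F i)).
Proof. exact: sigma_algebra_bigcup. Qed.

HB.instance Definition _ := @isMeasurable.Build rV_display
  'rV[R]_n (g_sigma_preimage coors) rV_set0 rV_setC rV_bigcup.

End measurable_rV.

Section lebesgue_rV.
Context (R : realType).

Lemma measurable_coord_rV n (i : 'I_n) :
  measurable_fun [set: 'rV[R]_n]
    ((fun x => x ord0 i) : 'rV[R]_n -> measurableTypeR R).
Proof.
move=> _ Y mY; rewrite setTI; apply: sub_sigma_algebra => /=.
rewrite -bigcup_seq/=; exists i => /=; first by rewrite mem_index_enum.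
by exists Y => //; rewrite setTI.
Qed.

Lemma measurable_fun_rVP d (T : measurableType d) n (f : T -> 'rV[R]_n) :
  (forall i, measurable_fun [set: T]
     ((fun x => f x ord0 i) : T -> measurableTypeR R)) ->
  measurable_fun [set: T] f.
Proof.
move=> mf.
suff sub : measurable `<=` [set A : set 'rV[R]_n | measurable (f @^-1` A)].
  by move=> _ A mA; rewrite setTI; exact: (sub _ mA).
apply: smallest_sub.
  split=> [|A mA|F mF] /=; first by rewrite preimage_set0.
    by rewrite setTD (_ : _ @^-1` _ = ~` (f @^-1` A)) //; exact: measurableC.
  rewrite (_ : _ @^-1` _ = \bigcup_k (f @^-1` F k)); last exact: preimage_bigcup.
  exact: bigcupT_measurable.
rewrite -bigcup_seq; apply: bigcup_sub => i _ A [B mB <-] /=.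
rewrite setTI.
by have := mf i measurableT B mB; rewrite setTI.
Qed.

Definition consrV n (p : measurableTypeR R * 'rV[R]_n) : 'rV[R]_n.+1 :=
  \row_i (if unlift ord0 i is Some j then p.2 ord0 j else p.1).

Definition unconsrV n (v : 'rV[R]_n.+1) : measurableTypeR R * 'rV[R]_n :=
  (v ord0 ord0, \row_i v ord0 (lift ord0 i)).

Lemma consrVK n : cancel (@consrV n) (@unconsrV n).
Proof.
case=> t v; congr pair => /=; first by rewrite mxE unlift_none.
by apply/rowP => i; rewrite !mxE liftK.
Qed.

Lemma measurable_consrV n : measurable_fun setT (@consrV n).
Proof.
apply: measurable_fun_rVP => i; under eq_fun do rewrite mxE.
case: unliftP => [j _|_]; last exact: measurable_fst.
apply: (measurableT_comp (f := fun x : 'rV[R]_n => x ord0 j)) => //.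
exact: measurable_coord_rV.
Qed.

Lemma measurable_unconsrV n : measurable_fun setT (@unconsrV n).
Proof.
apply: measurable_fun_pair; first exact: measurable_coord_rV.
apply: measurable_fun_rVP => i.
under eq_fun do rewrite mxE.
exact: measurable_coord_rV.
Qed.

Section product_rV.
Context n (mu1 : {sigma_finite_measure set (measurableTypeR R) -> \bar R})
  (mu : {sigma_finite_measure set 'rV[R]_n -> \bar R}).

Lemma product_measure1_sigma_finite : sigma_finite setT (mu1 \x mu)%E.
Proof.
have /sigma_finiteP[F [TF ndF Foo]] := sigma_finiteT mu1.
have /sigma_finiteP[G [TG ndG Goo]] := sigma_finiteT mu.
exists (fun k => F k `*` G k).
  rewrite -setXTT TF TG predeqE => -[x y]; split.
    move=> [/= [i _ Fix] [j _ Gjy]]; exists (maxn i j) => //; split.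
      by move: x Fix; exact/subsetPset/ndF/leq_maxl.
    by move: y Gjy; exact/subsetPset/ndG/leq_maxr.
  by move=> [k _ []/= ? ?]; split; exists k.
move=> k; have [? ?] := Foo k; have [? ?] := Goo k.
split; first exact: measurableX.
by rewrite product_measure1E// lte_mul_pinfty// ge0_fin_numE.
Qed.

Definition product_rV : set 'rV[R]_n.+1 -> \bar R :=
  pushforward (mu1 \x mu)%E (@consrV n).

HB.instance Definition _ := Measure.copy product_rV
  (measure_function_pushforward__canonical__measure_function_Measure
     (mu1 \x mu)%E (@measurable_consrV n)).

Lemma product_rV_sigma_finite : sigma_finite setT product_rV.
Proof.
have [F UF mF] := product_measure1_sigma_finite.
exists (fun k => @unconsrV n @^-1` F k).
  by rewrite -preimage_bigcup -UF preimage_setT.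
move=> k; have [mFk Foo] := mF k; split.
  by rewrite -[X in measurable X]setTI; exact: measurable_unconsrV.
rewrite /product_rV /pushforward -comp_preimage.
by rewrite (_ : _ \o _ = id) //; apply/funext => p /=; rewrite consrVK.
Qed.

HB.instance Definition _ := Measure_isSigmaFinite.Build _ _ _ product_rV
  product_rV_sigma_finite.

End product_rV.

Fixpoint lebesgue_rV n : {sigma_finite_measure set 'rV[R]_n -> \bar R} :=
  match n with
  | 0 => dirac (0 : 'rV[R]_0)
  | n'.+1 => product_rV (@lebesgue_measure R) (lebesgue_rV n')
  end.

End lebesgue_rV.

(* A point z = x + iy of C^n is the pair (x, y) of its real and imaginary
   parts, a normed space over R; functions on it take values in R[i]. *)
Notation Cn R n := ('rV[R]_n * 'rV[R]_n)%type.

Definition expi (R : realType) (x : R) : R[i] := cos x +i* sin x.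

Section twisted_laplacian.
Context (R : realType) (n : nat).
Implicit Types (f g h phi u : Cn R n -> R[i]) (z v : Cn R n).

Definition dirx (j : 'I_n) : Cn R n := (delta_mx ord0 j, 0).
Definition diry (j : 'I_n) : Cn R n := (0, delta_mx ord0 j).

Definition cderive v f : Cn R n -> R[i] :=
  fun z => ('D_v (fun w => complex.Re (f w)) z)
           +i* ('D_v (fun w => complex.Im (f w)) z).

Definition normsq z : R := \sum_(j < n) (z.1 ord0 j ^+ 2 + z.2 ord0 j ^+ 2).

Definition laplacian f : Cn R n -> R[i] := fun z =>
  \sum_(j < n) (cderive (dirx j) (cderive (dirx j) f) z
                + cderive (diry j) (cderive (diry j) f) z).

Definition special_hermite f : Cn R n -> R[i] := fun z =>
  - laplacian f z + (4^-1 * normsq z)%:C * f z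
  - 'i%C * \sum_(j < n) ((z.1 ord0 j)%:C * cderive (diry j) f z
                       - (z.2 ord0 j)%:C * cderive (dirx j) f z).

(* [foldr cderive f s] is an iterated directional derivative of f; asking that
   all of them be differentiable amounts to f being C^oo. *)
Definition smooth f := forall (s : seq (Cn R n)) z,
  differentiable (fun w => complex.Re (foldr cderive f s w)) z /\
  differentiable (fun w => complex.Im (foldr cderive f s w)) z.

Definition schwartz f := smooth f /\
  forall (s : seq (Cn R n)) (m : nat), exists M : R,
    forall z, `|z| ^+ m * Normc.normc (foldr cderive f s z) <= M.

Definition vol : {measure set (Cn R n) -> \bar R} :=
  (lebesgue_rV R n \x lebesgue_rV R n)%E.

Definition L2 f :=
  [/\ measurable_fun setT (fun z => complex.Re (f z)),
      measurable_fun setT (fun z => complex.Im (f z)) &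
      (\int[vol]_z (Normc.normc (f z) ^+ 2)%:E < +oo)%E].

Definition inner f g : R[i] :=
  (\int[vol]_z complex.Re (f z * conjc (g z)))
  +i* (\int[vol]_z complex.Im (f z * conjc (g z))).

Definition orthonormal_system (J : eqType) (f : J -> Cn R n -> R[i]) :=
  (forall j, L2 (f j)) /\
  forall j k, inner (f j) (f k) = (j == k)%:R.

(* Graph of the self-adjoint operator L on L^2(C^n): the differential operator
   is essentially self-adjoint on Schwartz functions, and its self-adjoint
   extension is the adjoint of its restriction to them. *)
Definition twisted_laplacian_graph f g :=
  [/\ L2 f, L2 g & forall phi, schwartz phi ->
      inner f (special_hermite phi) = inner g phi].

Definition eigenvalue_of (k : nat) : R := (2 * k + n)%:R.

Definition hermite_eigenspace (k : nat) f :=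
  twisted_laplacian_graph f (fun z => (eigenvalue_of k)%:C * f z).

(* g represents Q_k f *)
Definition is_spectral_projection (k : nat) f g :=
  hermite_eigenspace k g /\
  forall h, hermite_eigenspace k h -> inner (fun z => f z - g z) h = 0.

(* u represents e^{-itL} f: the spectral series converges to u in L^2. *)
Definition is_propagator (t : R) f u :=
  L2 u /\ exists2 g : nat -> Cn R n -> R[i],
    forall k, is_spectral_projection k f (g k) &
    (fun N : nat => \int[vol]_z (Normc.normc
       (u z - \sum_(k < N) expi (- (t * eigenvalue_of k)) * g k z) ^+ 2)%:E)%E
      @ \oo --> (0 : \bar R)%E.

Definition mixed_norm (p q : R) (F : R -> Cn R n -> R[i]) : \bar R :=
  ((\int[@lebesgue_measure R]_(t in `](- pi)%R, pi%R[%classic)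
      (Lnorm vol q%:E (fun z => (Normc.normc (F t z))%:E) `^ p)) `^ p^-1)%E.

End twisted_laplacian.

Section families.
Context (R : realType) (J : choiceType).

(* Unordered sums, meaningful for absolutely summable families only: [fine]
   sends an infinite positive or negative part to 0. *)
Definition rsum (a : J -> R) : R :=
  fine (\esum_(j in [set: J]) (EFin \o a)^\+%E j)
  - fine (\esum_(j in [set: J]) (EFin \o a)^\-%E j).

Definition csum (a : J -> R[i]) : R[i] :=
  rsum (fun j => complex.Re (a j)) +i* rsum (fun j => complex.Im (a j)).

Definition ell_norm (b : R) (a : J -> R[i]) : \bar R :=
  ((\esum_(j in [set: J]) (Normc.normc (a j) `^ b)%:E) `^ b^-1)%E.

End families.

(* Main.v *)
(* The estimate is tested on stationary data.  If every f_j is an eigenfunction,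
   then |e^{-itL} f_j| = |f_j| and, with V(z) = exp(-|z|^2/2), Hoelder's
   inequality in space gives
     sum_j nu_j int V |f_j|^2 <= K (sum_j nu_j^beta)^(1/beta),
   where beta = (2n+1)/(2n).  This fails once there are orthonormal
   eigenfunctions whose masses l_j = int V |f_j|^2 satisfy
   sum_j l_j^(2n+1) = oo (take nu_j = l_j^(2n)).

   Write eigenfunctions as polynomials in z and conj z times exp(-|z|^2/4), with
   the two commuting families of ladder operators a_i, b_i and the radial
   operator A = sum_i a_i^+ b_i^+.  If chi has bidegree (q, p), then A^j chi has
   mass at least of order 2^-(2j+al) binom(2j+al, j) where al = q + p + n - 1,
   because [A^*, A] is diagonal on bidegrees.  For d >= 1 take j = (nd)^2 and
   q, p in [nd, nd + d): the mass is at least c/d, the d^2 bidegrees so obtained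
   are different for different d, and each carries d^(2n-2) orthonormal states.
   So d^(2n) functions have mass at least c/d, and the sum of the l_j^(2n+1)
   dominates the harmonic series. *)
From HB Require Import structures.
Require Import Defs.
From mathcomp Require Import all_boot all_order all_algebra.
From mathcomp Require Import complex.
From mathcomp Require Import all_classical all_reals all_analysis measurable_realfun.
From mathcomp Require Import -(notations) mpoly.
From mathcomp Require Import ring lra zify.

Set Implicit Arguments.
Unset Strict Implicit.
Unset Printing Implicit Defensive.

Import Order.TTheory GRing.Theory Num.Theory.
Import numFieldNormedType.Exports.

Local Open Scope classical_set_scope.
Local Open Scope complex_scope.
Local Open Scope ring_scope.

(** * Polynomials and ladder operators *)

(** Why the mass of A^j chi is of the stated order, writing B for the adjoint of A. Multiplying
    |f|^2 by V replaces the Gaussian exp(-|z|^2/2) by exp(-|z|^2), which is the same Gaussian after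
    a dilation of ratio 1/sqrt 2. On a vector Q made of d creation operators that dilation acts as
    2^(-d/2) exp(-B), so the mass of Q is a constant times 2^-d |exp(-B) Q|^2. The vectors B^i Q
    have different bidegrees, hence are orthogonal, and the mass becomes a sum of |B^i Q|^2 / i!^2.
    For Q = A^j chi these norms are bounded below even when B chi is not 0, and Vandermonde's
    convolution adds the bounds up. So chi need not be harmonic: plain words in the creation
    operators will do, and they are easy to count. With j = (nd)^2 and al of order nd, al^2 / j
    stays bounded, so the binomial loses only a constant against the central one, itself of order 1
    / sqrt j = 1 / (nd). The algebra uses only integration by parts, symmetry under conjugation and
    positivity of the Gaussian functional, and its positive value at 1; the analysis serves to
    establish these and to identify the eigenfunctions. *)

Section polynomials.
Context (R : realType) (n : nat).

Local Notation MP := (mpoly (n + n) R[i]).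
Local Notation "''X' k" := (mpolyX R[i] (mnm1 k)) (at level 8, k at level 2).
Local Notation "''d' k" := (@mderiv (n + n) R[i] k) (at level 8, k at level 2).

Lemma mpolyX_neq0 (m : multinom (n + n)) : m != mnm0 ->
  exists2 k, mpolyX R[i] m = 'X k * mpolyX R[i] (mnm_sub m (mnm1 k)) &
    (mdeg (mnm_sub m (mnm1 k))).+1 = mdeg m.
Proof.
move=> m0.
have [k mk] : exists k, m k != 0%N.
  apply/existsP; apply: contra_neqT m0 => /existsPn h; apply/mnmP => k.
  by rewrite mnm0E; apply/eqP; move: (h k); rewrite negbK.
have e : m = mnm_add (mnm1 k) (mnm_sub m (mnm1 k)).
  by rewrite addmC submK// lep1mP.
exists k; first by rewrite -mpolyXD -e.
by rewrite [in RHS]e mdegD mdeg1.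
Qed.

(** Identities between ring morphisms and derivations then need checking only on constants and on
    multiplication by one variable. *)
Lemma mpoly_alg_ind (K : MP -> Prop) :
  (forall c, K (mpolyC _ c)) -> (forall P Q, K P -> K Q -> K (P + Q)) ->
  (forall k P, K P -> K ('X k * P)) -> forall P, K P.
Proof.
move=> KC KD KX.
have KZ c m : K (c *: mpolyX R[i] m).
  move: {2}(mdeg m) (erefl (mdeg m)) => d; elim: d m => [|d IH] m.
    by move/eqP; rewrite mdeg_eq0 => /eqP->; rewrite mpolyX0 -mul_mpolyC mulr1.
  have [->|/mpolyX_neq0[k -> <-] [/IH h]] := eqVneq m mnm0; first by rewrite mdeg0.
  by rewrite scalerAr; apply: KX.
elim/mpolyind => [|c m P _ _ KP]; first by rewrite -(mpolyC0 _ R[i]).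
exact: KD.
Qed.

(** The variable [lshift n i] stands for z_i and [rshift n i] for its conjugate, both divided by
    sqrt 2; [tau] is conjugation on indices and [star] is conjugation on polynomials. *)
Definition tau (k : 'I_(n + n)) : 'I_(n + n) :=
  match fintype.split k with inl i => rshift n i | inr i => lshift n i end.

Lemma tau_lshift i : tau (lshift n i) = rshift n i.
Proof. by rewrite /tau (unsplitK (inl i)). Qed.

Lemma tau_rshift i : tau (rshift n i) = lshift n i.
Proof. by rewrite /tau (unsplitK (inr i)). Qed.

Lemma tauK : involutive tau.
Proof.
move=> k; rewrite -(splitK k); case: (fintype.split k) => i /=.
  by rewrite tau_lshift tau_rshift.
by rewrite tau_rshift tau_lshift.
Qed.

Lemma mderivXU k l : 'd k ('X l) = (k == l)%:R.
Proof.
rewrite mderivX mnm1E eq_sym; case: eqVneq => [->|_]; last by rewrite scale0r.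
rewrite scale1r (_ : mnm_sub _ _ = mnm0) ?mpolyX0//.
by apply/mnmP => i; rewrite mnmBE subnn mnm0E.
Qed.

Lemma mderivXM k l P : 'd k ('X l * P) = (k == l)%:R *: P + 'X l * 'd k P.
Proof. by rewrite mderivM mderivXU scaler_nat mulr_natl. Qed.

(* Obtained from an existence statement so that unification does not unfold it. *)
Lemma star_subproof : exists f : {rmorphism MP -> MP},
  (forall k, f ('X k) = 'X (tau k)) /\
  (forall c, f (mpolyC _ c) = mpolyC _ (conjc c)).
Proof.
exists (mmap (mpolyC (n + n) (R := R[i]) \o (@conjc R)) (fun k => 'X (tau k))).
by split=> *; [exact: etrans (mmapX _ _ _) (mmap1U _ _)|exact: mmapC].
Qed.
Definition star : {rmorphism MP -> MP} := projT1 (cid star_subproof).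

Lemma starX k : star ('X k) = 'X (tau k).
Proof. exact: (projT2 (cid star_subproof)).1. Qed.

Lemma starC c : star (mpolyC _ c) = mpolyC _ (conjc c).
Proof. exact: (projT2 (cid star_subproof)).2. Qed.

Lemma starZ c P : star (c *: P) = conjc c *: star P.
Proof. by rewrite -!mul_mpolyC rmorphM starC. Qed.

Lemma starK : involutive star.
Proof.
elim/mpoly_alg_ind => [c|P Q hP hQ|k P hP].
- by rewrite !starC conjcK.
- by rewrite !rmorphD hP hQ.
- by rewrite !rmorphM !starX tauK hP.
Qed.

Lemma star_mderiv k P : star ('d k P) = 'd (tau k) (star P).
Proof.
elim/mpoly_alg_ind: P => [c|P Q hP hQ|l P hP].
- by rewrite starC !mderivC rmorph0.
- by rewrite mderivD !rmorphD mderivD hP hQ.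
- rewrite mderivXM rmorphD rmorphM !starX rmorphM !starX mderivXM hP.
  by rewrite starZ conjc_nat (inj_eq (inv_inj tauK)).
Qed.

(** Dilation of all variables, given by an existence statement for the same reason as [star]. It
    will relate the Gaussians exp(-|z|^2/2) and exp(-|z|^2). *)
Lemma scl_subproof (s : R[i]) : exists f : {rmorphism MP -> MP},
  (forall k, f ('X k) = s *: 'X k) /\ (forall c, f (mpolyC _ c) = mpolyC _ c).
Proof.
exists (mmap (mpolyC (n + n) (R := R[i])) (fun k => s *: 'X k)).
by split=> *; [exact: etrans (mmapX _ _ _) (mmap1U _ _)|exact: mmapC].
Qed.
Definition scl s : {rmorphism MP -> MP} := projT1 (cid (scl_subproof s)).

Lemma sclX s k : scl s ('X k) = s *: 'X k.
Proof. exact: (projT2 (cid (scl_subproof s))).1. Qed.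

Lemma sclC s c : scl s (mpolyC _ c) = mpolyC _ c.
Proof. exact: (projT2 (cid (scl_subproof s))).2. Qed.

Lemma sclZ s c P : scl s (c *: P) = c *: scl s P.
Proof. by rewrite -!mul_mpolyC rmorphM sclC. Qed.

Lemma mderiv_scl s k P : 'd k (scl s P) = s *: scl s ('d k P).
Proof.
elim/mpoly_alg_ind: P => [c|P Q hP hQ|l P hP].
- by rewrite sclC !mderivC rmorph0 scaler0.
- by rewrite mderivD !rmorphD mderivD scalerDr hP hQ.
- rewrite rmorphM sclX -scalerAl mderivZ !mderivXM hP rmorphD sclZ.
  by rewrite rmorphM sclX -scalerAr -scalerAl.
Qed.

Lemma scl_star s P : conjc s = s -> scl s (star P) = star (scl s P).
Proof.
move=> hs; elim/mpoly_alg_ind: P => [c|P Q hP hQ|l P hP].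
- by rewrite sclC !starC sclC.
- by rewrite !rmorphD hP hQ.
- by rewrite !rmorphM sclX starX sclX starZ starX hs hP.
Qed.

(* Creation operators; the annihilation operators are the derivations. *)
Definition cr k P : MP := 'X k * P - 'd (tau k) P.

Lemma cr_is_linear k : linear (cr k).
Proof.
move=> a P Q; rewrite /cr mulrDr -scalerAr mderivD mderivZ opprD addrACA.
by rewrite scalerBr.
Qed.
HB.instance Definition _ k := GRing.isLinear.Build R[i] MP MP _ (cr k)
  (cr_is_linear k).

Lemma mderiv_cr k l P : 'd k (cr l P) = cr l ('d k P) + (k == l)%:R *: P.
Proof. rewrite /cr mderivB mderivXM mderiv_comm; ring. Qed.

Lemma cr_comm k l P : cr k (cr l P) = cr l (cr k P).
Proof.
rewrite /cr !mderivB !mderivXM mderiv_comm.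
rewrite (_ : (tau k == l) = (tau l == k)); last first.
  by rewrite -(inj_eq (inv_inj tauK)) tauK eq_sym.
by rewrite !mulrBr; ring.
Qed.

(** [rai] is the radial operator A and [low] its adjoint for a Gaussian form; [numl] and [numr] are
    the number operators whose eigenvalues form the bidegree. *)
Definition low P : MP := \sum_(i < n) 'd (lshift n i) ('d (rshift n i) P).
Definition rai P : MP := \sum_(i < n) cr (lshift n i) (cr (rshift n i) P).
Definition numl P : MP := \sum_(i < n) cr (lshift n i) ('d (lshift n i) P).
Definition numr P : MP := \sum_(i < n) cr (rshift n i) ('d (rshift n i) P).

End polynomials.
Arguments star {R n}.
Arguments scl {R n}.

(** * Commutation relations, bidegrees and the dilation as an exponential *)

Section ladder.
Context (R : realType) (n : nat).

Local Notation MP := (mpoly (n + n) R[i]).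
Local Notation "''X' k" := (mpolyX R[i] (mnm1 k)) (at level 8, k at level 2).
Local Notation "''d' k" := (@mderiv (n + n) R[i] k) (at level 8, k at level 2).
Implicit Types P Q : MP.

Lemma low_is_linear : linear (@low R n).
Proof.
move=> a P Q; rewrite /low scaler_sumr -big_split; apply: eq_bigr => i _ /=.
by rewrite !linearP.
Qed.
HB.instance Definition _ := GRing.isLinear.Build R[i] MP MP _ (@low R n)
  low_is_linear.

Lemma rai_is_linear : linear (@rai R n).
Proof.
move=> a P Q; rewrite /rai scaler_sumr -big_split; apply: eq_bigr => i _ /=.
by rewrite !linearP.
Qed.
HB.instance Definition _ := GRing.isLinear.Build R[i] MP MP _ (@rai R n)
  rai_is_linear.

Lemma numl_is_linear : linear (@numl R n).
Proof.
move=> a P Q; rewrite /numl scaler_sumr -big_split; apply: eq_bigr => i _ /=.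
by rewrite !linearP.
Qed.
HB.instance Definition _ := GRing.isLinear.Build R[i] MP MP _ (@numl R n)
  numl_is_linear.

Lemma numr_is_linear : linear (@numr R n).
Proof.
move=> a P Q; rewrite /numr scaler_sumr -big_split; apply: eq_bigr => i _ /=.
by rewrite !linearP.
Qed.
HB.instance Definition _ := GRing.isLinear.Build R[i] MP MP _ (@numr R n)
  numr_is_linear.

Let eq_l (i j : 'I_n) : (lshift n i == lshift n j) = (i == j).
Proof. exact: eq_lshift. Qed.
Let eq_r (i j : 'I_n) : (rshift n i == rshift n j) = (i == j).
Proof. exact: eq_rshift. Qed.
Let eq_lr (i j : 'I_n) : (lshift n i == rshift n j) = false.
Proof. exact: eq_lrshift. Qed.
Let eq_rl (i j : 'I_n) : (rshift n i == lshift n j) = false.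
Proof. exact: eq_rlshift. Qed.

Lemma ord2P (k : 'I_(n + n)) :
  (exists i, k = lshift n i) \/ (exists i, k = rshift n i).
Proof.
by rewrite -(splitK k); case: (fintype.split k) => i; [left|right]; exists i.
Qed.

Let sum_delta i (F : 'I_n -> MP) :
  \sum_(j < n) (j == i)%:R *: F j = F i.
Proof.
rewrite (bigD1 i)//= eqxx scale1r big1 ?addr0// => j /negbTE ->.
by rewrite scale0r.
Qed.

Lemma low_cr k P : low (cr k P) = cr k (low P) + 'd (tau k) P.
Proof.
rewrite /low linear_sum /=.
under eq_bigr do rewrite !mderiv_cr linearD linearZ /= mderiv_cr -addrA.
rewrite big_split /=; congr (_ + _).
case: (ord2P k) => -[i ->].
  under eq_bigr do rewrite eq_l eq_rl scale0r addr0.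
  by rewrite sum_delta tau_lshift.
under eq_bigr do rewrite eq_lr eq_r scale0r add0r.
by rewrite sum_delta tau_rshift.
Qed.

Lemma low_mderiv k P : low ('d k P) = 'd k (low P).
Proof.
rewrite /low linear_sum /=; apply: eq_bigr => i _.
by rewrite [in RHS]mderiv_comm [X in _ = 'd _ X]mderiv_comm.
Qed.

Lemma numl_crl i P :
  numl (cr (lshift n i) P) = cr (lshift n i) (numl P) + cr (lshift n i) P.
Proof.
rewrite /numl linear_sum /=.
under eq_bigr do rewrite mderiv_cr linearD linearZ /= cr_comm.
by rewrite big_split /=; under [X in _ + X]eq_bigr do rewrite eq_l; rewrite sum_delta.
Qed.

Lemma numr_crr i P :
  numr (cr (rshift n i) P) = cr (rshift n i) (numr P) + cr (rshift n i) P.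
Proof.
rewrite /numr linear_sum /=.
under eq_bigr do rewrite mderiv_cr linearD linearZ /= cr_comm.
by rewrite big_split /=; under [X in _ + X]eq_bigr do rewrite eq_r; rewrite sum_delta.
Qed.

Lemma numl_crr i P : numl (cr (rshift n i) P) = cr (rshift n i) (numl P).
Proof.
rewrite /numl linear_sum /=; apply: eq_bigr => j _.
by rewrite mderiv_cr eq_lr scale0r addr0 cr_comm.
Qed.

Lemma numr_crl i P : numr (cr (lshift n i) P) = cr (lshift n i) (numr P).
Proof.
rewrite /numr linear_sum /=; apply: eq_bigr => j _.
by rewrite mderiv_cr eq_rl scale0r addr0 cr_comm.
Qed.

(** An sl_2 relation: each of the n pairs contributes its two number operators and, from normal
    ordering, one identity. *)
Lemma low_rai P :
  low (rai P) = rai (low P) + numl P + numr P + n%:R *: P.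
Proof.
rewrite [in LHS]/rai linear_sum /=.
under eq_bigr => i _ do
  rewrite low_cr low_cr linearD /= tau_lshift tau_rshift mderiv_cr eqxx scale1r -addrA.
rewrite -[RHS]addrA -[RHS]addrA.
rewrite big_split; congr (_ + _); rewrite big_split; congr (_ + _).
by rewrite big_split; congr (_ + _); rewrite sumr_const card_ord scaler_nat.
Qed.

Lemma numl_rai P : numl (rai P) = rai (numl P) + rai P.
Proof.
rewrite /rai [in LHS]linear_sum /= -big_split; apply: eq_bigr => i _ /=.
by rewrite numl_crl numl_crr.
Qed.

Lemma numr_rai P : numr (rai P) = rai (numr P) + rai P.
Proof.
rewrite /rai [in LHS]linear_sum /= -big_split; apply: eq_bigr => i _ /=.
by rewrite numr_crl numr_crr linearD.
Qed.

Lemma numl_dl i P :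
  'd (lshift n i) (numl P) = numl ('d (lshift n i) P) + 'd (lshift n i) P.
Proof.
rewrite /numl linear_sum /=.
under eq_bigr do rewrite mderiv_cr eq_l eq_sym mderiv_comm.
by rewrite big_split /= sum_delta.
Qed.

Lemma numl_dr i P : 'd (rshift n i) (numl P) = numl ('d (rshift n i) P).
Proof.
rewrite /numl linear_sum /=.
by under eq_bigr do rewrite mderiv_cr eq_rl scale0r addr0 mderiv_comm.
Qed.

Lemma numr_dr i P :
  'd (rshift n i) (numr P) = numr ('d (rshift n i) P) + 'd (rshift n i) P.
Proof.
rewrite /numr linear_sum /=.
under eq_bigr do rewrite mderiv_cr eq_r eq_sym mderiv_comm.
by rewrite big_split /= sum_delta.
Qed.

Lemma numr_dl i P : 'd (lshift n i) (numr P) = numr ('d (lshift n i) P).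
Proof.
rewrite /numr linear_sum /=.
by under eq_bigr do rewrite mderiv_cr eq_lr scale0r addr0 mderiv_comm.
Qed.

Lemma low_numl P : low (numl P) = numl (low P) + low P.
Proof.
rewrite /low [in RHS]linear_sum /= -big_split; apply: eq_bigr => i _ /=.
by rewrite numl_dr numl_dl.
Qed.

Lemma low_numr P : low (numr P) = numr (low P) + low P.
Proof.
rewrite /low [in RHS]linear_sum /= -big_split; apply: eq_bigr => i _ /=.
by rewrite numr_dr linearD /= numr_dl.
Qed.

(** Bidegrees are real here, so that lowering needs no truncated subtraction, and 0 belongs to every
    bidegree. *)
Definition eig (x y : R) P := numl P = x%:C *: P /\ numr P = y%:C *: P.

Lemma eig_lin x y (a : R[i]) P Q : eig x y P -> eig x y Q -> eig x y (a *: P + Q).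
Proof.
move=> [p1 p2] [q1 q2]; split; rewrite linearP /= ?p1 ?q1 ?p2 ?q2.
  by rewrite scalerDr !scalerA mulrC.
by rewrite scalerDr !scalerA mulrC.
Qed.

Lemma eig0 x y : eig x y 0.
Proof. by split; rewrite linear0 scaler0. Qed.

Lemma eig_low x y P : eig x y P -> eig (x - 1) (y - 1) (low P).
Proof.
move=> [p1 p2]; split.
  have := low_numl P; rewrite p1 linearZ /= => /eqP; rewrite -subr_eq => /eqP <-.
  by rewrite rmorphB scalerBl rmorph1 scale1r.
have := low_numr P; rewrite p2 linearZ /= => /eqP; rewrite -subr_eq => /eqP <-.
by rewrite rmorphB scalerBl rmorph1 scale1r.
Qed.

Lemma eig_rai x y P : eig x y P -> eig (x + 1) (y + 1) (rai P).
Proof.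
move=> [p1 p2]; split.
  by rewrite numl_rai p1 linearZ /= rmorphD scalerDl rmorph1 scale1r.
by rewrite numr_rai p2 linearZ /= rmorphD scalerDl rmorph1 scale1r.
Qed.

Lemma eig_iter_low i x y P : eig x y P -> eig (x - i%:R) (y - i%:R) (iter i (@low R n) P).
Proof.
move=> h; elim: i => [|i IH]; first by rewrite !subr0.
by rewrite iterS -natr1 !opprD !addrA; exact: eig_low.
Qed.

Lemma eig_iter_rai i x y P : eig x y P -> eig (x + i%:R) (y + i%:R) (iter i (@rai R n) P).
Proof.
move=> h; elim: i => [|i IH]; first by rewrite !addr0.
by rewrite iterS -natr1 !addrA; exact: eig_rai.
Qed.

(* [P] is a combination of products of [k] left and [m] right creation
   operators applied to the vacuum. *)
Inductive fock : nat -> nat -> MP -> Prop :=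
| fock_vac : fock 0 0 1
| fock0 k m : fock k m 0
| fock_crl i k m P : fock k m P -> fock k.+1 m (cr (lshift n i) P)
| fock_crr i k m P : fock k m P -> fock k m.+1 (cr (rshift n i) P)
| fock_lin a k m P Q : fock k m P -> fock k m Q -> fock k m (a *: P + Q).

Lemma fock_sum k m (I : finType) (F : I -> MP) (c : I -> R[i]) :
  (forall i, fock k m (F i)) -> fock k m (\sum_i c i *: F i).
Proof.
by move=> h; elim/big_rec: _ => [|i P _ hP]; [exact: fock0|exact: fock_lin].
Qed.

Lemma fock_eig k m P : fock k m P -> eig k%:R m%:R P.
Proof.
elim=> {k m P}.
- split; rewrite scale0r /numl /numr big1// => i _; rewrite -(mpolyC1 _ R[i]) mderivC;
  exact: linear0.
- by move=> k m; exact: eig0.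
- move=> i k m P _ [p1 p2]; split.
    by rewrite numl_crl p1 linearZ /= -natr1 rmorphD scalerDl rmorph1 scale1r.
  by rewrite numr_crl p2 linearZ.
- move=> i k m P _ [p1 p2]; split.
    by rewrite numl_crr p1 linearZ.
  by rewrite numr_crr p2 linearZ /= -natr1 rmorphD scalerDl rmorph1 scale1r.
- by move=> a k m P Q _ h1 _ h2; exact: eig_lin.
Qed.

Lemma fock_rai k m P : fock k m P -> fock k.+1 m.+1 (rai P).
Proof.
move=> h; rewrite /rai.
rewrite (eq_bigr (fun i => 1 *: cr (lshift n i) (cr (rshift n i) P))); last first.
  by move=> i _; rewrite scale1r.
by apply: fock_sum => i; apply: fock_crl; apply: fock_crr.
Qed.

Lemma fock_iter_rai j k m P : fock k m P -> fock (j + k) (j + m) (iter j (@rai R n) P).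
Proof. by move=> h; elim: j => // j IH; rewrite iterS !addSn; exact: fock_rai. Qed.

(** The commutator of [low] with [cr k] is a derivation that commutes with [low], hence the i equal
    terms. For i = 0 the factor [i%:R] kills the meaningless [i.-1]. *)
Lemma iter_low_cr i k P : iter i (@low R n) (cr k P) =
  cr k (iter i (@low R n) P) + i%:R *: 'd (tau k) (iter i.-1 (@low R n) P).
Proof.
elim: i => [|i IH]; first by rewrite scale0r addr0.
rewrite iterS IH linearD linearZ /= low_cr low_mderiv -addrA; congr (_ + _).
case: i {IH} => [|i]; first by rewrite scale0r addr0 scale1r.
by rewrite -[in RHS]natr1 scalerDl scale1r addrC.
Qed.

Lemma low1 : low 1 = 0 :> MP.
Proof. by rewrite /low big1// => i _; rewrite -(mpolyC1 _ R[i]) !mderivC. Qed.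

(** The exponential of [- low], cut off after K terms; on [fock k m] the cut is harmless as soon as
    K exceeds k + m. *)
Definition expm K P : MP :=
  \sum_(i < K) ((-1) ^+ i / i`!%:R) *: iter i (@low R n) P.

Lemma expm_lin K a P Q : expm K (a *: P + Q) = a *: expm K P + expm K Q.
Proof.
have lin i : iter i (@low R n) (a *: P + Q) =
    a *: iter i (@low R n) P + iter i (@low R n) Q.
  by elim: i => // i IH; rewrite !iterS IH linearP.
rewrite /expm scaler_sumr -big_split; apply: eq_bigr => i _ /=.
by rewrite lin scalerDr !scalerA mulrC.
Qed.

(** exp(- low) intertwines [cr k] with [cr k - 'd (tau k)]. The truncation drops by one because the
    derivative carries low^(i-1) where the term i stood. *)
Lemma expm_cr K k P :
  expm K.+1 (cr k P) = cr k (expm K.+1 P) - 'd (tau k) (expm K P).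
Proof.
rewrite /expm (linear_sum (cr k)) (linear_sum ('d (tau k))) /=.
under eq_bigr do rewrite iter_low_cr scalerDr.
rewrite big_split /=; congr (_ + _); first by apply: eq_bigr => i _; rewrite linearZ.
rewrite big_ord_recl /= scale0r scaler0 add0r -sumrN; apply: eq_bigr => i _.
rewrite /bump /= add1n mderivZ scalerA -scaleNr; congr (_ *: _).
rewrite exprS mulN1r !mulNr; congr (- _).
rewrite factS natrM invfM -!mulrA; congr (_ * _).
by rewrite mulrCA mulVf ?mulr1// pnatr_eq0.
Qed.

(** Both sides obey the same recursion along creation operators. As s^2 = 1/2, a derivative passes
    through [scl s] with the factor 2 s, so [scl s (cr t Q)] is s times [cr t - 'd (tau t)] applied
    to [scl s Q], which is the rule of [expm_cr]; and both sides fix the vacuum. *)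
Lemma scl_fock (s : R[i]) k m P K : s * s = 2^-1 -> fock k m P -> (k + m < K)%N ->
  scl s P = s ^+ (k + m) *: expm K P.
Proof.
move=> hs.
have s0 : s != 0.
  by apply: contra_eq_neq hs => ->; rewrite mul0r eq_sym invr_eq0 pnatr_eq0.
have step t Q d L : (forall L, (d < L)%N -> scl s Q = s ^+ d *: expm L Q) ->
    (d.+1 < L)%N -> scl s (cr t Q) = s ^+ d.+1 *: expm L (cr t Q).
  case: L => // L h dL; rewrite expm_cr scalerBr exprS -!scalerA.
  have -> : s ^+ d *: cr t (expm L.+1 Q) = cr t (scl s Q).
    by rewrite (h L.+1) ?linearZ// ltnW.
  have -> : s ^+ d *: 'd (tau t) (expm L Q) = 'd (tau t) (scl s Q).
    by rewrite (h L) ?linearZ//.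
  rewrite [in LHS]/cr rmorphB rmorphM sclX mderiv_scl /cr mderiv_scl -scalerAl.
  rewrite -!scalerBr -addrA -opprD -mulr2n -scaler_nat scalerA scalerBr; congr (_ - _).
  rewrite scalerA (_ : s * _ = 1) ?scale1r//.
  by rewrite mulrCA hs divff// pnatr_eq0.
move=> h; elim: h K => {k m P} [K|k m K|i k m P _ IH K|i k m P _ IH K|a k m P Q _ hP _ hQ K] kK.
- rewrite rmorph1 expr0 scale1r /expm.
  case: K kK => // K _; rewrite big_ord_recl /= expr0 fact0 divr1 scale1r big1 ?addr0// => i _.
  rewrite add0n -iterS iterSr low1 (_ : iter i _ 0 = 0) ?scaler0//.
  by elim: (nat_of_ord i) => //= j ->; exact: linear0.
- rewrite rmorph0; have := expm_lin K (-1) 0 0.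
  by rewrite !scaleN1r oppr0 addr0 addNr => ->; rewrite scaler0.
- exact: step.
- by rewrite addnS; apply: step => //; rewrite -addnS.
- by rewrite expm_lin rmorphD sclZ (hP K)// (hQ K)// scalerDr !scalerA mulrC.
Qed.

End ladder.

(** * Norms in a Gaussian form, up to the lower bound for masses *)

Section hform.
Context (R : realType) (n : nat).

Local Notation MP := (mpoly (n + n) R[i]).
Local Notation "''X' k" := (mpolyX R[i] (mnm1 k)) (at level 8, k at level 2).
Local Notation "''d' k" := (@mderiv (n + n) R[i] k) (at level 8, k at level 2).
Implicit Types P Q : MP.

Context (E : {scalar MP})
  (E_ibp : forall k P, E ('X k * P) = E ('d (tau k) P))
  (E_star : forall P, E (star P) = conjc (E P))
  (E_ge0 : forall P, 0 <= complex.Re (E (P * star P))).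

Definition hform P Q : R[i] := E (P * star Q).
Definition nrm P : R := complex.Re (hform P P).

Lemma formC P Q : hform Q P = conjc (hform P Q).
Proof. by rewrite /hform -E_star rmorphM starK mulrC. Qed.

Lemma formDl P P' Q : hform (P + P') Q = hform P Q + hform P' Q.
Proof. by rewrite /hform mulrDl linearD. Qed.

Lemma formZl a P Q : hform (a *: P) Q = a * hform P Q.
Proof. by rewrite /hform -scalerAl linearZ. Qed.

Lemma form_suml (I : finType) (F : I -> MP) Q :
  hform (\sum_i F i) Q = \sum_i hform (F i) Q.
Proof. by rewrite /hform mulr_suml linear_sum. Qed.

Lemma formDr P Q Q' : hform P (Q + Q') = hform P Q + hform P Q'.
Proof. by rewrite formC formDl rmorphD /= -!formC. Qed.

Lemma formZr a P Q : hform P (a *: Q) = conjc a * hform P Q.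
Proof. by rewrite formC formZl rmorphM /= -formC. Qed.

Lemma form_sumr (I : finType) (F : I -> MP) P :
  hform P (\sum_i F i) = \sum_i hform P (F i).
Proof.
by rewrite formC form_suml rmorph_sum; apply: eq_bigr => i _ /=; rewrite -formC.
Qed.

(** Integration by parts replaces ['X k] by a derivative of the product; the part falling on P
    cancels the second term of [cr], and [star] turns the rest into ['d k Q]. *)
Lemma form_crl k P Q : hform (cr k P) Q = hform P ('d k Q).
Proof.
rewrite /hform /cr mulrBl linearB /= -mulrA E_ibp mderivM linearD /=.
by rewrite star_mderiv addrAC subrr add0r.
Qed.

Lemma form_crr k P Q : hform P (cr k Q) = hform ('d k P) Q.
Proof. by rewrite formC form_crl -formC. Qed.

Lemma form_rail P Q : hform (rai P) Q = hform P (low Q).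
Proof.
rewrite /rai form_suml /low form_sumr; apply: eq_bigr => i _.
by rewrite !form_crl mderiv_comm.
Qed.

Lemma form_numl P Q : hform (numl P) Q = hform P (numl Q).
Proof.
rewrite /numl form_suml form_sumr; apply: eq_bigr => i _.
by rewrite form_crl form_crr.
Qed.

Lemma form_numr P Q : hform (numr P) Q = hform P (numr Q).
Proof.
rewrite /numr form_suml form_sumr; apply: eq_bigr => i _.
by rewrite form_crl form_crr.
Qed.

Lemma form_eig x y x' y' P Q : eig x y P -> eig x' y' Q ->
  (x != x') || (y != y') -> hform P Q = 0.
Proof.
move=> [p1 p2] [q1 q2] /orP[] ne.
  have := form_numl P Q; rewrite p1 q1 formZl formZr conjc_real => /eqP.
  rewrite -subr_eq0 -mulrBl mulf_eq0 subr_eq0.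
  by rewrite (inj_eq (@complexI _)) (negbTE ne) => /eqP.
have := form_numr P Q; rewrite p2 q2 formZl formZr conjc_real => /eqP.
rewrite -subr_eq0 -mulrBl mulf_eq0 subr_eq0.
by rewrite (inj_eq (@complexI _)) (negbTE ne) => /eqP.
Qed.

Lemma formPP P : hform P P = (nrm P)%:C.
Proof.
have := formC P P; rewrite /nrm; case: (hform P P) => a b /= [hb].
by congr (_ +i* _); lra.
Qed.

Lemma nrmZ a P : nrm (a *: P) = Normc.normc a ^+ 2 * nrm P.
Proof.
rewrite /nrm formZl formZr formPP; case: a => a b /=.
rewrite sqr_sqrtr ?addr_ge0 ?sqr_ge0//; ring.
Qed.

Lemma nrm_rai x y P : eig x y P ->
  nrm (rai P) = nrm (low P) + (x + y + n%:R) * nrm P.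
Proof.
move=> [p1 p2].
have : hform (rai P) (rai P) =
    hform (low P) (low P) + (x + y + n%:R)%:C * hform P P.
  rewrite form_rail low_rai !formDr p1 p2 !formZr formC form_rail -formC.
  rewrite conjc_real conjc_real conjc_nat !rmorphD /= rmorph_nat; ring.
rewrite !formPP -rmorphM -rmorphD /= => /complexI; exact.
Qed.

Section tower.
Context (x y : R) (x0 : 0 <= x) (y0 : 0 <= y).

(** The sum of the eigenvalues x + y + n + 2 i of the commutator of [low] and [rai] over the first j
    rungs above bidegree (x, y). *)
Definition mu (j : nat) : R := j%:R * (j%:R - 1 + x + y + n%:R).

Let mu_ge0 j : 0 <= mu j.
Proof.
case: j => [|j]; first by rewrite /mu mul0r.
by rewrite /mu mulr_ge0// -natr1 addrK !addr_ge0.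
Qed.

Let muS j : mu j.+1 = mu j + (x + j%:R + (y + j%:R) + n%:R).
Proof. by rewrite /mu -natr1; ring. Qed.

(* For P = rai Q, expanding 0 <= |low P - mu Q|^2 and |P|^2 >= mu |Q|^2 give
   |low P|^2 >= 2 mu |P|^2 - mu^2 |Q|^2 >= mu |P|^2. *)
Lemma nrm_low_rai j P : eig x y P ->
  mu j * nrm (iter j (@rai R n) P) <= nrm (low (iter j (@rai R n) P)).
Proof.
move=> eP; elim: j => [|j IH]; first by rewrite /mu !mul0r E_ge0.
rewrite iterS; set Q := iter j _ P in IH *.
have eQ := eig_iter_rai j eP; rewrite -/Q in eQ.
have h1 := nrm_rai eQ.
have h2 : mu j.+1 * nrm Q <= nrm (rai Q) by rewrite h1 muS mulrDl lerD2r.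
have h3 : nrm (low (rai Q) - (mu j.+1)%:C *: Q) =
    nrm (low (rai Q)) - 2 * mu j.+1 * nrm (rai Q) + mu j.+1 ^+ 2 * nrm Q.
  rewrite {1}/nrm -scaleNr !formDl !formDr !formZl !formZr.
  have -> : hform (low (rai Q)) Q = (nrm (rai Q))%:C.
    by rewrite formC -form_rail formPP conjc_real.
  by rewrite -[hform Q (low _)]form_rail !formPP /=; ring.
have := E_ge0 (low (rai Q) - (mu j.+1)%:C *: Q); rewrite -/(hform _ _) -/(nrm _) h3.
have := ler_wpM2l (mu_ge0 j.+1) h2.
clear h1 h3; move: (nrm _) (nrm _) (nrm Q) (mu _) => a b c m {h2}; lra.
Qed.

Lemma low_iter_rai j P : eig x y P ->
  low (iter j.+1 (@rai R n) P) = iter j.+1 (@rai R n) (low P) +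
    ((mu j.+1)%:C) *: iter j (@rai R n) P.
Proof.
move=> eP; elim: j => [|j IH].
  rewrite /= low_rai -!addrA; congr (_ + _).
  have [-> ->] := eP; rewrite -!scalerDl; congr (_ *: _).
  by rewrite /mu -(rmorph_nat (real_complex R)) -!rmorphD /=; congr (_%:C); ring.
rewrite iterS low_rai IH linearD linearZ /= -!addrA; congr (_ + _).
have [-> ->] := eig_iter_rai j.+1 eP; rewrite -!scalerDl; congr (_ *: _).
by rewrite [mu j.+2]muS -(rmorph_nat (real_complex R)) -!rmorphD /=; congr (_%:C); ring.
Qed.

(** Lowering leads to the rung below over another vector of the same bidegree, so the bound of
    [nrm_low_rai] can be used again. *)
Lemma low_iter_rai_ex j P : eig x y P -> exists2 Q, eig x y Q &
  low (iter j.+1 (@rai R n) P) = iter j (@rai R n) Q.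
Proof.
move=> eP; exists ((mu j.+1)%:C *: P + rai (low P)).
  by apply: eig_lin => //; have := eig_rai (eig_low eP); rewrite !subrK.
have lin i a A B : iter i (@rai R n) (a *: A + B) =
    a *: iter i (@rai R n) A + iter i (@rai R n) B.
  by elim: i => // i IH; rewrite !iterS IH linearP.
by rewrite low_iter_rai// lin -iterSr addrC.
Qed.

(** Induction on i with the bottom vector varying: every lowering costs one factor mu j, mu (j - 1),
    ..., always for the same x and y. *)
Lemma nrm_iter_low_rai i j P : eig x y P -> (i <= j)%N ->
  (\prod_(l < i) mu (j - l)) * nrm (iter j (@rai R n) P) <=
  nrm (iter i (@low R n) (iter j (@rai R n) P)).
Proof.
elim: i j P => [|i IH] j P eP ij; first by rewrite big_ord0 mul1r.
case: j ij => // j ij; rewrite big_ord_recl subn0 [iter i.+1 _ _]iterSr.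
have [Q eQ e] := low_iter_rai_ex j eP.
rewrite e; apply: le_trans (IH j Q eQ ij).
rewrite mulrAC mulrC; apply: ler_wpM2l.
  by apply: prodr_ge0 => l _; exact: mu_ge0.
by rewrite -e; exact: nrm_low_rai.
Qed.

End tower.

Section gaussian_weight.
Context (E' : {scalar MP}) (s : R[i]) (ss : s * s = 2^-1) (sc : conjc s = s)
  (E'_ibp : forall k P, 2 * E' ('X k * P) = E' ('d (tau k) P)).

(** Integration by parts determines a functional on all monomials from its value at 1, and E
    composed with [scl s] obeys the same rule as E', because s^2 = 1/2 accounts for the factor 2. *)
Lemma weight_scl P : E 1 * E' P = E' 1 * E (scl s P).
Proof.
suff key m : E 1 * E' (mpolyX R[i] m) = E' 1 * E (scl s (mpolyX R[i] m)).
  elim/mpolyind: P => [|c m P _ _ IH]; first by rewrite rmorph0 !linear0 !mulr0.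
  by rewrite rmorphD sclZ !linearP /= !mulrDr IH ![_ * (c * _)]mulrCA key.
elim/ltn_ind : {m}(mdeg m) {-2}m (erefl (mdeg m)) => d IH m md.
have [->|m0] := eqVneq m mnm0; first by rewrite mpolyX0 rmorph1 mulrC.
have [k -> dm] := mpolyX_neq0 R m0.
rewrite rmorphM sclX -scalerAl linearZ /= E_ibp mderiv_scl linearZ /= mulrA ss.
have -> : E' ('X k * mpolyX R[i] (mnm_sub m (mnm1 k))) =
    2^-1 * E' ('d (tau k) (mpolyX R[i] (mnm_sub m (mnm1 k)))).
  by rewrite -E'_ibp mulrA mulVf ?mul1r// pnatr_eq0.
rewrite mderivX sclZ !linearZ /= mulrCA [RHS]mulrCA; congr (_ * _).
rewrite mulrCA [RHS]mulrCA; congr (_ * _).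
by apply: (IH _ _ _ (erefl _)); rewrite -md -dm ltnS; exact: mdegB.
Qed.

(** The i-th term is binom(j, i) binom(j + a, i); replacing binom(j, i) by binom(j, j - i) gives
    Vandermonde's convolution. *)
Lemma vandermonde_fact (j a : nat) :
  \sum_(i < j.+1) (\prod_(l < i) ((j - l)%:R * (j - l + a)%:R)) / i`!%:R ^+ 2 =
  'C(j + j + a, j)%:R :> R.
Proof.
have ff (b i : nat) : (i <= b)%N -> \prod_(l < i) (b - l)%:R = 'C(b, i)%:R * i`!%:R :> R.
  by move=> ib; rewrite -natrM bin_ffact ffact_prod natr_prod.
rewrite -addnA addnC -binomial.Vandermonde natr_sum; apply: eq_bigr => i _.
have ij : (i <= j)%N by rewrite -ltnS.
rewrite big_split /= ff// (eq_bigr (fun l : 'I_i => (j + a - l)%:R : R)); last first.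
  by move=> l _; rewrite addnBAC// (leq_trans _ ij)// ltnW.
rewrite ff ?(leq_trans ij) ?leq_addr// natrM (bin_sub ij).
by field; rewrite pnatr_eq0 -lt0n fact_gt0.
Qed.

(** Pythagoras: different powers of [low] send P to different bidegrees, so the cross terms
    vanish. *)
Lemma form_expm k m P K : fock k m P ->
  hform (expm K P) (expm K P) =
    \sum_(i < K) ((i`!%:R ^- 2) * nrm (iter i (@low R n) P))%:C.
Proof.
move=> fP; rewrite /expm form_suml; apply: eq_bigr => i _.
rewrite form_sumr (bigD1 i)//= [X in _ + X]big1 ?addr0; last first.
  move=> j ji; rewrite formZl formZr (@form_eig (k%:R - i%:R) (m%:R - i%:R)
    (k%:R - j%:R) (m%:R - j%:R)) ?mulr0//.
  - exact/eig_iter_low/fock_eig.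
  - exact/eig_iter_low/fock_eig.
  - by rewrite (inj_eq (addrI _)) (inj_eq oppr_inj) eqr_nat eq_sym ji.
have -> : (-1) ^+ i / i`!%:R = ((-1) ^+ i / i`!%:R : R)%:C.
  by rewrite rmorphM rmorphXn rmorphN1 fmorphV rmorph_nat.
rewrite formZl formZr formPP mulrA conjc_real -!rmorphM; congr (_%:C); congr (_ * _).
by rewrite mulrACA -expr2 sqrr_sign mul1r -invfM -expr2.
Qed.

(** Combines the dilation, [form_expm], the lower bound along the tower and the Vandermonde sum. The
    number a = k + m + n - 1 is chosen so that mu t = t (t + a) for t > 0. *)
Lemma weight_rai e e' k m j a P Q : E 1 = e%:C -> E' 1 = e'%:C -> 0 <= e' ->
  fock k m P -> (k + m + n = a.+1)%N -> Q = iter j (@rai R n) P ->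
  e' * (2 ^- (j + j + (k + m)) * 'C(j + j + a, j)%:R * nrm Q) <=
  e * complex.Re (E' (Q * star Q)).
Proof.
move=> He He' e'0 fP ka QE.
set d := (j + k + (j + m))%N.
have fQ : fock (j + k) (j + m) Q by rewrite QE; exact: fock_iter_rai.
have : E 1 * E' (Q * star Q) = E' 1 * (2 ^- d * hform (expm d.+1 Q) (expm d.+1 Q)).
  rewrite weight_scl; congr (_ * _).
  rewrite rmorphM (scl_star _ sc) -/(hform _ _) (scl_fock ss fQ (ltnSn d)).
  by rewrite formZl formZr rmorphXn /= sc mulrA -exprMn ss exprVn.
rewrite He He' (form_expm _ fQ) -rmorph_sum -(rmorph_nat (real_complex R)).
rewrite -rmorphXn -fmorphV -!rmorphM /= => h.
have -> : e * complex.Re (E' (Q * star Q)) = complex.Re (e%:C * E' (Q * star Q)).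
  by case: (E' _) => u v /=; ring.
rewrite h /= -mulrA; apply: ler_wpM2l => //.
rewrite (_ : j + j + (k + m) = d)%N ?/d; last by lia.
apply: ler_wpM2l; first by rewrite invr_ge0 exprn_ge0.
rewrite -vandermonde_fact mulr_suml.
have jd : (j.+1 <= d.+1)%N by rewrite /d; lia.
(* The sum for [expm] has more terms than the Vandermonde sum; those with i > j are nonnegative and
   are dropped. *)
rewrite (big_ord_widen _ (fun i =>
  \prod_(l < i) ((j - l)%:R * (j - l + a)%:R) / i`!%:R ^+ 2 * nrm Q) jd) big_mkcond /=.
apply: ler_sum => i _; case: ifPn => [ij|_]; last first.
  by rewrite mulr_ge0 ?E_ge0// invr_ge0 exprn_ge0.
rewrite mulrAC [leRHS]mulrC ler_wpM2r// ?invr_ge0 ?exprn_ge0//.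
rewrite ltnS in ij.
have := nrm_iter_low_rai (ler0n R k) (ler0n R m) (fock_eig fP) ij.
rewrite -QE; apply: le_trans.
rewrite ler_wpM2r ?E_ge0// le_eqVlt; apply/orP; left; apply/eqP; apply: eq_bigr => l _.
(* The factor j - l must be positive here: mu contains a real j - l - 1, compared with natural
   numbers. *)
rewrite /mu; congr (_ * _).
have : (j - l > 0)%N by rewrite subn_gt0 (leq_trans (ltn_ord l)).
case: (j - l)%N => // t _.
have -> : (t.+1 + a = t + (k + m + n))%N by rewrite ka addnS addSn.
by rewrite !natrD -natr1; ring.
Qed.

End gaussian_weight.

End hform.

(** * Orthonormalisation and words in the creation operators *)

Section orthonormal_families.
Context (R : realType) (n : nat).

Local Notation MP := (mpoly (n + n) R[i]).
Local Notation "''X' k" := (mpolyX R[i] (mnm1 k)) (at level 8, k at level 2).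
Local Notation "''d' k" := (@mderiv (n + n) R[i] k) (at level 8, k at level 2).
Implicit Types P Q : MP.

Context (E : {scalar MP})
  (E_ibp : forall k P, E ('X k * P) = E ('d (tau k) P))
  (E_star : forall P, E (star P) = conjc (E P))
  (E_ge0 : forall P, 0 <= complex.Re (E (P * star P))).

(** The predicate [S] lets the new vectors keep a prescribed form, later an image under a power of
    [rai]. Independence is stated through the norm since E is only assumed nonnegative. The span
    clause serves the induction: the new vector is a combination with last coefficient 1, so
    independence makes its norm nonzero. *)
Lemma gram_schmidt (S : MP -> Prop) (v : nat -> MP) N :
  (forall a P Q, S P -> S Q -> S (a *: P + Q)) ->
  (forall i, (i < N)%N -> S (v i)) ->
  (forall c : nat -> R[i], nrm E (\sum_(i < N) c i *: v i) = 0 ->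
    forall i, (i < N)%N -> c i = 0) ->
  exists e : nat -> MP,
  [/\ forall i, (i < N)%N -> S (e i),
      forall i j, (i < N)%N -> (j < N)%N -> hform E (e i) (e j) = (i == j)%:R &
      forall i, (i < N)%N ->
        exists c : nat -> R[i], e i = \sum_(j < N) c j *: v j].
Proof.
move=> Slin; elim: N => [_ _|N IH Sv indep]; first by exists (fun=> 0); split.
have [i iN|c c0 i iN|e [Se eon espan]] := IH.
- by apply: Sv; exact: ltnW.
- pose c' i := if (i < N)%N then c i else 0.
  have := indep c'; rewrite big_ord_recr /= /c' ltnn scale0r addr0.
  rewrite (eq_bigr (fun i : 'I_N => c i *: v i)); last by move=> k _; rewrite ltn_ord.
  by move=> /(_ c0 i); rewrite iN; apply; exact: ltnW.
have S0 : S 0 by have := Slin (-1) _ _ (Sv N (ltnSn N)) (Sv N (ltnSn N));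
  rewrite scaleN1r addNr.
pose a i := - hform E (v N) (e i).
pose w := v N + \sum_(i < N) a i *: e i.
have we j : (j < N)%N -> hform E w (e j) = 0.
  move=> jN; rewrite /w formDl form_suml (bigD1 (Ordinal jN))//= formZl eon// eqxx mulr1.
  rewrite big1 ?addr0 ?subrr// => i ij; rewrite formZl eon//.
  by rewrite (_ : (i == j :> nat) = false) ?mulr0//; apply/negbTE; move: ij; rewrite -val_eqE.
have Sw : S w.
  rewrite /w addrC.
  elim/big_rec : _ => [|i P _ SP]; first by rewrite add0r; exact: Sv.
  by rewrite -addrA; apply: Slin => //; exact: Se.
have [c wc cN] : exists2 c : nat -> R[i], w = \sum_(j < N.+1) c j *: v j & c N = 1.
  have /choice[f fE] : forall i : 'I_N, exists c : nat -> R[i], e i = \sum_(j < N) c j *: v j.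
    by move=> i; exact: espan.
  exists (fun j => if (j < N)%N then \sum_(i < N) a i * f i j else 1); last by rewrite ltnn.
  rewrite big_ord_recr /= ltnn scale1r /w addrC; congr (_ + _).
  rewrite (eq_bigr (fun i : 'I_N => \sum_(j < N) (a i * f i j) *: v j)); last first.
    by move=> i _; rewrite fE scaler_sumr; apply: eq_bigr => j _; rewrite scalerA.
  rewrite exchange_big /=; apply: eq_bigr => j _; by rewrite ltn_ord scaler_suml.
have w0 : nrm E w != 0.
  apply/eqP => w0; have := indep c; rewrite -wc => /(_ w0 N (ltnSn N)) /eqP.
  by rewrite cN oner_eq0.
have wgt : 0 < nrm E w by rewrite lt_neqAle eq_sym w0 E_ge0.
pose r := ((Num.sqrt (nrm E w))^-1)%:C : R[i].
exists (fun i => if (i < N)%N then e i else r *: w); split.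
- move=> i iN; case: ifPn => [|_]; first exact: Se.
  by rewrite -[_ *: _]addr0; apply: Slin.
- have ew j : (j < N)%N -> hform E (e j) w = 0.
    by move=> jN; rewrite formC// we// conjc0.
  move=> i j; rewrite !ltnS => iN jN.
  have [i'|i'] := ltnP i N; have [j'|j'] := ltnP j N.
  + exact: eon.
  + by rewrite formZr// ew// mulr0 ltn_eqF// (leq_trans i').
  + by rewrite formZl we// mulr0 gtn_eqF// (leq_trans j').
  + rewrite (_ : i == j); last by rewrite eqn_leq (leq_trans iN j') (leq_trans jN i').
    rewrite formZl formZr// formPP// conjc_real -!rmorphM /= mulrA -invfM -expr2.
    by rewrite sqr_sqrtr ?ltW// mulVf.
- move=> i _; case: ifPn => [iN|_].
    have [d ->] := espan i iN; exists (fun j => if (j < N)%N then d j else 0).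
    rewrite big_ord_recr /= ltnn scale0r addr0; apply: eq_bigr => j _.
    by rewrite ltn_ord.
  exists (fun j => r * c j); rewrite wc scaler_sumr; apply: eq_bigr => j _.
  by rewrite scalerA.
Qed.

Definition fword (ks : seq 'I_(n + n)) : MP := foldr (@cr R n) 1 ks.

Definition isl (k : 'I_(n + n)) := (k < n)%N.

Lemma fock_fword ks : fock (count isl ks) (count (predC isl) ks) (fword ks).
Proof.
elim: ks => [|k ks IH]; first exact: fock_vac.
rewrite /= /isl; case: (ord2P k) => -[i ->] /=.
  by rewrite ltn_ord add1n add0n; exact: fock_crl.
by rewrite ltnNge leq_addr add1n add0n; exact: fock_crr.
Qed.

Lemma num_fword k ks : cr k ('d k (fword ks)) = (count_mem k ks)%:R *: fword ks.
Proof.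
elim: ks => [|l ks IH].
  by rewrite scale0r /fword /= -(mpolyC1 _ R[i]) mderivC linear0.
rewrite /= mderiv_cr linearD linearZ /= cr_comm IH linearZ /= natrD scalerDl addrC.
by rewrite eq_sym; have [->|] := eqVneq k l; rewrite ?scale0r.
Qed.

(** The operator [cr k] after ['d k] is symmetric and has the number of letters k as its eigenvalue
    on a word. *)
Lemma form_fword k ks ks' : count_mem k ks != count_mem k ks' ->
  hform E (fword ks) (fword ks') = 0.
Proof.
move=> ne; have : hform E (cr k ('d k (fword ks))) (fword ks') =
    hform E (fword ks) (cr k ('d k (fword ks'))) by rewrite form_crl// form_crr.
rewrite !num_fword formZl formZr// conjc_nat => /eqP.
by rewrite -subr_eq0 -mulrBl mulf_eq0 subr_eq0 eqr_nat (negbTE ne) => /eqP.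
Qed.

(** By the commutation relation, |cr k P|^2 = |P|^2 + |'d k P|^2. *)
Lemma nrm_fword ks : nrm E 1 <= nrm E (fword ks).
Proof.
elim: ks => // k ks IH; apply: le_trans IH _; rewrite /= {2}/nrm form_crl//.
by rewrite mderiv_cr eqxx scale1r formDr// form_crr// raddfD /= lerDr E_ge0.
Qed.

Lemma nrm_rai_ge (x y : R) P : 0 <= x -> 0 <= y -> eig x y P ->
  n%:R * nrm E P <= nrm E (rai P).
Proof.
move=> x0 y0 eP; rewrite (nrm_rai E_ibp E_star eP).
have := E_ge0 (low P); rewrite -/(hform _ _ _) -/(nrm _ _).
have := E_ge0 P; rewrite -/(hform _ _ _) -/(nrm _ _).
nra.
Qed.

(** For n > 0 this shows that powers of [rai] send no vector of a fixed bidegree with nonzero norm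
    to one of norm 0, hence preserve independence. *)
Lemma nrm_iter_rai_ge (x y : R) j P : 0 <= x -> 0 <= y -> eig x y P ->
  n%:R ^+ j * nrm E P <= nrm E (iter j (@rai R n) P).
Proof.
move=> x0 y0 eP; elim: j => [|j IH]; first by rewrite mul1r.
have := @nrm_rai_ge (x + j%:R) (y + j%:R) _ _ _ (eig_iter_rai j eP).
rewrite !addr_ge0// => /(_ isT isT); apply: le_trans.
by rewrite exprS -mulrA ler_wpM2l.
Qed.

End orthonormal_families.

(** * Many orthonormal states in one bidegree *)

Section blocks.
Context (R : realType) (n' : nat).
Let n := n'.+1.

Local Notation MP := (mpoly (n + n) R[i]).
Local Notation "''X' k" := (mpolyX R[i] (mnm1 k)) (at level 8, k at level 2).
Local Notation "''d' k" := (@mderiv (n + n) R[i] k) (at level 8, k at level 2).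
Implicit Types P Q : MP.

Context (E : {scalar MP})
  (E_ibp : forall k P, E ('X k * P) = E ('d (tau k) P))
  (E_star : forall P, E (star P) = conjc (E P))
  (E_ge0 : forall P, 0 <= complex.Re (E (P * star P)))
  (E1_gt0 : 0 < complex.Re (E 1)).

(** The first n - 1 letters have free multiplicities below d, and the last letter pads the word to
    length q; so the degree is fixed while d^(n-1) words remain. *)
Definition pad_word (f : 'I_n -> 'I_(n + n)) q d (e : {ffun 'I_n' -> 'I_d}) :=
  \big[cat/[::]]_(i < n') nseq (e i) (f (widen_ord (leqnSn n') i)) ++
  nseq (q - \sum_i e i) (f ord_max).

Lemma count_pad_word a f q d e : count a (@pad_word f q d e) =
  (\sum_i a (f (widen_ord (leqnSn n') i)) * e i +
   a (f ord_max) * (q - \sum_i e i))%N.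
Proof.
rewrite /pad_word count_cat count_nseq; congr (_ + _)%N.
rewrite (big_morph (count a) (id1 := 0%N) (op1 := addn))//; last exact: count_cat.
by apply: eq_bigr => i _; rewrite count_nseq.
Qed.

Lemma sum_ffun_le d (e : {ffun 'I_n' -> 'I_d}) : (\sum_i e i <= n' * d)%N.
Proof.
have -> : (n' * d = \sum_(i < n') d)%N by rewrite sum_nat_const card_ord.
by apply: leq_sum => i _; exact: ltnW.
Qed.

Lemma count_pad_word_all (a : pred _) f q d e : (n' * d <= q)%N -> (forall i, a (f i)) ->
  count a (@pad_word f q d e) = q.
Proof.
move=> dq af; rewrite count_pad_word af mul1n; under eq_bigr do rewrite af mul1n.
by rewrite subnKC// (leq_trans (sum_ffun_le e)).
Qed.

Lemma count_pad_word_none (a : pred _) f q d e : (forall i, a (f i) = false) ->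
  count a (@pad_word f q d e) = 0%N.
Proof.
move=> af; rewrite count_pad_word af mul0n addn0 big1// => i _.
by rewrite af.
Qed.

Lemma count_pad_word_mem (f : 'I_n -> 'I_(n + n)) q d e i : injective f ->
  count_mem (f (widen_ord (leqnSn n') i)) (@pad_word f q d e) = e i.
Proof.
move=> fi; rewrite count_pad_word (bigD1 i)//= eqxx mul1n big1 ?addn0.
  rewrite (inj_eq fi) -val_eqE /= gtn_eqF// mul0n addn0//.
by move=> j /negbTE; rewrite (inj_eq fi) -!val_eqE /= => ->.
Qed.

Definition block_index d := ({ffun 'I_n' -> 'I_d} * {ffun 'I_n' -> 'I_d})%type.

Definition block_word q p d (t : block_index d) :=
  pad_word (@lshift n n) q t.1 ++ pad_word (@rshift n n) p t.2.

Lemma fock_block_word q p d t : (n' * d <= q)%N -> (n' * d <= p)%N ->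
  fock q p (fword R (@block_word q p d t)).
Proof.
move=> dq dp; have := fock_fword R (@block_word q p d t).
have l i : isl (@lshift n n i) = true by rewrite /isl /= ltn_ord.
have r i : isl (@rshift n n i) = false by rewrite /isl /= ltnNge leq_addr.
rewrite /block_word !(count_cat _ (pad_word _ _ _)).
rewrite (count_pad_word_all (f := @lshift n n) _ dq l).
rewrite (count_pad_word_none (f := @rshift n n) _ _ r).
rewrite (count_pad_word_none (f := @lshift n n)) ?add0n ?addn0; last first.
  by move=> i /=; rewrite l.
by rewrite (count_pad_word_all (f := @rshift n n) _ dp)// => i /=; rewrite r.
Qed.

Lemma block_word_neq q p d t t' : t != t' ->
  exists k, count_mem k (@block_word q p d t) != count_mem k (block_word q p t').
Proof.
rewrite -pair_eqE negb_and => /orP[] /eqP ne.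
  have [i ni] : exists i, t.1 i != t'.1 i.
    by apply/existsP; apply: contra_notT ne => /existsPn h; apply/ffunP => i;
      apply/eqP; rewrite -[_ == _]negbK h.
  exists (lshift n (widen_ord (leqnSn n') i)); rewrite !(count_cat _ (pad_word _ _ _)).
  rewrite !count_pad_word_mem; [|exact: lshift_inj..].
  rewrite !(count_pad_word_none (f := @rshift n n)) ?addn0//.
    by move=> j /=; rewrite eq_rlshift.
  by move=> j /=; rewrite eq_rlshift.
have [i ni] : exists i, t.2 i != t'.2 i.
  by apply/existsP; apply: contra_notT ne => /existsPn h; apply/ffunP => i;
    apply/eqP; rewrite -[_ == _]negbK h.
exists (rshift n (widen_ord (leqnSn n') i)); rewrite !(count_cat _ (pad_word _ _ _)).
rewrite !count_pad_word_mem; [|exact: rshift_inj..].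
rewrite !(count_pad_word_none (f := @lshift n n)) ?add0n//.
  by move=> j /=; rewrite eq_lrshift.
by move=> j /=; rewrite eq_lrshift.
Qed.

(** The words of one bidegree are orthogonal and nonzero. Their images under [rai] to the power j
    need not be orthogonal, but they are independent, and Gram-Schmidt keeps them in the image. *)
Lemma block_family q p d j : (0 < d)%N -> (n' * d <= q)%N -> (n' * d <= p)%N ->
  exists e : nat -> MP,
  (forall i, (i < d ^ n' * d ^ n')%N ->
     exists2 P, fock q p P & e i = iter j (@rai R n) P) /\
  (forall i l, (i < d ^ n' * d ^ n')%N -> (l < d ^ n' * d ^ n')%N ->
     hform E (e i) (e l) = (i == l)%:R).
Proof.
case: d => // d _ dq dp; set d1 := d.+1 in dq dp *.
set N := (d1 ^ n' * d1 ^ n')%N.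
have cN : N = #|{: block_index d1}| by rewrite card_prod !card_ffun !card_ord.
pose t0 : block_index d1 := ([ffun=> ord0], [ffun=> ord0]).
pose w i := fword R (block_word q p (nth t0 (enum {: block_index d1}) i)).
have fw i : fock q p (w i) by exact: fock_block_word.
pose S P := exists2 Q, fock q p Q & P = iter j (@rai R n) Q.
have lin a A B : iter j (@rai R n) (a *: A + B) =
    a *: iter j (@rai R n) A + iter j (@rai R n) B.
  by elim: (j) => // i IH; rewrite !iterS IH linearP.
have lin0 : iter j (@rai R n) 0 = 0.
  by elim: (j) => // i IH; rewrite !iterS IH linear0.
have [| | |e [h1 h2 _]] := @gram_schmidt R n E E_star E_ge0 S (fun i => iter j (@rai R n) (w i)) N.
- move=> a P Q [P' fP ->] [Q' fQ ->]; exists (a *: P' + Q'); first exact: fock_lin.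
  by rewrite lin.
- by move=> i _; exists (w i).
- move=> c.
  have -> : \sum_(i < N) c i *: iter j (@rai R n) (w i) =
      iter j (@rai R n) (\sum_(i < N) c i *: w i).
    elim/big_rec2 : _ => [|i P Q _ ->]; first by rewrite lin0.
    by rewrite lin.
  have fs : fock q p (\sum_(i < N) c i *: w i) by apply: fock_sum => i; exact: fw.
  (* A combination of images with norm 0 comes from a combination of words with norm 0, and words
     are orthogonal. *)
  have := nrm_iter_rai_ge E_ibp E_star E_ge0 j (ler0n _ _) (ler0n _ _) (fock_eig fs).
  move=> /[swap] -> h.
  have {h} : nrm E (\sum_(i < N) c i *: w i) <= 0.
    by rewrite -(@pmulr_rle0 _ (n%:R ^+ j)) ?exprn_gt0 ?ltr0n.
  have -> : nrm E (\sum_(i < N) c i *: w i) =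
      \sum_(i < N) Normc.normc (c i) ^+ 2 * nrm E (w i).
    rewrite {1}/nrm form_suml (raddf_sum (@complex.Re R : {additive _ -> _})) /=.
    apply: eq_bigr => i _; rewrite -nrmZ// form_sumr// (bigD1 i)//= big1 ?addr0//.
    move=> l li; rewrite formZl formZr//.
    have [k kne] : exists k, count_mem k (block_word q p (nth t0 (enum {: block_index d1}) i))
       != count_mem k (block_word q p (nth t0 (enum {: block_index d1}) l)).
      by apply: block_word_neq; rewrite nth_uniq ?enum_uniq// -?cardE -?cN// eq_sym.
    by rewrite (form_fword E_ibp E_star kne) !mulr0.
  have pos i : 0 <= Normc.normc (c i) ^+ 2 * nrm E (w i).
    by rewrite mulr_ge0 ?sqr_ge0 ?E_ge0.
  move=> le0 i iN; have := psumr_eq0P (fun (l : 'I_N) (_ : true) => pos l).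
  have /eqP s0 : \sum_(i < N) Normc.normc (c i) ^+ 2 * nrm E (w i) == 0.
    by rewrite eq_le le0 sumr_ge0.
  move=> /(_ s0 (Ordinal iN) isT) /= /eqP; rewrite mulf_eq0 sqrf_eq0.
  have /gt_eqF -> : 0 < nrm E (w i).
    apply: lt_le_trans (nrm_fword E_ibp E_star E_ge0 _).
    by rewrite /nrm /hform rmorph1 mulr1.
  by rewrite orbF => /eqP /Normc.eq0_normc.
by exists e; split.
Qed.

End blocks.

(** * A central binomial estimate *)

Section binomial_bound.
Context (R : realType).

Lemma central_binomialS (m : nat) :
  'C(m.+1 + m.+1, m.+1)%:R / 2 ^+ (m.+1 + m.+1) =
  'C(m + m, m)%:R / 2 ^+ (m + m) * ((2 * m%:R + 1) / (2 * (m%:R + 1))) :> R.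
Proof.
have := mul_bin_diag (m + m).+2 m.
have := mul_bin_down (m + m).+1 m.
rewrite (_ : (m + m).+1 - m = m.+1)%N /=; last by lia.
rewrite addnS addSn => /(congr1 (fun k => k%:R : R)) + /(congr1 (fun k => k%:R : R)).
rewrite !natrM -[(m + m).+2%:R]natr1 -[(m + m).+1%:R]natr1 -[m.+1%:R]natr1 natrD !exprS.
have v0 : (2 : R) ^+ (m + m) != 0 by rewrite expf_neq0// pnatr_eq0.
have x1 : (m%:R + 1 : R) != 0 by rewrite natr1 pnatr_eq0.
move: ('C(_, _)%:R) ('C(_, _)%:R) ('C(_, _)%:R) (2 ^+ _) v0 (m%:R) x1.
move=> c0 c1 c2 p p0 x x1 h1 h2.
have -> : c0 = 2 * c1 by apply: (mulfI x1); rewrite -h2; ring.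
have -> : c1 = (x + x + 1) * c2 / (x + 1) by rewrite h1 mulrC mulKf.
by field; rewrite p0 x1.
Qed.

(** The quantity on the right equals 1 at j = 1 and is nondecreasing, as (2x + 1)^2 is at least 4x
    (x + 1). *)
Lemma central_binomial_lower (j : nat) : (0 < j)%N ->
  1 <= ('C(j + j, j)%:R / 2 ^+ (j + j)) ^+ 2 * (4 * j%:R) :> R.
Proof.
case: j => // j _; elim: j => [|j]; first by rewrite bin1; lra.
rewrite (central_binomialS j.+1).
move: ('C(j.+1 + j.+1, j.+1)%:R / 2 ^+ (j.+1 + j.+1) : R) => b.
have mR : 0 < (j.+1%:R : R) by rewrite ltr0n.
rewrite -[j.+2%:R]natr1; move: (j.+1%:R) mR => x x0 IH.
have h : 4 * x <= ((2 * x + 1) / (2 * (x + 1))) ^+ 2 * (4 * (x + 1)).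
  by rewrite expr_div_n mulrAC ler_pdivlMr ?exprn_gt0//; nra.
apply: le_trans IH _; rewrite exprMn -[leRHS]mulrA; apply: ler_wpM2l => //.
exact: sqr_ge0.
Qed.

(** Raising a by one from t multiplies the normalised binomial by (2j + t + 1) / (2 (j + t + 1)).
    Its inverse is 1 + (t + 1) / (2j + t + 1), at most exp(a / (2j)) while t < a. *)
Lemma binomial_lower (j a : nat) : (0 < j)%N ->
  'C(j + j, j)%:R / 2 ^+ (j + j) * expR (- (a * a)%:R / (2 * j%:R)) <=
  'C(j + j + a, j)%:R / 2 ^+ (j + j + a) :> R.
Proof.
move=> j0; have jR : 0 < (j%:R : R) by rewrite ltr0n.
suff key t : (t <= a)%N ->
    'C(j + j, j)%:R / 2 ^+ (j + j) * expR (- (t * a)%:R / (2 * j%:R)) <=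
    'C(j + j + t, j)%:R / 2 ^+ (j + j + t) :> R by exact: key.
elim: t => [|t IH] ta; first by rewrite mul0n oppr0 mul0r expR0 mulr1 addn0.
have {IH} := IH (ltnW ta); set b0 := _ / _ => IH.
have b0_ge0 : 0 <= b0 by rewrite divr_ge0// exprn_ge0.
have h : ('C(j + j + t.+1, j)%:R / 2 ^+ (j + j + t.+1) : R) =
   'C(j + j + t, j)%:R / 2 ^+ (j + j + t) * ((2 * j%:R + t.+1%:R) / (2 * (j%:R + t.+1%:R))).
  have := mul_bin_down (j + j + t).+1 j.
  rewrite (_ : (j + j + t).+1 - j = j + t.+1)%N /=; last by lia.
  rewrite (addnS (j + j) t) => /(congr1 (fun k => k%:R : R)).
  rewrite !natrM exprS -(addnS (j + j) t).
  have u0 : (j%:R + t.+1%:R : R) != 0 by rewrite -natrD pnatr_eq0 addnS.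
  have v0 : (2 : R) ^+ (j + j + t) != 0 by rewrite expf_neq0// pnatr_eq0.
  rewrite !natrD; move: ('C(_, _)%:R) ('C(_, _)%:R) (2 ^+ _) v0 (j%:R) (t.+1%:R) u0.
  move=> c0 c1 p p0 x y u0 hC; apply: (mulfI u0).
  by rewrite !mulrA -hC; field; rewrite u0 p0.
rewrite h mulSn natrD opprD mulrDl expRD mulrCA [leLHS]mulrC.
apply: ler_pM => //; rewrite ?mulr_ge0 ?expR_ge0//.
have t1 : 1 <= (t.+1%:R : R) by rewrite ler1n.
have ta' : (t.+1%:R : R) <= a%:R by rewrite ler_nat.
move: (t.+1%:R) (a%:R) (j%:R) t1 ta' jR => y z x y1 yz x0.
have F0 : 0 < (2 * x + y) / (2 * (x + y)) by apply: divr_gt0; lra.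
rewrite mulNr expRN -[leRHS]invrK lef_pV2 ?posrE ?expR_gt0 ?invr_gt0//.
apply: le_trans (expR_ge1Dx _); rewrite invf_div ler_pdivrMr; last by lra.
have h1 : z / (2 * x) * (2 * x) = z by rewrite divfK//; apply: lt0r_neq0; lra.
have h2 : 0 <= z / (2 * x) by apply: divr_ge0; lra.
by move: (z / (2 * x)) h1 h2 => u h1 h2; nra.
Qed.

(** With j = r^2 and a at most 5r, the exponent a^2 / (2j) is at most 25/2 and the central factor at
    least 1 / (2r). *)
Lemma square_binomial_lower (r a : nat) : (0 < r)%N -> (a <= 5 * r)%N ->
  expR (- (25 / 2)) / (2 * r%:R) <=
  'C(r * r + r * r + a, r * r)%:R / 2 ^+ (r * r + r * r + a) :> R.
Proof.
move=> r0 ar; have jr : (0 < r * r)%N by rewrite muln_gt0 r0.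
have rR : 0 < (r%:R : R) by rewrite ltr0n.
apply: le_trans (binomial_lower a jr); rewrite mulrC.
apply: ler_pM; rewrite ?expR_ge0 ?invr_ge0 ?mulr_ge0//.
  have := central_binomial_lower jr; set b := _ / _ => h.
  have b0 : 0 <= b by rewrite divr_ge0// exprn_ge0.
  rewrite -[leLHS]mul1r ler_pdivrMr ?mulr_gt0//.
  rewrite -(@ler_pXn2r _ 2)// ?nnegrE ?mulr_ge0// expr1n.
  by apply: le_trans h _; rewrite natrM le_eqVlt; apply/orP; left; apply/eqP; ring.
rewrite ler_expR mulNr lerN2 ler_pdivrMr; last by rewrite mulr_gt0// ltr0n.
have : (a%:R : R) <= 5 * r%:R by rewrite -natrM ler_nat.
have a0 : 0 <= (a%:R : R) by [].
rewrite !natrM; nra.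
Qed.

End binomial_bound.

(** * Integration on real row vectors and on C^n *)

Lemma rV_norm_le (R : realType) n (x : 'rV[R]_n) (e : R) :
  0 <= e -> (forall i, `|x ord0 i| <= e) -> `|x| <= e.
Proof.
move=> e0 xe; change (mx_norm x <= e).
have [->//|/mx_norm_neq0[[i j] ->] /=] := eqVneq (mx_norm x) 0.
by rewrite (ord1 i).
Qed.

Section continuous_measurable.
Context (R : realType) (n : nat).

Let rnd (k : nat) (t : R) : int := Num.floor (k.+1%:R * t).

Let approx (k : nat) (x : 'rV[R]_n) : 'rV[R]_n :=
  \row_i ((rnd k (x ord0 i))%:~R / k.+1%:R).

Let rnd_bound k t : `|t - (rnd k t)%:~R / k.+1%:R| <= k.+1%:R^-1.
Proof.
have k0 : 0 < (k.+1%:R : R) by rewrite ltr0n.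
rewrite -(@ler_pM2l _ k.+1%:R)// -[X in X * `|_|]gtr0_norm// -normrM divff ?gt_eqF//.
rewrite mulrBr mulrCA divff ?gt_eqF// mulr1 ger0_norm.
  by rewrite lerBlDl ltW// -intrD1 floorD1_gt.
by rewrite subr_ge0 floor_le.
Qed.

Let approx_bound k x : `|x - approx k x| <= k.+1%:R^-1.
Proof.
apply: rV_norm_le; first by rewrite invr_ge0.
by move=> i; rewrite !mxE; exact: rnd_bound.
Qed.

Let approx_cvg x : approx k x @[k --> \oo] --> x.
Proof.
apply/cvgrPdist_le => /= e e0; near=> k.
apply: le_trans (approx_bound k x) _.
by apply/ltW; near: k; exact: (near_infty_natSinv_lt (PosNum e0)).
Unshelve. all: by end_near. Qed.

Let measurable_rnd k (m : int) : measurable [set t : R | rnd k t = m].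
Proof.
have k0 : 0 < (k.+1%:R : R) by rewrite ltr0n.
rewrite (_ : [set _ | _] = `[m%:~R / k.+1%:R, (m + 1)%:~R / k.+1%:R[%classic)//.
apply/seteqP; split => t /=; rewrite in_itv /= ler_pdivrMr// ltr_pdivlMr// mulrC.
  by move=> <-; rewrite floor_le floorD1_gt.
by move=> /floor_def.
Qed.

Let measurable_cell k (m : 'rV[int]_n) :
  measurable [set x : 'rV[R]_n | \row_i rnd k (x ord0 i) = m].
Proof.
rewrite (_ : [set _ | _] =
    \bigcap_(i in [set: 'I_n]) ((fun x : 'rV[R]_n => x ord0 i) @^-1` [set t | rnd k t = m ord0 i])).
  apply: fin_bigcap_measurable => // i _.
  rewrite -[X in measurable X]setTI; apply: measurable_coord_rV => //.
  exact: measurable_rnd.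
apply/seteqP; split => x /=.
  by move=> <- i _ /=; rewrite mxE.
by move=> h; apply/rowP => i; rewrite mxE; exact: h.
Qed.

(** Here the sigma-algebra is generated by coordinates, not by open sets. Rounding the coordinates
    to multiples of 1/(k + 1) turns f into a function constant on countably many measurable cells,
    and f is the pointwise limit of these. *)
Lemma continuous_measurable_Cn (f : Cn R n -> R) : continuous f ->
  measurable_fun [set: Cn R n] (f : _ -> measurableTypeR R).
Proof.
move=> cf.
pose g k (z : Cn R n) := f (approx k z.1, approx k z.2).
apply: (@measurable_fun_cvg _ _ _ _ g); last first.
  move=> z _; apply: (@cvg_comp _ _ _ (fun k => (approx k z.1, approx k z.2)) f _ (nbhs z)).
    case: z => x y.
    exact: (@cvg_pair _ _ _ _ (nbhs x) (nbhs y) _ _ _ _ _ (@approx_cvg x) (@approx_cvg y)).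
  exact: cf.
move=> k _ B mB; rewrite setTI.
pose h (m : 'rV[int]_n) : 'rV[R]_n := \row_i ((m ord0 i)%:~R / k.+1%:R).
pose cell (m : 'rV[int]_n * 'rV[int]_n) : set (Cn R n) :=
  if f (h m.1, h m.2) \in B then
    [set x : 'rV[R]_n | \row_i rnd k (x ord0 i) = m.1] `*`
    [set x : 'rV[R]_n | \row_i rnd k (x ord0 i) = m.2]
  else set0.
rewrite (_ : _ @^-1` _ = \bigcup_m cell m).
  apply: countable_bigcupT_measurable => // m; rewrite /cell.
  by case: ifPn => // _; apply: measurableX; exact: measurable_cell.
have hE x : approx k x = h (\row_i rnd k (x ord0 i)).
  by apply/rowP => i; rewrite !mxE.
apply/seteqP; split => z.
  rewrite /g /= => Bz.
  exists (\row_i rnd k (z.1 ord0 i), \row_i rnd k (z.2 ord0 i)) => //.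
  by rewrite /cell /= -!hE mem_set.
move=> [[m1 m2] _]; rewrite /cell /=; case: ifPn => // /set_mem Bm [/= z1 z2].
by rewrite /g /preimage /= !hE z1 z2.
Qed.

End continuous_measurable.

Section weight.
Context (R : realType).

(** The integrable majorant used throughout: a product, so that it splits along coordinates, with
    decay slow enough to dominate any polynomial times a Gaussian. *)
Definition om n (x : 'rV[R]_n) : R := \prod_i (oneDsqr (x ord0 i))^-1.

Lemma om_gt0 n (x : 'rV[R]_n) : 0 < om x.
Proof.
by apply: prodr_gt0 => i _; rewrite invr_gt0 (lt_le_trans ltr01)// oneDsqr_ge1.
Qed.

Lemma om_consrV n t (v : 'rV[R]_n) :
  om (consrV (t, v)) = (oneDsqr t)^-1 * om v.
Proof.
rewrite /om big_ord_recl mxE unlift_none; congr (_ * _).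
by apply: eq_bigr => i _; rewrite mxE liftK.
Qed.

Lemma measurable_om n : measurable_fun setT (@om n : _ -> measurableTypeR R).
Proof.
apply: measurable_prod => i _.
apply: (measurableT_comp (f := fun t : R => (oneDsqr t)^-1)); last exact: measurable_coord_rV.
by apply: continuous_measurable_fun; exact: continuous_oneDsqrV.
Qed.

Lemma integrable_oneDsqrV :
  (@lebesgue_measure R).-integrable setT (EFin \o (fun t : R => (oneDsqr t)^-1)).
Proof.
apply/integrableP; split.
  by apply/measurable_EFinP; apply: continuous_measurable_fun; exact: continuous_oneDsqrV.
have n1 t : `|(oneDsqr t)^-1| = (oneDsqr t)^-1 :> R.
  by rewrite ger0_norm// invr_ge0 (le_trans ler01)// oneDsqr_ge1.
under eq_integral => t _ do rewrite /= n1.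
rewrite ge0_symfun_integralT.
- rewrite (_ : [set x | _] = `[0, +oo[%classic); last first.
    by apply/seteqP; split => x /=; rewrite in_itv/= andbT.
  by rewrite integral0y_oneDsqr -EFinM ltry.
- by move=> t; rewrite invr_ge0 (le_trans ler01)// oneDsqr_ge1.
- exact: continuous_oneDsqrV.
- by move=> t /=; rewrite /oneDsqr sqrrN.
Qed.

Lemma integral_rV_cons n (f : 'rV[R]_n.+1 -> \bar R) :
  measurable_fun setT f ->
  ((@lebesgue_measure R) \x (lebesgue_rV R n))%E.-integrable setT (f \o @consrV R n) ->
  (\int[lebesgue_rV R n.+1]_x f x =
   \int[(@lebesgue_measure R) \x (lebesgue_rV R n)]_p f (consrV p))%E.
Proof.
move=> mf intf.
exact: (integral_pushforward (measurable_consrV (n := n)) mf intf measurableT).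
Qed.

Lemma ge0_integral_rV_cons n (f : 'rV[R]_n.+1 -> \bar R) :
  measurable_fun setT f -> (forall x, 0 <= f x)%E ->
  (\int[lebesgue_rV R n.+1]_x f x =
   \int[(@lebesgue_measure R) \x (lebesgue_rV R n)]_p f (consrV p))%E.
Proof.
move=> mf f0.
exact: (ge0_integral_pushforward (measurable_consrV (n := n)) _ measurableT mf).
Qed.

Lemma integrable_om_cons n :
  (lebesgue_rV R n).-integrable setT (EFin \o @om n) ->
  ((@lebesgue_measure R) \x (lebesgue_rV R n))%E.-integrable setT
    (fun p => (om (consrV p))%:E).
Proof.
move=> IH; apply/integrable12ltyP.
  apply/measurable_EFinP; apply: (measurableT_comp (f := @om n.+1)).
    exact: measurable_om.
  exact: measurable_consrV.
set M := (\int[lebesgue_rV R n]_x (om x)%:E)%E.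
have M0 : (0 <= M)%E by apply: integral_ge0 => x _; rewrite lee_fin ltW// om_gt0.
have Mfin : M \is a fin_num by exact: integrable_fin_num IH.
have w0 (t : R) : 0 <= (oneDsqr t)^-1.
  by rewrite invr_ge0 (le_trans ler01)// oneDsqr_ge1.
have h (t : R) (v : 'rV[R]_n) : 0 <= (oneDsqr t)^-1 * om v.
  by rewrite mulr_ge0// ltW// om_gt0.
under eq_integral => t _.
  under eq_integral => v _.
    rewrite om_consrV gee0_abs ?lee_fin ?h// EFinM.
    over.
  rewrite ge0_integralZl//=; first over.
  - by case/integrableP: IH.
  - by move=> v _; rewrite lee_fin ltW// om_gt0.
rewrite -/M -(fineK Mfin).
under eq_integral do rewrite -EFinM mulrC EFinM.
rewrite integralZl//; last exact: integrable_oneDsqrV.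
by rewrite lte_mul_pinfty ?lee_fin ?fine_ge0// ltey_eq integrable_fin_num// integrable_oneDsqrV.
Qed.

Lemma integrable_om n : (lebesgue_rV R n).-integrable setT (EFin \o @om n).
Proof.
have om0 m (x : 'rV[R]_m) : `|om x| = om x by rewrite gtr0_norm// om_gt0.
have mE m : measurable_fun [set: 'rV[R]_m] (fun x => (om x)%:E).
  by apply/measurable_EFinP; exact: measurable_om.
elim: n => [|n IH].
  apply/integrableP; split; first exact: mE.
  under eq_integral => x _ do rewrite /= om0.
  have := integral_dirac (0 : 'rV[R]_0) measurableT (mE 0%N).
  by move=> ->; rewrite diracE mem_set// mul1e ltry.
have /integrableP[_ h] := integrable_om_cons IH.
apply/integrableP; split; first exact: mE.
under eq_integral => x _ do rewrite /= om0.
rewrite ge0_integral_rV_cons; [|exact: mE|by move=> x; rewrite lee_fin ltW// om_gt0].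
by under eq_integral => x _ do rewrite -om0.
Qed.

End weight.

(** * Integrals of derivatives vanish *)

Section integral_of_derivative.
Context (R : realType).
Notation mu := (@lebesgue_measure R).

Let cvg_bound K (h : R -> R) : (forall t, `|h t| <= K * (oneDsqr t)^-1) ->
  (h k.+1%:R - h (- k.+1%:R)) @[k --> \oo] --> (0 : R).
Proof.
move=> hK.
have K0 : 0 <= K.
  have := hK 0; rewrite /oneDsqr expr0n addr0 invr1 mulr1; exact: le_trans.
apply/cvgrPdist_le => /= e e0; near=> k.
have k1 : 1 <= (k.+1%:R : R) by rewrite ler1n.
have b (t : R) : t ^+ 2 = k.+1%:R ^+ 2 -> `|h t| <= K * k.+1%:R^-1.
  move=> tk; apply: le_trans (hK t) _; apply: ler_wpM2l => //.
  rewrite lef_pV2 ?posrE ?(lt_le_trans ltr01 (oneDsqr_ge1 _))//.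
  by rewrite /oneDsqr tk; nra.
rewrite sub0r normrN (le_trans (ler_normB _ _))//.
apply: (@le_trans _ _ (K * k.+1%:R^-1 + K * k.+1%:R^-1)).
  by apply: lerD; apply: b; rewrite ?sqrrN.
rewrite -mulrDl ler_pdivrMr ?ltr0n// mulrC -ler_pdivrMr//.
near: k; apply: filterS (nbhs_infty_gtr ((K + K) / e)) => k.
by move=> /ltW /le_trans; apply; rewrite ler_nat.
Unshelve. all: by end_near. Qed.

(** The fundamental theorem on [-k - 1, k + 1]: the boundary terms tend to 0 by the bound on h, and
    the bound on d allows dominated convergence. *)
Lemma integral_deriv0 (h d : R -> R) K :
  (forall t : R, is_derive t 1 h (d t)) -> continuous d ->
  (forall t, `|h t| <= K * (oneDsqr t)^-1) ->
  (forall t, `|d t| <= K * (oneDsqr t)^-1) ->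
  (\int[mu]_x (d x)%:E = 0)%E.
Proof.
move=> hd cd hK dK.
have md : measurable_fun setT d by exact: continuous_measurable_fun.
pose I k : set R := `[- k.+1%:R, k.+1%:R]%classic.
pose f k := (EFin \o d) \_ (I k).
have intg : mu.-integrable setT (fun t => (K * (oneDsqr t)^-1)%:E).
  under eq_fun do rewrite EFinM.
  by apply: integrableZl => //; exact: integrable_oneDsqrV.
have : (\int[mu]_x f k x)%E @[k --> \oo] --> (\int[mu]_x (d x)%:E)%E.
  apply: (dominated_cvg measurableT _ _ _ intg) => //.
  - move=> k; apply/(measurable_restrictT (EFin \o d) (measurable_itv `[- k.+1%:R, k.+1%:R])).
    by apply: measurable_funTS; apply/measurable_EFinP.
  - move=> x _; apply: cvg_near_cst; near=> k.
    rewrite /f patchE ifT// inE /I /= in_itv /= -ler_norml.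
    near: k; apply: filterS (nbhs_infty_gtr `|x|) => k.
    by move=> /ltW /le_trans; apply; rewrite ler_nat.
  - move=> k x _; rewrite /f patchE; case: ifPn => _; first by rewrite lee_fin dK.
    rewrite abse0 lee_fin (le_trans _ (dK x))//.
have e k : (\int[mu]_x f k x = (h k.+1%:R - h (- k.+1%:R))%:E)%E.
  rewrite /f -integral_mkcond EFinB; apply: continuous_FTC2.
  - by have : 0 < (k.+1%:R : R) by []; lra.
  - by apply: continuous_subspaceT => x; exact: cd.
  - have ch : continuous h.
      by move=> t; apply/differentiable_continuous/derivable1_diffP; exact: ex_derive.
    split.
    + by move=> t _; exact: ex_derive.
    + by apply: cvg_at_right_filter; exact: ch.
    + by apply: cvg_at_left_filter; exact: ch.
  - by move=> t _; rewrite derive1E; exact: derive_val.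
under eq_fun do rewrite e.
move/cvg_unique; apply => //.
apply: (@cvg_comp _ _ _ _ EFin _ (nbhs (0 : R))); first exact: cvg_bound hK.
exact: cvg_id.
Unshelve. all: by end_near. Qed.

End integral_of_derivative.

Section integral_of_partial_derivative.
Context (R : realType).
Notation mu := (@lebesgue_measure R).

Lemma integrable_cons_le_om n K (D : 'rV[R]_n.+1 -> R) :
  measurable_fun setT (D : _ -> measurableTypeR R) ->
  (forall x, `|D x| <= K * om x) ->
  (mu \x lebesgue_rV R n)%E.-integrable setT (fun p => (D (consrV p))%:E).
Proof.
move=> mD DK.
apply: (le_integrable measurableT (g := fun p => (K * om (consrV p))%:E)).
- apply/measurable_EFinP; apply: (measurableT_comp (f := D)) => //.
  exact: measurable_consrV.
- by move=> x _ /=; rewrite lee_fin (le_trans (DK _))// ler_norm.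
- under eq_fun do rewrite EFinM; apply: integrableZl => //.
  by apply: integrable_om_cons; exact: integrable_om.
Qed.

Lemma integral_pderiv0_rV n (j : 'I_n) K (H D : 'rV[R]_n -> R) :
  measurable_fun setT (D : _ -> measurableTypeR R) ->
  (forall x, `|H x| <= K * om x) -> (forall x, `|D x| <= K * om x) ->
  (forall x (t : R), is_derive t 1 (fun s => H (x + s *: delta_mx ord0 j))
     (D (x + t *: delta_mx ord0 j))) ->
  (forall x, continuous (fun t : R => D (x + t *: delta_mx ord0 j))) ->
  (\int[lebesgue_rV R n]_x (D x)%:E = 0)%E.
Proof.
elim: n j H D K => [[]//|n IH] j H D K mD HK DK dH cD.
have intD := integrable_cons_le_om mD DK.
rewrite integral_rV_cons//; last by apply/measurable_EFinP.
have mcons : measurable_fun setT (fun p : measurableTypeR R * 'rV[R]_n => D (consrV p)).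
  by apply: (measurableT_comp (f := D)) => //; exact: measurable_consrV.
case: (unliftP ord0 j) => [i ij|j0].
- rewrite -(integral12_prod_meas1 intD) /fubini_F.
  apply: integral0_eq => t _.
  have e s v : consrV (t, v) + s *: delta_mx ord0 j = consrV (t, v + s *: delta_mx ord0 i).
    apply/rowP => k; rewrite !mxE ij /=; case: unliftP => [l ->|->].
      by rewrite !mxE /= (inj_eq lift_inj).
    by rewrite (negbTE (neq_lift _ _)) mulr0 addr0.
  apply: (IH i (fun v => H (consrV (t, v))) (fun v => D (consrV (t, v))) (K * (oneDsqr t)^-1)).
  + by apply: (measurableT_comp mcons); exact: measurable_pair1.
  + by move=> v; rewrite -mulrA -om_consrV.
  + by move=> v; rewrite -mulrA -om_consrV.
  + move=> v s; have := dH (consrV (t, v)) s; rewrite e.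
    by under [X in is_derive _ _ X]eq_fun do rewrite e.
  + move=> v; have := cD (consrV (t, v)).
    by under [X in continuous X]eq_fun do rewrite e.
- rewrite -(integral21_prod_meas1 intD) /fubini_G.
  apply: integral0_eq => v _.
  have e s : consrV (0, v) + s *: delta_mx ord0 j = consrV (s, v).
    apply/rowP => k; rewrite !mxE j0 /=; case: unliftP => [l ->|->].
      by rewrite eq_sym (negbTE (neq_lift _ _)) mulr0 addr0.
    by rewrite eqxx mulr1 add0r.
  apply: (@integral_deriv0 R (fun s => H (consrV (s, v))) _ (K * om v)).
  + move=> s; have := dH (consrV (0, v)) s; rewrite e.
    by under [X in is_derive _ _ X]eq_fun do rewrite e.
  + have := cD (consrV (0, v)).
    by under [X in continuous X]eq_fun do rewrite e.
  + by move=> s; rewrite -mulrA (mulrC (om v)) -om_consrV.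
  + by move=> s; rewrite -mulrA (mulrC (om v)) -om_consrV.
Qed.

Definition vom n (z : Cn R n) : R := om z.1 * om z.2.

Lemma vom_gt0 n (z : Cn R n) : 0 < vom z.
Proof. by rewrite mulr_gt0// om_gt0. Qed.

Lemma measurable_vom n : measurable_fun setT (@vom n : _ -> measurableTypeR R).
Proof.
apply: measurable_funM; apply: (measurableT_comp (f := @om R n)) => //;
  exact: measurable_om.
Qed.

Lemma integrable_vom n : (vol R n).-integrable setT (EFin \o @vom n).
Proof.
apply/integrable12ltyP.
  by apply/measurable_EFinP; exact: measurable_vom.
set M := (\int[lebesgue_rV R n]_x (om x)%:E)%E.
have M0 : (0 <= M)%E by apply: integral_ge0 => x _; rewrite lee_fin ltW// om_gt0.
have Mfin : M \is a fin_num by exact: integrable_fin_num (integrable_om R n).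
under eq_integral => x _.
  under eq_integral => v _.
    rewrite /= ger0_norm ?(ltW (vom_gt0 (x, v)))// /vom EFinM /=.
    over.
  rewrite ge0_integralZl//=; first over.
  - by case/integrableP: (integrable_om R n).
  - by move=> v _; rewrite lee_fin ltW// om_gt0.
  - by rewrite lee_fin ltW// om_gt0.
rewrite -/M -(fineK Mfin).
under eq_integral do rewrite -EFinM mulrC EFinM.
rewrite integralZl//; last exact: integrable_om.
by rewrite lte_mul_pinfty ?lee_fin ?fine_ge0// ltey_eq integrable_fin_num// integrable_om.
Qed.

Lemma integrable_le_vom n K (D : Cn R n -> R) :
  measurable_fun setT (D : _ -> measurableTypeR R) ->
  (forall x, `|D x| <= K * vom x) -> (vol R n).-integrable setT (EFin \o D).
Proof.
move=> mD DK.
apply: (le_integrable measurableT (g := fun x => (K * vom x)%:E)).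
- by apply/measurable_EFinP.
- by move=> x _ /=; rewrite lee_fin (le_trans (DK x))// ler_norm.
- by under eq_fun do rewrite EFinM; apply: integrableZl => //; exact: integrable_vom.
Qed.

Lemma is_derive_line (V : normedModType R) (f : V -> R) (z v : V) (t l : R) :
  is_derive (z + t *: v) v f l -> is_derive t 1 (fun s => f (z + s *: v)) l.
Proof.
have e : (fun h : R => h^-1 *: (f (z + (h *: 1 + t) *: v) - f (z + t *: v))) =
    (fun h => h^-1 *: (f (h *: v + (z + t *: v)) - f (z + t *: v))).
  apply/funext => h; congr (_ *: (f _ - _)).
  by rewrite [h *: 1]mulr1 scalerDl addrCA.
case=> [d1 d2]; split; first by rewrite /derivable/= e.
by rewrite -d2 /derive/= e.
Qed.

Lemma integral_pderiv0 n (v : Cn R n) K (F D : Cn R n -> R) :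
  (exists j, v = dirx R j \/ v = diry R j) ->
  (forall z, is_derive z v F (D z)) -> continuous D ->
  (forall z, `|F z| <= K * vom z) -> (forall z, `|D z| <= K * vom z) ->
  (\int[vol R n]_z (D z)%:E = 0)%E.
Proof.
move=> [j jv] dF cD FK DK.
have mD : measurable_fun setT (D : _ -> measurableTypeR R) by exact: continuous_measurable_Cn.
have intD := integrable_le_vom mD DK.
have cl z : continuous (fun t : R => D (z + t *: v)).
  have cg : continuous (fun t : R => z + t *: v).
    move=> t; apply: cvgD; first exact: cvg_cst.
    by apply: cvgZr_tmp; exact: cvg_id.
  by move=> t; exact: (continuous_comp (cg t) (cD _)).
have dl z t := is_derive_line (dF (z + t *: v)).
case: jv => jv; rewrite /vol.
- rewrite -(integral21_prod_meas1 intD) /fubini_G.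
  apply: integral0_eq => y _.
  have e x s : (x, y) + s *: v = (x + s *: delta_mx ord0 j, y).
    by rewrite jv /dirx; congr pair => /=; rewrite scaler0 addr0.
  apply: (@integral_pderiv0_rV _ j (K * om y) (fun x => F (x, y))).
  + by apply: (measurableT_comp mD); exact: measurable_pair2.
  + by move=> x; rewrite -mulrA (mulrC (om y)); exact: FK.
  + by move=> x; rewrite -mulrA (mulrC (om y)); exact: DK.
  + move=> x s; have := dl (x, y) s; rewrite e.
    by under [X in is_derive _ _ X]eq_fun do rewrite e.
  + move=> x; have := cl (x, y).
    by under [X in continuous X]eq_fun do rewrite e.
- rewrite -(integral12_prod_meas1 intD) /fubini_F.
  apply: integral0_eq => x _.
  have e y s : (x, y) + s *: v = (x, y + s *: delta_mx ord0 j).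
    by rewrite jv /diry; congr pair => /=; rewrite scaler0 addr0.
  apply: (@integral_pderiv0_rV _ j (K * om x) (fun y => F (x, y))).
  + by apply: (measurableT_comp mD); exact: measurable_pair1.
  + by move=> y; rewrite -mulrA; exact: FK.
  + by move=> y; rewrite -mulrA; exact: DK.
  + move=> y s; have := dl (x, y) s; rewrite e.
    by under [X in is_derive _ _ X]eq_fun do rewrite e.
  + move=> y; have := cl (x, y).
    by under [X in continuous X]eq_fun do rewrite e.
Qed.

End integral_of_partial_derivative.

(** * Polynomials times Gaussians *)

Section complex_calculus.
Context (R : realType) (n : nat).
Implicit Types (f g : Cn R n -> R[i]) (z v : Cn R n).

Definition cdiff f := forall z,
  differentiable (fun w => complex.Re (f w)) z /\
  differentiable (fun w => complex.Im (f w)) z.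

Definition is_cderive z v f (l : R[i]) :=
  is_derive z v (fun w => complex.Re (f w)) (complex.Re l) /\
  is_derive z v (fun w => complex.Im (f w)) (complex.Im l).

Lemma cReD (x y : R[i]) : complex.Re (x + y) = complex.Re x + complex.Re y.
Proof. by case: x => a b; case: y. Qed.

Lemma cImD (x y : R[i]) : complex.Im (x + y) = complex.Im x + complex.Im y.
Proof. by case: x => a b; case: y. Qed.

Lemma cReM (x y : R[i]) :
  complex.Re (x * y) = complex.Re x * complex.Re y - complex.Im x * complex.Im y.
Proof. by case: x => a b; case: y. Qed.

Lemma cImM (x y : R[i]) :
  complex.Im (x * y) = complex.Re x * complex.Im y + complex.Im x * complex.Re y.
Proof. by case: x => a b; case: y. Qed.

Lemma complexE (x : R[i]) : x = complex.Re x +i* complex.Im x.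
Proof. by case: x. Qed.

Lemma is_cderive_val z v f l : is_cderive z v f l -> cderive v f z = l.
Proof. by move=> [h1 h2]; rewrite /cderive !derive_val -complexE. Qed.

Lemma cdiff_is_cderive f z v : cdiff f -> is_cderive z v f (cderive v f z).
Proof.
by move=> /(_ z)[h1 h2]; split; split => //; exact: diff_derivable.
Qed.

Lemma cdiff_cst (c : R[i]) : cdiff (fun=> c).
Proof. by move=> z; split; exact: differentiable_cst. Qed.

Lemma cdiffD f g : cdiff f -> cdiff g -> cdiff (fun z => f z + g z).
Proof.
move=> df dg z; have [f1 f2] := df z; have [g1 g2] := dg z; split.
  under eq_fun do rewrite raddfD; exact: differentiableD.
under eq_fun do rewrite raddfD; exact: differentiableD.
Qed.

Lemma cdiffM f g : cdiff f -> cdiff g -> cdiff (fun z => f z * g z).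
Proof.
move=> df dg z; have [f1 f2] := df z; have [g1 g2] := dg z; split.
  by under eq_fun do rewrite cReM; apply: differentiableB; exact: differentiableM.
by under eq_fun do rewrite cImM; apply: differentiableD; exact: differentiableM.
Qed.

Lemma cdiff_conj f : cdiff f -> cdiff (fun z => conjc (f z)).
Proof.
move=> df z; have [f1 f2] := df z; split.
  by rewrite (_ : (fun w => _) = fun w => complex.Re (f w))//; apply/funext => w; case: (f w).
rewrite (_ : (fun w => _) = fun w => - complex.Im (f w)); first exact: differentiableN.
by apply/funext => w; case: (f w).
Qed.

Lemma is_cderive_cst z v (c : R[i]) : is_cderive z v (fun=> c) 0.
Proof. by split; exact: is_derive_cst. Qed.

Lemma is_cderiveD z v f g k l : is_cderive z v f k -> is_cderive z v g l ->
  is_cderive z v (fun z => f z + g z) (k + l).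
Proof.
move=> [f1 f2] [g1 g2]; split.
  by under eq_fun do rewrite raddfD; rewrite raddfD; exact: is_deriveD.
by under eq_fun do rewrite raddfD; rewrite raddfD; exact: is_deriveD.
Qed.

Lemma is_cderiveM z v f g k l : is_cderive z v f k -> is_cderive z v g l ->
  is_cderive z v (fun z => f z * g z) (k * g z + f z * l).
Proof.
move=> [f1 f2] [g1 g2]; split.
  under eq_fun do rewrite cReM.
  apply: is_derive_eq (is_deriveB (is_deriveM f1 g1) (is_deriveM f2 g2)) _.
  by rewrite cReD !cReM /GRing.scale /=; ring.
under eq_fun do rewrite cImM.
apply: is_derive_eq (is_deriveD (is_deriveM f1 g2) (is_deriveM f2 g1)) _.
by rewrite cImD !cImM /GRing.scale /=; ring.
Qed.

Lemma is_cderive_conj z v f l : is_cderive z v f l ->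
  is_cderive z v (fun z => conjc (f z)) (conjc l).
Proof.
move=> [f1 f2]; split.
  rewrite (_ : (fun w => _) = fun w => complex.Re (f w)); first by case: l f1 f2.
  by apply/funext => w; case: (f w).
rewrite (_ : (fun w => _) = fun w => - complex.Im (f w)).
  by rewrite (_ : complex.Im _ = - complex.Im l); [exact: is_deriveN|case: l {f1 f2}].
by apply/funext => w; case: (f w).
Qed.

Lemma is_cderive_real z v (r : Cn R n -> R) (l : R) : is_derive z v r l ->
  is_cderive z v (fun z => (r z)%:C) l%:C.
Proof. by move=> h; split => //=; exact: is_derive_cst. Qed.

Lemma cdiff_real (r : Cn R n -> R) : (forall z, differentiable r z) ->
  cdiff (fun z => (r z)%:C).
Proof. by move=> h z; split => //=; exact: differentiable_cst. Qed.

Lemma differentiable_x j z : differentiable (fun w : Cn R n => w.1 ord0 j) z.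
Proof.
apply: (@differentiable_comp _ _ _ _ (fun w : Cn R n => w.1) (fun x => x ord0 j)).
  by apply: (@linear_differentiable _ _ _ (@fst 'rV[R]_n 'rV[R]_n)) => w; exact: cvg_fst.
exact: differentiable_coord.
Qed.

Lemma differentiable_y j z : differentiable (fun w : Cn R n => w.2 ord0 j) z.
Proof.
apply: (@differentiable_comp _ _ _ _ (fun w : Cn R n => w.2) (fun x => x ord0 j)).
  by apply: (@linear_differentiable _ _ _ (@snd 'rV[R]_n 'rV[R]_n)) => w; exact: cvg_snd.
exact: differentiable_coord.
Qed.

Lemma is_derive_linear (V : normedModType R) (f : V -> R) (a v : V) :
  (forall (t : R) x y, f (t *: x + y) = t * f x + f y) -> is_derive a v f (f v).
Proof.
move=> flin; have h : (h^-1 *: (f (h *: v + a) - f a) @[h --> 0^']) --> f v.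
  apply: cvg_near_cst; near=> t.
  rewrite flin addrK scalerA mulVf ?scale1r//.
  by near: t; exact: nbhs_dnbhs_neq.
split; first by apply/cvg_ex; exists (f v).
exact/cvg_lim.
Unshelve. all: by end_near. Qed.

Lemma is_derive_x j z v : is_derive z v (fun w : Cn R n => w.1 ord0 j) (v.1 ord0 j).
Proof. by apply: is_derive_linear => t x y; rewrite !mxE. Qed.

Lemma is_derive_y j z v : is_derive z v (fun w : Cn R n => w.2 ord0 j) (v.2 ord0 j).
Proof. by apply: is_derive_linear => t x y; rewrite !mxE. Qed.

Lemma is_derive_expR_comp z v (r : Cn R n -> R) : differentiable r z ->
  differentiable (fun w => expR (r w)) z /\
  forall l, is_derive z v r l -> is_derive z v (fun w => expR (r w)) (expR (r z) * l).
Proof.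
move=> dr.
have de : differentiable (@expR R) (r z) by apply/derivable1_diffP; exact: derivable_expR.
have dc : differentiable (fun w => expR (r w)) z by exact: (differentiable_comp dr de).
split => // l hl; split; first exact: diff_derivable.
rewrite deriveE// (diff_comp dr de) /=.
have <- : 'd r z v = l by rewrite -deriveE// derive_val.
rewrite -[X in 'd expR _ X]mulr1 linearZ /= mulrC; congr (_ * _).
have -> : 'd expR (r z) 1 = 'D_1 expR (r z) by rewrite deriveE.
exact: derive_val.
Qed.

End complex_calculus.

Section polynomial_gaussian.
Context (R : realType) (n : nat).
Local Notation MP := (mpoly (n + n) R[i]).
Local Notation "''X' k" := (mpolyX R[i] (mnm1 k)) (at level 8, k at level 2).
Local Notation "''d' k" := (@mderiv (n + n) R[i] k) (at level 8, k at level 2).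
Implicit Types (P Q : MP) (z v : Cn R n) (c : R).

(** With variables z_k / sqrt 2, the Gaussian exp(-|z|^2/2) satisfies E(X_k P) = E(d_(tau k) P)
    without a constant. *)
Definition rt : R[i] := (Num.sqrt 2^-1)%:C.

Lemma rt_sqr : rt * rt = 2^-1.
Proof.
rewrite -rmorphM /= -expr2 sqr_sqrtr ?invr_ge0// fmorphV.
by rewrite (rmorph_nat (real_complex R)).
Qed.

Lemma rt_conj : conjc rt = rt. Proof. exact: conjc_real. Qed.

Lemma rt_rt2 : 2 * (rt * rt) = 1.
Proof. by rewrite rt_sqr divff// pnatr_eq0. Qed.

Definition zc (k : 'I_(n + n)) z : R[i] :=
  match fintype.split k with
  | inl j => z.1 ord0 j +i* z.2 ord0 j
  | inr j => z.1 ord0 j -i* z.2 ord0 j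
  end.

Lemma zc_l j z : zc (lshift n j) z = z.1 ord0 j +i* z.2 ord0 j.
Proof. by rewrite /zc (unsplitK (inl j)). Qed.

Lemma zc_r j z : zc (rshift n j) z = z.1 ord0 j -i* z.2 ord0 j.
Proof. by rewrite /zc (unsplitK (inr j)). Qed.

Lemma zc_tau k z : zc (tau k) z = conjc (zc k z).
Proof.
case: (ord2P k) => -[j ->]; first by rewrite tau_lshift zc_r zc_l.
by rewrite tau_rshift zc_r zc_l /= opprK.
Qed.

Lemma cdiff_zc k : cdiff (zc k).
Proof.
case: (ord2P k) => -[j ->] z; split.
- under eq_fun do rewrite zc_l /=; exact: differentiable_x.
- under eq_fun do rewrite zc_l /=; exact: differentiable_y.
- under eq_fun do rewrite zc_r /=; exact: differentiable_x.
- under eq_fun do rewrite zc_r /=; apply: differentiableN; exact: differentiable_y.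
Qed.

Lemma is_cderive_zc k z v : is_cderive z v (zc k) (zc k v).
Proof.
case: (ord2P k) => -[j ->]; split.
- under eq_fun do rewrite zc_l /=; rewrite zc_l; exact: is_derive_x.
- under eq_fun do rewrite zc_l /=; rewrite zc_l; exact: is_derive_y.
- under eq_fun do rewrite zc_r /=; rewrite zc_r; exact: is_derive_x.
- under eq_fun do rewrite zc_r /=; rewrite zc_r /=; apply: is_deriveN; exact: is_derive_y.
Qed.

Definition pev P z : R[i] := meval (fun k => rt * zc k z) P.

Lemma pevD P Q z : pev (P + Q) z = pev P z + pev Q z.
Proof. exact: mevalD. Qed.

Lemma pevM P Q z : pev (P * Q) z = pev P z * pev Q z.
Proof. exact: mevalM. Qed.

Lemma pevC a z : pev (mpolyC _ a) z = a.
Proof. exact: mevalC. Qed.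

Lemma pevX k z : pev ('X k) z = rt * zc k z.
Proof. exact: mevalXU. Qed.

Lemma pevZ a P z : pev (a *: P) z = a * pev P z.
Proof. by rewrite -mul_mpolyC pevM pevC. Qed.

Lemma pev0 z : pev 0 z = 0.
Proof. by rewrite -(mpolyC0 _ R[i]) pevC. Qed.

Lemma pevN P z : pev (- P) z = - pev P z.
Proof. by rewrite -scaleN1r pevZ mulN1r. Qed.

Lemma pev_sum (I : finType) (F : I -> MP) z :
  pev (\sum_i F i) z = \sum_i pev (F i) z.
Proof. by apply: (big_morph (pev^~ z)); [move=> P Q; exact: pevD|exact: pev0]. Qed.

Lemma pev_star P z : pev (star P) z = conjc (pev P z).
Proof.
elim/mpoly_alg_ind: P => [a|P Q hP hQ|k P hP].
- by rewrite starC !pevC.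
- by rewrite rmorphD !pevD rmorphD hP hQ.
- by rewrite rmorphM starX !pevM !pevX hP zc_tau -{1}rt_conj -!rmorphM.
Qed.

Lemma cdiff_pev P : cdiff (pev P).
Proof.
elim/mpoly_alg_ind: P => [a|P Q hP hQ|k P hP].
- by rewrite (_ : pev _ = fun=> a); [exact: cdiff_cst|apply/funext => z; rewrite pevC].
- rewrite (_ : pev _ = fun z => pev P z + pev Q z); first exact: cdiffD.
  by apply/funext => z; rewrite pevD.
- rewrite (_ : pev _ = fun z => rt * zc k z * pev P z).
    by apply: cdiffM => //; apply: cdiffM; [exact: cdiff_cst|exact: cdiff_zc].
  by apply/funext => z; rewrite pevM pevX.
Qed.

Lemma is_cderive_pev P z v :
  is_cderive z v (pev P) (\sum_k rt * zc k v * pev ('d k P) z).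
Proof.
elim/mpoly_alg_ind: P => [a|P Q hP hQ|k P hP].
- rewrite (_ : pev _ = fun=> a); last by apply/funext => w; rewrite pevC.
  rewrite big1; first exact: is_cderive_cst.
  by move=> i _; rewrite mderivC pev0 mulr0.
- rewrite (_ : pev _ = fun z => pev P z + pev Q z); last first.
    by apply/funext => w; rewrite pevD.
  rewrite (_ : \sum_k _ = (\sum_k rt * zc k v * pev ('d k P) z) +
     \sum_k rt * zc k v * pev ('d k Q) z); first exact: is_cderiveD.
  by rewrite -big_split; apply: eq_bigr => i _ /=; rewrite mderivD pevD mulrDr.
- rewrite (_ : pev _ = fun z => rt * zc k z * pev P z); last first.
    by apply/funext => w; rewrite pevM pevX.
  rewrite (_ : \sum_k _ = (0 * zc k z + rt * zc k v) * pev P z +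
    rt * zc k z * (\sum_k rt * zc k v * pev ('d k P) z)).
    apply: is_cderiveM => //; apply: is_cderiveM; last exact: is_cderive_zc.
    exact: is_cderive_cst.
  rewrite mul0r add0r mulr_sumr.
  rewrite (eq_bigr (fun i => rt * zc i v * ((i == k)%:R * pev P z) +
     rt * zc k z * (rt * zc i v * pev ('d i P) z))); last first.
    by move=> i _; rewrite mderivXM pevD pevZ pevM pevX mulrDr; congr (_ + _); ring.
  rewrite big_split /=; congr (_ + _).
  rewrite (bigD1 k)//= eqxx mul1r big1 ?addr0// => i /negbTE ->.
  by rewrite mul0r mulr0.
Qed.

Lemma differentiable_normsq z : differentiable (@normsq R n) z.
Proof.
rewrite (_ : @normsq R n =
  \sum_(j < n) (fun w : Cn R n => w.1 ord0 j ^+ 2 + w.2 ord0 j ^+ 2)); last first.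
  by apply/funext => w; rewrite /normsq fct_sumE.
apply: differentiable_sum => j.
have h (f : Cn R n -> R) : differentiable f z -> differentiable (fun w => f w ^+ 2) z.
  by move=> df; under eq_fun do rewrite expr2; exact: differentiableM.
by apply: differentiableD; apply: h; [exact: differentiable_x|exact: differentiable_y].
Qed.

Lemma is_derive_normsq z v : is_derive z v (@normsq R n)
  (\sum_j 2 * (z.1 ord0 j * v.1 ord0 j + z.2 ord0 j * v.2 ord0 j)).
Proof.
rewrite (_ : @normsq R n =
  \sum_(j < n) (fun w : Cn R n => w.1 ord0 j ^+ 2 + w.2 ord0 j ^+ 2)); last first.
  by apply/funext => w; rewrite /normsq fct_sumE.
apply: is_derive_sum => j.
under eq_fun do rewrite !expr2.
have dx := is_derive_x j z v; have dy := is_derive_y j z v.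
apply: is_derive_eq (is_deriveD (is_deriveM dx dx) (is_deriveM dy dy)) _.
by rewrite /GRing.scale /=; ring.
Qed.

Definition ev c P z : R[i] := pev P z * (expR (- (c * normsq z)))%:C.

(** The directional derivative conjugated by exp(-c |z|^2). The second sum is multiplication by the
    derivative of c |z|^2 along v; by it, derivatives of polynomials times a Gaussian stay in that
    class. *)
Definition gder c v P : MP :=
  \sum_k (rt * zc k v) *: 'd k P -
  (\sum_k (2 * c%:C * rt * zc (tau k) v) *: ('X k * P)).

Lemma cdiff_ev c P : cdiff (ev c P).
Proof.
apply: cdiffM; first exact: cdiff_pev.
apply: cdiff_real => z.
have dr : differentiable (fun w => - (c * normsq w)) z.
  by apply: differentiableN; apply: differentiableM => //; exact: differentiable_normsq.
exact: (is_derive_expR_comp 0 dr).1.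
Qed.

Lemma is_cderive_ev c P z v : is_cderive z v (ev c P) (ev c (gder c v P) z).
Proof.
have dr : differentiable (fun w => - (c * normsq w)) z.
  by apply: differentiableN; apply: differentiableM => //; exact: differentiable_normsq.
set l := \sum_j 2 * (z.1 ord0 j * v.1 ord0 j + z.2 ord0 j * v.2 ord0 j).
have il : is_derive z v (fun w => - (c * normsq w)) (- (c * l)).
  apply: is_deriveN.
  apply: is_derive_eq (is_deriveM (is_derive_cst c z v) (is_derive_normsq z v)) _.
  by rewrite /GRing.scale /= mulr0 addr0.
have := is_cderiveM (is_cderive_pev P z v) (is_cderive_real ((is_derive_expR_comp v dr).2 _ il)).
rewrite (_ : _ + _ = ev c (gder c v P) z)//.
rewrite /ev /gder pevD pevN !pev_sum mulrDl; congr (_ + _).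
  by congr (_ * _); apply: eq_bigr => k _; rewrite pevZ.
rewrite rmorphM /= mulrCA mulrC; congr (_ * _).
rewrite rmorphN rmorphM /= mulrN; congr (- _).
rewrite (eq_bigr (fun k => pev P z * c%:C * (zc k z * zc (tau k) v))); last first.
  move=> k _; rewrite pevZ pevM pevX.
  transitivity (2 * (rt * rt) * (pev P z * c%:C * (zc k z * zc (tau k) v))); first by ring.
  by rewrite rt_rt2 mul1r.
rewrite -mulr_sumr mulrA; congr (_ * _).
rewrite /l rmorph_sum big_split_ord /= -big_split; apply: eq_bigr => j _ /=.
rewrite tau_lshift tau_rshift !zc_l !zc_r.
by apply/eqP; rewrite eq_complex /=; apply/andP; split; apply/eqP; ring.
Qed.

Lemma cderive_ev c P v : cderive v (ev c P) = ev c (gder c v P).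
Proof. by apply/funext => z; exact/is_cderive_val/is_cderive_ev. Qed.

Lemma smooth_ev c P : smooth (ev c P).
Proof.
move=> s z.
have -> : foldr (@cderive R n) (ev c P) s = ev c (foldr (gder c) P s).
  by elim: s => //= v s ->; rewrite cderive_ev.
exact: cdiff_ev.
Qed.

End polynomial_gaussian.

(** * Decay of polynomials times Gaussians *)

Section gaussian_bounds.
Context (R : realType) (n : nat).
Local Notation MP := (mpoly (n + n) R[i]).
Implicit Types (F : Cn R n -> R[i]) (P Q : MP) (z v : Cn R n) (c : R).

Lemma normc_ge0 (x : R[i]) : 0 <= Normc.normc x.
Proof. by case: x => a b; exact: sqrtr_ge0. Qed.

Lemma normc_real (r : R) : Normc.normc r%:C = `|r|.
Proof. by rewrite /= expr0n /= addr0 sqrtr_sqr. Qed.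

Lemma normc_conj (x : R[i]) : Normc.normc (conjc x) = Normc.normc x.
Proof. by case: x => a b /=; rewrite sqrrN. Qed.

Lemma le_Re_normc (x : R[i]) : `|complex.Re x| <= Normc.normc x.
Proof.
by case: x => a b /=; rewrite -sqrtr_sqr ler_wsqrtr// lerDl sqr_ge0.
Qed.

Lemma le_Im_normc (x : R[i]) : `|complex.Im x| <= Normc.normc x.
Proof.
by case: x => a b /=; rewrite -sqrtr_sqr ler_wsqrtr// lerDr sqr_ge0.
Qed.

Lemma sqr_normcE (x : R[i]) : ((Normc.normc x) ^+ 2)%:C = x * conjc x.
Proof.
case: x => a b /=; rewrite sqr_sqrtr ?addr_ge0 ?sqr_ge0//.
by apply/eqP; rewrite eq_complex /=; apply/andP; split; apply/eqP; ring.
Qed.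

Lemma normsq_ge0 z : 0 <= normsq z.
Proof. by apply: sumr_ge0 => j _; rewrite addr_ge0 ?sqr_ge0. Qed.

Lemma coord_normsq j z : z.1 ord0 j ^+ 2 + z.2 ord0 j ^+ 2 <= normsq z.
Proof.
rewrite /normsq (bigD1 j)//= lerDl; apply: sumr_ge0 => k _.
by rewrite addr_ge0 ?sqr_ge0.
Qed.

Lemma le1D_expR (e t : R) : 0 < e -> 0 <= t -> 1 + t <= (1 + e^-1) * expR (e * t).
Proof.
move=> e0 t0; apply: (@le_trans _ _ ((1 + e^-1) * (1 + e * t))); last first.
  by rewrite ler_wpM2l ?expR_ge1Dx// addr_ge0// invr_ge0 ltW.
rewrite mulrDl mul1r mulrDr mulr1 mulrA mulVf ?gt_eqF// mul1r.
have ei : 0 < e^-1 by rewrite invr_gt0.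
have := mulr_ge0 (ltW e0) t0; lra.
Qed.

(** Growth slower than every Gaussian: a class closed under sums and products of nonnegative
    functions, with no degrees to keep track of. *)
Definition subexp (f : Cn R n -> R) := forall e : R, 0 < e ->
  exists K, forall z, f z <= K * expR (e * normsq z).

Lemma subexpD f g : subexp f -> subexp g -> subexp (fun z => f z + g z).
Proof.
move=> hf hg e e0; have [K hK] := hf e e0; have [M hM] := hg e e0.
by exists (K + M) => z; rewrite mulrDl lerD.
Qed.

Lemma subexpM f g : (forall z, 0 <= f z) -> (forall z, 0 <= g z) ->
  subexp f -> subexp g -> subexp (fun z => f z * g z).
Proof.
move=> f0 g0 hf hg e e0.
have e2 : 0 < e / 2 by rewrite divr_gt0.
have [K hK] := hf _ e2; have [M hM] := hg _ e2.
exists (K * M) => z; rewrite (_ : e * normsq z = e / 2 * normsq z + e / 2 * normsq z);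
    last by rewrite -mulrDl -splitr.
  rewrite expRD mulrACA.
exact: ler_pM.
Qed.

Lemma subexp_cst (a : R) : 0 <= a -> subexp (fun=> a).
Proof.
move=> a0 e e0; exists a => z; rewrite ler_peMr//.
by rewrite -expR0 ler_expR mulr_ge0 ?normsq_ge0// ltW.
Qed.

Lemma subexp_le f g : (forall z, f z <= g z) -> subexp g -> subexp f.
Proof.
by move=> fg hg e e0; have [K hK] := hg e e0; exists K => z; apply: le_trans (hK z).
Qed.

Lemma subexp_1D : subexp (fun z => 1 + normsq z).
Proof. by move=> e e0; exists (1 + e^-1) => z; rewrite le1D_expR// normsq_ge0. Qed.

Lemma subexp_zc k : subexp (fun z => Normc.normc (zc k z)).
Proof.
apply: subexp_le subexp_1D => z.
have h j : Num.sqrt (z.1 ord0 j ^+ 2 + z.2 ord0 j ^+ 2) <= 1 + normsq z.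
  have := coord_normsq j z; set t := _ + _ => tz.
  have t0 : 0 <= t by rewrite addr_ge0 ?sqr_ge0.
  apply: (@le_trans _ _ (1 + t)); last by rewrite lerD2l.
  have t1 : 0 <= 1 + t by lra.
  have -> : 1 + t = Num.sqrt ((1 + t) ^+ 2) by rewrite sqrtr_sqr ger0_norm.
  rewrite ler_wsqrtr//; nra.
case: (ord2P k) => -[j ->]; rewrite ?zc_l ?zc_r /=; first exact: h.
by rewrite sqrrN; exact: h.
Qed.

Lemma subexp_pev P : subexp (fun z => Normc.normc (pev P z)).
Proof.
elim/mpoly_alg_ind: P => [a|P Q hP hQ|k P hP].
- apply: subexp_le (subexp_cst (normc_ge0 a)) => z.
  by rewrite pevC.
- apply: subexp_le (subexpD hP hQ) => z.
  by rewrite pevD le_normcD.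
- apply: (@subexp_le _
    (fun z => (Normc.normc (rt R) * Normc.normc (zc k z)) * Normc.normc (pev P z))).
    by move=> z; rewrite pevM pevX !Normc.normcM.
  apply: subexpM => //.
  + by move=> z; rewrite mulr_ge0 ?normc_ge0.
  + by move=> z; exact: normc_ge0.
  apply: subexpM.
  + by move=> z; exact: normc_ge0.
  + by move=> z; exact: normc_ge0.
  + by apply: subexp_cst; exact: normc_ge0.
  + exact: subexp_zc.
Qed.

Lemma subexp_norm m : subexp (fun z => `|z| ^+ m).
Proof.
elim: m => [|m IH]; first by apply: subexp_cst.
apply: (@subexp_le _ (fun z => `|z| * `|z| ^+ m)) => [z|]; first by rewrite exprS.
apply: subexpM => //.
apply: subexp_le subexp_1D => z.
have N0 := normsq_ge0 z.
have h (a b : R) : a ^+ 2 + b ^+ 2 <= normsq z -> `|a| <= 1 + normsq z.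
  by move=> ab; rewrite ler_norml; apply/andP; split; nra.
rewrite [leLHS](_ : _ = Num.max `|z.1| `|z.2|)// ge_max.
apply/andP; split; apply: rV_norm_le; rewrite ?addr_ge0// => j.
  exact: h (coord_normsq j z).
by apply: (h _ (z.1 ord0 j)); rewrite addrC; exact: coord_normsq.
Qed.

Lemma normc_ev c P z :
  Normc.normc (ev c P z) = Normc.normc (pev P z) * expR (- (c * normsq z)).
Proof. by rewrite /ev Normc.normcM normc_real ger0_norm// expR_ge0. Qed.

Lemma subexp_bounded (f : Cn R n -> R) c : 0 < c -> subexp f ->
  exists K, forall z, f z * expR (- (c * normsq z)) <= K * expR (- (c / 2 * normsq z)).
Proof.
move=> c0 hf; have [|K hK] := hf (c / 2); first by rewrite divr_gt0.
exists K => z; apply: le_trans (ler_wpM2r (expR_ge0 _) (hK z)) _.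
rewrite -[leLHS]mulrA -expRD (_ : _ + _ = - (c / 2 * normsq z))//.
by field.
Qed.

(** Coordinate by coordinate, 1 + t^2 is at most (1 + 1/c) exp(c t^2). *)
Lemma gauss_le_vom c : 0 < c ->
  exists2 K, 0 <= K & forall z, expR (- (c * normsq z)) <= K * vom z.
Proof.
move=> c0; exists ((1 + c^-1) ^+ n * (1 + c^-1) ^+ n).
  by rewrite mulr_ge0// exprn_ge0// addr_ge0// invr_ge0 ltW.
have h1 (t : R) : expR (- (c * t ^+ 2)) <= (1 + c^-1) * (oneDsqr t)^-1.
  rewrite expRN ler_pdivlMr ?(lt_le_trans ltr01 (oneDsqr_ge1 _))//.
  rewrite mulrC ler_pdivrMr ?expR_gt0// /oneDsqr; apply: le1D_expR => //.
  exact: sqr_ge0.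
have h (x : 'rV[R]_n) : expR (- (c * \sum_j x ord0 j ^+ 2)) <= (1 + c^-1) ^+ n * om x.
  have -> : (1 + c^-1) ^+ n = \prod_(j < n) (1 + c^-1) by rewrite prodr_const card_ord.
  rewrite /om -big_split /= mulr_sumr -sumrN expR_sum.
  by apply: ler_prod => j _; rewrite expR_ge0 h1.
move=> z; rewrite /normsq big_split /= mulrDr opprD expRD /vom mulrACA.
by apply: ler_pM; rewrite ?expR_ge0.
Qed.

Lemma ev_le_vom c P : 0 < c ->
  exists2 K, 0 <= K & forall z, Normc.normc (ev c P z) <= K * vom z.
Proof.
move=> c0; have [K hK] := subexp_bounded c0 (@subexp_pev P).
have [|M M0 hM] := @gauss_le_vom (c / 2); first by rewrite divr_gt0.
exists (`|K| * M); first by rewrite mulr_ge0.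
move=> z; rewrite normc_ev; apply: le_trans (hK z) _; rewrite -[leRHS]mulrA.
apply: le_trans (ler_wpM2l (normr_ge0 _) (hM z)).
by rewrite ler_wpM2r ?expR_ge0// ler_norm.
Qed.

Lemma schwartz_ev c P : 0 < c -> schwartz (ev c P).
Proof.
move=> c0; split=> [|s m]; first exact: smooth_ev.
have -> : foldr (@cderive R n) (ev c P) s = ev c (foldr (gder c) P s).
  by elim: s => //= v s ->; rewrite cderive_ev.
set Q := foldr _ _ _.
have hs : subexp (fun z => `|z| ^+ m * Normc.normc (pev Q z)).
  apply: subexpM; [|by move=> z; exact: normc_ge0|exact: subexp_norm|exact: subexp_pev].
  by move=> z; rewrite exprn_ge0.
have [K hK] := subexp_bounded c0 hs.
exists `|K| => z; rewrite normc_ev mulrA; apply: le_trans (hK z) _.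
apply: (@le_trans _ _ (`|K| * expR (- (c / 2 * normsq z)))).
  by rewrite ler_wpM2r ?expR_ge0// ler_norm.
rewrite ler_piMr// -expR0 ler_expR oppr_le0 mulr_ge0 ?normsq_ge0//.
by rewrite divr_ge0// ltW.
Qed.

End gaussian_bounds.

(** * Complex-valued integrals and integration by parts *)

Section complex_integral.
Context (R : realType) (n : nat).
Local Notation MP := (mpoly (n + n) R[i]).
Local Notation "''X' k" := (mpolyX R[i] (mnm1 k)) (at level 8, k at level 2).
Local Notation "''d' k" := (@mderiv (n + n) R[i] k) (at level 8, k at level 2).
Implicit Types (F G : Cn R n -> R[i]) (P Q : MP) (z v : Cn R n) (c : R).

Definition cint F : R[i] :=
  (\int[vol R n]_z complex.Re (F z)) +i* (\int[vol R n]_z complex.Im (F z)).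

Lemma innerE F G : inner F G = cint (fun z => F z * conjc (G z)).
Proof. by []. Qed.

Definition cintegrable F :=
  (vol R n).-integrable setT (fun z => (complex.Re (F z))%:E) /\
  (vol R n).-integrable setT (fun z => (complex.Im (F z))%:E).

Lemma cintD F G : cintegrable F -> cintegrable G ->
  cint (fun z => F z + G z) = cint F + cint G.
Proof.
move=> [f1 f2] [g1 g2]; rewrite /cint.
under eq_Rintegral do rewrite cReD.
under [X in _ +i* X]eq_Rintegral do rewrite cImD.
by rewrite !RintegralD.
Qed.

Lemma cintegrableD F G : cintegrable F -> cintegrable G ->
  cintegrable (fun z => F z + G z).
Proof.
move=> [f1 f2] [g1 g2]; split.
  by under eq_fun do rewrite cReD EFinD; exact: integrableD.
by under eq_fun do rewrite cImD EFinD; exact: integrableD.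
Qed.

Lemma cintegrableZ a F : cintegrable F -> cintegrable (fun z => a * F z).
Proof.
move=> [f1 f2]; split.
  under eq_fun do rewrite cReM EFinB !EFinM.
  by apply: integrableB => //; exact: integrableZl.
under eq_fun do rewrite cImM EFinD !EFinM.
by apply: integrableD => //; exact: integrableZl.
Qed.

Lemma cintZ a F : cintegrable F -> cint (fun z => a * F z) = a * cint F.
Proof.
move=> [f1 f2]; rewrite /cint.
under eq_Rintegral do rewrite cReM.
under [X in _ +i* X]eq_Rintegral do rewrite cImM.
have iZ (r : R) f : (vol R n).-integrable setT (EFin \o f) ->
    (vol R n).-integrable setT (EFin \o (fun z => r * f z)).
  by move=> h; rewrite /comp; under eq_fun do rewrite EFinM; exact: integrableZl.
rewrite RintegralB//; [|exact: iZ..].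
rewrite RintegralD//; [|exact: iZ..].
rewrite !RintegralZl//.
by case: a.
Qed.

Lemma cint_conj F : cint (fun z => conjc (F z)) = conjc (cint F).
Proof.
rewrite /cint /=; congr (_ +i* _).
  by apply: eq_Rintegral => z _; case: (F z).
(* No integrability is assumed: a change of sign exchanges positive and negative parts, and [fine]
   sends infinite values to 0 on both sides. *)
have <- : \int[vol R n]_z - complex.Im (F z) = - \int[vol R n]_z complex.Im (F z).
  rewrite /Rintegral integralE [in RHS]integralE.
  have -> : (fun z => (- complex.Im (F z))%:E)^\+%E = (fun z => (complex.Im (F z))%:E)^\-%E.
    exact: (funeposN (fun z => (complex.Im (F z))%:E)).
  have -> : (fun z => (- complex.Im (F z))%:E)^\-%E = (fun z => (complex.Im (F z))%:E)^\+%E.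
    exact: (funenegN (fun z => (complex.Im (F z))%:E)).
  case: (integral _ _ _) => [a||]; case: (integral _ _ _) => [b||] //=; rewrite ?oppr0//.
  by rewrite opprB.
by apply: eq_Rintegral => z _; case: (F z).
Qed.

Lemma cint0 : cint (fun=> 0) = 0.
Proof. by rewrite /cint /= /Rintegral integral0. Qed.

Lemma cintegrable0 : cintegrable (fun=> 0).
Proof. by split; exact: integrable0. Qed.

Lemma cintegrable_sum (I : finType) (F : I -> Cn R n -> R[i]) :
  (forall i, cintegrable (F i)) -> cintegrable (fun z => \sum_i F i z).
Proof.
move=> h; rewrite (_ : (fun z => _) = (\sum_i F i)); last by apply/funext => z; rewrite fct_sumE.
by elim/big_rec : _ => [|i G _ hG]; [exact: cintegrable0|exact: cintegrableD].
Qed.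

Lemma cint_sum (I : finType) (F : I -> Cn R n -> R[i]) :
  (forall i, cintegrable (F i)) -> cint (fun z => \sum_i F i z) = \sum_i cint (F i).
Proof.
move=> h; rewrite (_ : (fun z => _) = (\sum_i F i)); last by apply/funext => z; rewrite fct_sumE.
have [//] : cintegrable (\sum_i F i) /\ cint (\sum_i F i) = \sum_i cint (F i).
elim/big_rec2 : _ => [|i x G _ [hG <-]]; first by split; [exact: cintegrable0|exact: cint0].
by split; [exact: cintegrableD|exact: cintD].
Qed.

Lemma cdiff_continuous F : cdiff F ->
  continuous (fun z => complex.Re (F z)) /\ continuous (fun z => complex.Im (F z)).
Proof.
by move=> dF; split => z; have [h1 h2] := dF z; exact: differentiable_continuous.
Qed.

Definition vbd F := exists K, forall z, Normc.normc (F z) <= K * vom z.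

Lemma cintegrable_vbd F : cdiff F -> vbd F -> cintegrable F.
Proof.
move=> /cdiff_continuous[c1 c2] [K hK]; split.
  apply: (@integrable_le_vom R n K (fun z => complex.Re (F z))).
    exact: continuous_measurable_Cn.
  by move=> z; apply: le_trans (le_Re_normc _) _.
apply: (@integrable_le_vom R n K (fun z => complex.Im (F z))).
  exact: continuous_measurable_Cn.
by move=> z; apply: le_trans (le_Im_normc _) _.
Qed.

Definition coord_dir v := exists j, v = dirx R j \/ v = diry R j.

Lemma cint_cderive0 v F : coord_dir v -> cdiff F -> cdiff (cderive v F) ->
  vbd F -> vbd (cderive v F) -> cint (cderive v F) = 0.
Proof.
move=> dv dF /cdiff_continuous[c1 c2] [K hK] [M hM].
(* [integral_pderiv0] takes one constant for the function and its derivative, hence the maximum. *)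
have hK' z : Normc.normc (F z) <= Num.max K M * vom z.
  by apply: le_trans (hK z) _; rewrite ler_wpM2r ?(ltW (vom_gt0 z))// le_max lexx.
have hM' z : Normc.normc (cderive v F z) <= Num.max K M * vom z.
  by apply: le_trans (hM z) _; rewrite ler_wpM2r ?(ltW (vom_gt0 z))// le_max lexx orbT.
have d z := cdiff_is_cderive z v dF.
have e1 := integral_pderiv0 dv (fun z => (d z).1) c1
  (fun z => le_trans (le_Re_normc _) (hK' z)) (fun z => le_trans (le_Re_normc _) (hM' z)).
have e2 := integral_pderiv0 dv (fun z => (d z).2) c2
  (fun z => le_trans (le_Im_normc _) (hK' z)) (fun z => le_trans (le_Im_normc _) (hM' z)).
by rewrite /cint /Rintegral e1 e2.
Qed.

Section functional.
Context c (c0 : 0 < c).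

Lemma vbd_ev P : vbd (ev c P).
Proof. by have [K _ h] := ev_le_vom P c0; exists K. Qed.

Lemma cintegrable_ev P : cintegrable (ev c P).
Proof. exact: cintegrable_vbd (cdiff_ev c P) (vbd_ev P). Qed.

Lemma evD P Q z : ev c (P + Q) z = ev c P z + ev c Q z.
Proof. by rewrite /ev pevD mulrDl. Qed.

Lemma evZ a P z : ev c (a *: P) z = a * ev c P z.
Proof. by rewrite /ev pevZ mulrA. Qed.

Lemma cint_ev_linear : linear_for *%R (fun P => cint (ev c P)).
Proof.
move=> a P Q /=; rewrite -cintZ; last exact: cintegrable_ev.
rewrite -cintD; [|apply: cintegrableZ|]; [|exact: cintegrable_ev..].
by congr cint; apply/funext => z; rewrite evD evZ.
Qed.

Lemma gder_x j P : gder c (dirx R j) P =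
  rt R *: ('d (lshift n j) P + 'd (rshift n j) P) -
  (2 * c%:C * rt R) *: ('X (lshift n j) * P + 'X (rshift n j) * P).
Proof.
have zl i : zc (lshift n i) (dirx R j) = (i == j)%:R.
  by rewrite zc_l !mxE eqxx /=; case: (i == j).
have zr i : zc (rshift n i) (dirx R j) = (i == j)%:R.
  by rewrite zc_r !mxE eqxx /=; case: (i == j); rewrite /= oppr0.
rewrite /gder !big_split_ord /=; congr (_ - _).
  rewrite scalerDr; congr (_ + _); rewrite (bigD1 j)//= ?zl ?zr eqxx mulr1.
    by rewrite big1 ?addr0// => i /negbTE ij; rewrite zl ij mulr0 scale0r.
  by rewrite big1 ?addr0// => i /negbTE ij; rewrite zr ij mulr0 scale0r.
rewrite scalerDr; congr (_ + _); rewrite (bigD1 j)//= ?tau_lshift ?tau_rshift ?zl ?zr eqxx mulr1.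
  by rewrite big1 ?addr0// => i /negbTE ij; rewrite tau_lshift zr ij mulr0 scale0r.
by rewrite big1 ?addr0// => i /negbTE ij; rewrite tau_rshift zl ij mulr0 scale0r.
Qed.

Lemma gder_y j P : gder c (diry R j) P =
  ('i * rt R) *: ('d (lshift n j) P - 'd (rshift n j) P) -
  (2 * c%:C * rt R * 'i) *: ('X (rshift n j) * P - 'X (lshift n j) * P).
Proof.
have zl i : zc (lshift n i) (diry R j) = (i == j)%:R * 'i.
  by rewrite zc_l !mxE eqxx /=; case: (i == j); rewrite ?mul1r ?mul0r.
have zr i : zc (rshift n i) (diry R j) = - ((i == j)%:R * 'i).
  rewrite zc_r !mxE eqxx /=; case: (i == j); rewrite ?mul1r ?mul0r ?oppr0//.
  by apply/eqP; rewrite eq_complex /= oppr0 !eqxx.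
rewrite /gder !big_split_ord /=; congr (_ - _).
  rewrite scalerBr; congr (_ + _); rewrite (bigD1 j)//= ?zl ?zr eqxx mul1r.
    rewrite big1 ?addr0 1?mulrC// => i /negbTE ij; rewrite zl ij mul0r mulr0 scale0r//.
  rewrite big1 ?addr0 ?mulrN ?scaleNr 1?mulrC// => i /negbTE ij.
  by rewrite zr ij mul0r oppr0 mulr0 scale0r.
rewrite scalerBr [RHS]addrC; congr (_ + _);
  rewrite (bigD1 j)//= ?tau_lshift ?tau_rshift ?zl ?zr eqxx mul1r.
  rewrite big1 ?addr0 ?mulrN ?scaleNr// => i /negbTE ij.
  by rewrite tau_lshift zr ij mul0r oppr0 mulr0 scale0r.
by rewrite big1 ?addr0// => i /negbTE ij; rewrite tau_rshift zl ij mul0r mulr0 scale0r.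
Qed.

Lemma cint_gder0 v P : coord_dir v -> cint (ev c (gder c v P)) = 0.
Proof.
move=> dv; rewrite -cderive_ev; apply: cint_cderive0 => //.
- exact: cdiff_ev.
- by rewrite cderive_ev; exact: cdiff_ev.
- exact: vbd_ev.
- by rewrite cderive_ev; exact: vbd_ev.
Qed.

End functional.

End complex_integral.

(** * The Gaussian integral as a linear functional on polynomials *)

Section gaussian_functional.
Context (R : realType) (n : nat).
Local Notation MP := (mpoly (n + n) R[i]).
Local Notation "''X' k" := (mpolyX R[i] (mnm1 k)) (at level 8, k at level 2).
Local Notation "''d' k" := (@mderiv (n + n) R[i] k) (at level 8, k at level 2).
Implicit Types (P Q : MP) (z v : Cn R n).

Lemma lebesgue_rV_setT_gt0 m : (0 < lebesgue_rV R m setT)%E.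
Proof.
elim: m => [|m IH]; first by rewrite /= diracE mem_set// lte_fin.
have -> : lebesgue_rV R m.+1 setT =
    ((@lebesgue_measure R) \x (lebesgue_rV R m))%E (setT `*` setT).
  by rewrite setXTT.
rewrite product_measure1E//; apply: mule_gt0 => //.
have : (lebesgue_measure `[0%R, 1%R]%classic <= lebesgue_measure [set: R])%E.
  by apply: le_measure => //; rewrite inE.
apply: lt_le_trans.
by rewrite lebesgue_measure_itv /= lte_fin ltr01 -EFinB subr0 lte_fin.
Qed.

Lemma vol_setT_gt0 : (0 < vol R n setT)%E.
Proof.
have -> : vol R n setT =
    ((lebesgue_rV R n) \x (lebesgue_rV R n))%E (setT `*` setT) by rewrite setXTT.
rewrite product_measure1E//.
by apply: mule_gt0; exact: lebesgue_rV_setT_gt0.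
Qed.

(** The relations along x_j and y_j are recombined into those for the complex derivatives in z_j and
    its conjugate, by taking their sum and difference. *)
Lemma gder_ibp (c : R) (E : {scalar MP}) :
  (forall v P, coord_dir v -> E (gder c v P) = 0) ->
  forall k P, (2 * c%:C) * E ('X k * P) = E ('d (tau k) P).
Proof.
move=> E0 k P.
have rt0 : rt R != 0.
  by apply: contra_eq_neq (rt_sqr R) => ->; rewrite mul0r eq_sym invr_eq0 pnatr_eq0.
have i0 : 'i != 0 :> R[i] by rewrite eq_complex /= oner_eq0 andbF.
suff key j : (2 * c%:C) * E ('X (lshift n j) * P) = E ('d (rshift n j) P) /\
    (2 * c%:C) * E ('X (rshift n j) * P) = E ('d (lshift n j) P).
  by case: (ord2P k) => -[j ->]; rewrite ?tau_lshift ?tau_rshift; have [] := key j.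
have : E (gder c (dirx R j) P) = 0 by apply: E0; exists j; left.
have : E (gder c (diry R j) P) = 0 by apply: E0; exists j; right.
rewrite gder_x gder_y !(linearB E) !(linearZ_LR E) /= !(linearB E) !(linearD E) /=.
move: (E _) (E _) (E _) (E _) => a b x y.
move=> h1 h2.
have {}h1 : y - x = 2 * c%:C * (a - b).
  by apply: (mulfI rt0); apply: (mulfI i0); apply/eqP; rewrite -subr_eq0 -h1; apply/eqP; ring.
have {}h2 : y + x = 2 * c%:C * (b + a).
  by apply: (mulfI rt0); apply/eqP; rewrite -subr_eq0 -h2; apply/eqP; ring.
have t0 : (2 : R[i]) != 0 by rewrite pnatr_eq0.
split; apply: (mulfI t0).
  transitivity (2 * c%:C * (b + a) - 2 * c%:C * (a - b)); first by ring.
  by rewrite -h1 -h2; ring.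
transitivity (2 * c%:C * (b + a) + 2 * c%:C * (a - b)); first by ring.
by rewrite -h1 -h2; ring.
Qed.

Context (c : R) (c0 : 0 < c).

Definition gfun P : R[i] := cint (ev c P).
HB.instance Definition _ := GRing.isLinear.Build R[i] MP R[i] *%R gfun
  (cint_ev_linear c0).

Definition gfunctional : {scalar MP} := gfun.

Lemma gfunctionalE P : gfunctional P = cint (ev c P).
Proof. by []. Qed.

Lemma gfunctional_ibp k P :
  (2 * c%:C) * gfunctional ('X k * P) = gfunctional ('d (tau k) P).
Proof. by apply: gder_ibp => v Q; exact: cint_gder0. Qed.

Lemma gfunctional_star P : gfunctional (star P) = conjc (gfunctional P).
Proof.
rewrite !gfunctionalE -cint_conj; congr cint; apply/funext => z.
by rewrite /ev pev_star -{1}(conjc_real (expR _)) -rmorphM.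
Qed.

Lemma ev_mul_star P z :
  ev c (P * star P) z = (Normc.normc (pev P z) ^+ 2 * expR (- (c * normsq z)))%:C.
Proof. by rewrite /ev pevM pev_star -sqr_normcE -rmorphM. Qed.

Lemma gfunctional_ge0 P : 0 <= complex.Re (gfunctional (P * star P)).
Proof.
rewrite gfunctionalE /cint /=; apply: Rintegral_ge0 => z _.
by rewrite ev_mul_star /= mulr_ge0 ?sqr_ge0 ?expR_ge0.
Qed.

Lemma gfunctional1 : exists2 e : R, 0 < e & gfunctional 1 = e%:C.
Proof.
have evE z : ev c 1 z = (expR (- (c * normsq z)))%:C.
  by rewrite /ev -(mpolyC1 _ R[i]) pevC mul1r.
exists (complex.Re (gfunctional 1)); last first.
  rewrite gfunctionalE /cint /=; congr (_ +i* _).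
  rewrite (_ : (fun z => _) = fun=> 0); first by rewrite /Rintegral integral0.
  by apply/funext => z; rewrite evE.
rewrite lt_neqAle; apply/andP; split; last first.
  by have := gfunctional_ge0 1; rewrite mul1r rmorph1.
rewrite eq_sym; apply/eqP => h.
have [i1 _] := cintegrable_ev c0 (1 : MP).
have eq0 : (\int[vol R n]_z `|(complex.Re (ev c 1 z))%:E| = 0)%E.
  move: h; rewrite gfunctionalE /cint /= /Rintegral => h.
  under eq_integral => z _.
    rewrite evE /= ger0_norm ?expR_ge0//.
    over.
  rewrite -[LHS]fineK; last first.
    by have := integrable_fin_num measurableT i1; under eq_integral do rewrite evE.
  by congr EFin; rewrite -[RHS]h; congr fine; apply: eq_integral => z _; rewrite evE.
have [m1 _] := integrableP _ _ _ i1.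
(* The Gaussian vanishes nowhere, so a zero integral would make the whole space a null set. *)
have /(ae_eq_integral_abs _ measurableT m1)[N [mN N0 sN]] := eq0.
have NT : N = setT.
  rewrite -subTset => z _; apply: sN => /= /(_ I) /eqP.
  by rewrite evE /= eqe gt_eqF ?expR_gt0.
by have := vol_setT_gt0; rewrite -NT N0 ltxx.
Qed.

End gaussian_functional.

(** * The special Hermite operator *)

Section special_hermite_symmetry.
Context (R : realType) (n : nat).
Local Notation MP := (mpoly (n + n) R[i]).
Local Notation "''X' k" := (mpolyX R[i] (mnm1 k)) (at level 8, k at level 2).
Local Notation "''d' k" := (@mderiv (n + n) R[i] k) (at level 8, k at level 2).
Implicit Types (P Q : MP) (z v : Cn R n) (phi : Cn R n -> R[i]).

Let c : R := 4^-1.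
Let c0 : 0 < c. Proof. by rewrite invr_gt0. Qed.

Let c2 : 2 * c%:C = 2^-1.
Proof.
rewrite /c fmorphV (rmorph_nat (real_complex R)).
have -> : (4 : R[i]) = 2 * 2 by rewrite -natrM.
by rewrite invfM mulrA divff ?mul1r// pnatr_eq0.
Qed.

(** [gz] and [gzb] are sqrt 2 times the Wirtinger derivatives in z_j and its conjugate, conjugated
    by exp(-|z|^2/4). *)
Definition gz j P : MP := 'd (lshift n j) P - 2^-1 *: ('X (rshift n j) * P).
Definition gzb j P : MP := 'd (rshift n j) P - 2^-1 *: ('X (lshift n j) * P).

Lemma gder_xE j P : gder c (dirx R j) P = rt R *: (gz j P + gzb j P).
Proof.
rewrite gder_x c2 /gz /gzb -!mul_mpolyC !mpolyCM; ring.
Qed.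

Lemma gder_yE j P : gder c (diry R j) P = ('i * rt R) *: (gz j P - gzb j P).
Proof.
rewrite gder_y c2 /gz /gzb -!mul_mpolyC !mpolyCM; ring.
Qed.

Lemma gzD j P Q : gz j (P + Q) = gz j P + gz j Q.
Proof. by rewrite /gz mderivD mulrDr scalerDr opprD addrACA. Qed.
Lemma gzbD j P Q : gzb j (P + Q) = gzb j P + gzb j Q.
Proof. by rewrite /gzb mderivD mulrDr scalerDr opprD addrACA. Qed.
Lemma gzZ j a P : gz j (a *: P) = a *: gz j P.
Proof. by rewrite /gz mderivZ -scalerAr scalerBr !scalerA mulrC. Qed.
Lemma gzbZ j a P : gzb j (a *: P) = a *: gzb j P.
Proof. by rewrite /gzb mderivZ -scalerAr scalerBr !scalerA mulrC. Qed.
Lemma gzN j P : gz j (- P) = - gz j P.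
Proof. by rewrite -[- P]scaleN1r gzZ scaleN1r. Qed.
Lemma gzbN j P : gzb j (- P) = - gzb j P.
Proof. by rewrite -[- P]scaleN1r gzbZ scaleN1r. Qed.

Definition xpol j : MP := rt R *: ('X (lshift n j) + 'X (rshift n j)).
Definition ypol j : MP := (- 'i * rt R) *: ('X (lshift n j) - 'X (rshift n j)).

Let ii : 'i * 'i = -1 :> R[i].
Proof. by apply/eqP; rewrite eq_complex /=; apply/andP; split; apply/eqP; ring. Qed.

Lemma pev_xpol j z : pev (xpol j) z = (z.1 ord0 j)%:C.
Proof.
rewrite /xpol pevZ pevD !pevX zc_l zc_r -mulrDr mulrA rt_sqr.
rewrite (_ : _ + _ = 2 * (z.1 ord0 j)%:C); first by rewrite mulrA mulVf ?mul1r// pnatr_eq0.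
by apply/eqP; rewrite eq_complex /=; apply/andP; split; apply/eqP; ring.
Qed.

Lemma pev_ypol j z : pev (ypol j) z = (z.2 ord0 j)%:C.
Proof.
rewrite /ypol pevZ pevD pevN !pevX zc_l zc_r -mulrBr -mulrA (mulrA (rt R)) rt_sqr.
rewrite (_ : _ - _ = 2 * ('i * (z.2 ord0 j)%:C)); last first.
  by apply/eqP; rewrite eq_complex /=; apply/andP; split; apply/eqP; ring.
rewrite (mulrA 2^-1) mulVf ?pnatr_eq0// mul1r mulrA mulNr ii opprK mul1r//.
Qed.

Definition npol : MP := 2^-1 *: \sum_(j < n) 'X (lshift n j) * 'X (rshift n j).

Lemma pev_npol z : pev npol z = (4^-1 * normsq z)%:C.
Proof.
rewrite /npol pevZ pev_sum /normsq mulr_sumr mulr_sumr rmorph_sum; apply: eq_bigr => j _.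
rewrite pevM !pevX mulrACA rt_sqr [LHS]mulrA zc_l zc_r.
have -> : 2^-1 * 2^-1 = (4^-1)%:C :> R[i].
  by rewrite -invfM -natrM fmorphV (rmorph_nat (real_complex R)).
by apply/eqP; rewrite eq_complex /=; apply/andP; split; apply/eqP; ring.
Qed.

Definition hermite_pol P : MP :=
  - \sum_(j < n) (gder c (dirx R j) (gder c (dirx R j) P) +
                  gder c (diry R j) (gder c (diry R j) P)) + npol * P
  - 'i *: \sum_(j < n) (xpol j * gder c (diry R j) P - ypol j * gder c (dirx R j) P).

(** The factorisation of the Laplacian as four times the mixed Wirtinger derivative, symmetrised so
    that A and B need not commute. *)
Lemma sum_sqr_ladder (A B : MP -> MP) P :
  (forall a Q Q', A (a *: (Q + Q')) = a *: (A Q + A Q')) ->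
  (forall a Q Q', B (a *: (Q + Q')) = a *: (B Q + B Q')) ->
  (forall Q, A (- Q) = - A Q) -> (forall Q, B (- Q) = - B Q) ->
  rt R *: (A (rt R *: (A P + B P)) + B (rt R *: (A P + B P))) +
  ('i * rt R) *: (A (('i * rt R) *: (A P - B P)) - B (('i * rt R) *: (A P - B P))) =
  A (B P) + B (A P).
Proof.
move=> AL BL AN BN; rewrite !AL !BL AN BN -!scalerDr -scalerBr !scalerA.
have -> : 'i * rt R * ('i * rt R) = - 2^-1 by rewrite mulrACA ii rt_sqr mulN1r.
rewrite rt_sqr scaleNr -scalerBr.
move: (A (A P)) (A (B P)) (B (A P)) (B (B P)) => a b d e.
transitivity (2^-1 *: (2 *: (b + d))).
  by congr (_ *: _); rewrite scaler_nat; ring.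
by rewrite scalerA mulVf ?scale1r// pnatr_eq0.
Qed.

(** The rotation field x d/dy - y d/dx is i (z d/dz - w d/dw), where w is the conjugate of z. *)
Lemma rotation_ladder (x y A B : MP) :
  'i *: ((rt R *: (x + y)) * (('i * rt R) *: (A - B)) -
         ((- 'i * rt R) *: (x - y)) * (rt R *: (A + B))) = - (x * A - y * B).
Proof.
rewrite -!scalerAl -!scalerAr !scalerA.
have -> : rt R * ('i * rt R) = 'i * 2^-1 by rewrite mulrCA rt_sqr.
have -> : - 'i * rt R * rt R = - ('i * 2^-1) by rewrite -mulrA rt_sqr mulNr.
rewrite scaleNr opprK -scalerDr scalerA mulrA ii mulN1r scaleNr; congr (- _).
transitivity (2^-1 *: (2 *: (x * A - y * B))).
  by congr (_ *: _); rewrite scaler_nat; ring.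
by rewrite scalerA mulVf ?scale1r// pnatr_eq0.
Qed.

Lemma special_hermite_ev P : special_hermite (ev c P) = ev c (hermite_pol P).
Proof.
apply/funext => z; rewrite /special_hermite /laplacian /hermite_pol.
have evN Q : ev c (- Q) z = - ev c Q z by rewrite /ev pevN mulNr.
have ev_sum (F : 'I_n -> MP) : ev c (\sum_j F j) z = \sum_j ev c (F j) z.
  by rewrite /ev pev_sum mulr_suml.
have evM Q Q' : ev c (Q * Q') z = pev Q z * ev c Q' z by rewrite /ev pevM mulrA.
rewrite !evD !evN evZ !ev_sum; congr (_ + _ - _).
- by congr (- _); apply: eq_bigr => j _; rewrite !cderive_ev evD.
- by rewrite evM pev_npol.
- congr (_ * _); apply: eq_bigr => j _.
  by rewrite evD evN !evM pev_xpol pev_ypol !cderive_ev.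
Qed.

(** The eigenvalue sees the left degree only; the right degree and the choice inside a bidegree stay
    free, which makes the eigenspaces large enough for the construction. *)
Lemma hermite_polE P : hermite_pol P = 2 *: numl P + n%:R *: P.
Proof.
have h j : gder c (dirx R j) (gder c (dirx R j) P) +
    gder c (diry R j) (gder c (diry R j) P) = gz j (gzb j P) + gzb j (gz j P).
  rewrite !gder_xE !gder_yE; apply: sum_sqr_ladder => *.
  - by rewrite gzZ gzD.
  - by rewrite gzbZ gzbD.
  - by rewrite gzN.
  - by rewrite gzbN.
have h' j : 'i *: (xpol j * gder c (diry R j) P - ypol j * gder c (dirx R j) P) =
   - ('X (lshift n j) * gz j P - 'X (rshift n j) * gzb j P).
  by rewrite gder_xE gder_yE; exact: rotation_ladder.
rewrite /hermite_pol /npol; under eq_bigr do rewrite h.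
rewrite (scaler_sumr 'i); under [X in _ - X]eq_bigr do rewrite h'.
rewrite -scalerAl mulr_suml (scaler_sumr 2^-1) /numl (scaler_sumr 2).
rewrite scaler_nat -[X in P *+ X](card_ord n) -sumr_const -!sumrN -!big_split /=.
apply: eq_bigr => j _.
rewrite /gz /gzb /cr !mderivB !mderivZ !mderivXM tau_lshift !eqxx !scale1r.
rewrite (mderiv_comm (rshift n j)).
move: ('d (rshift n j) ('d (lshift n j) P)) ('d (lshift n j) P) ('d (rshift n j) P).
move: ('X (lshift n j)) ('X (rshift n j)) => x y t u w.
rewrite -!mul_mpolyC mpolyC_nat.
(* The constant polynomial 1/2 becomes a letter H with 2 H = 1, and the difference of the two sides
   is a multiple of 2 H - 1. *)
have hH : 2 * mpolyC (n + n) (2^-1 : R[i]) = 1.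
  by rewrite -mpolyC_nat -mpolyCM divff ?mpolyC1// pnatr_eq0.
move: (mpolyC _ _) hH => H hH; apply/eqP; rewrite -subr_eq0; apply/eqP.
transitivity ((2 * H - 1) * (P + x * u + y * w - H * x * y * P)); last first.
  by rewrite hH subrr mul0r.
ring.
Qed.

(** Boundedness is all that is asked of the test function and its derivatives: the other factor of
    each pairing has Gaussian decay. *)
Definition nice phi := cdiff phi /\ exists M, forall z, Normc.normc (phi z) <= M.

Lemma schwartz_nice phi s : schwartz phi -> nice (foldr (@cderive R n) phi s).
Proof.
move=> [sm bd]; split; first exact: sm.
by have [M hM] := bd s 0; exists M => z; have := hM z; rewrite expr0 mul1r.
Qed.

Lemma vbd_ev_conj P phi : nice phi -> vbd (fun z => ev c P z * conjc (phi z)).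
Proof.
move=> [_ [M hM]]; have [K K0 hK] := ev_le_vom P c0.
exists (K * `|M|) => z; rewrite Normc.normcM normc_conj mulrAC.
apply: ler_pM; rewrite ?normc_ge0//.
by apply: le_trans (hM z) _; exact: ler_norm.
Qed.

Lemma cdiff_ev_conj P phi : nice phi -> cdiff (fun z => ev c P z * conjc (phi z)).
Proof. by move=> [d _]; apply: cdiffM; [exact: cdiff_ev|exact: cdiff_conj]. Qed.

Lemma cintegrable_ev_conj P phi : nice phi ->
  cintegrable (fun z => ev c P z * conjc (phi z)).
Proof. by move=> h; apply: cintegrable_vbd; [exact: cdiff_ev_conj|exact: vbd_ev_conj]. Qed.

Lemma inner_ev_linear phi : nice phi ->
  linear_for *%R (fun P => inner (ev c P) phi).
Proof.
move=> h a P Q /=; rewrite !innerE -cintZ; last exact: cintegrable_ev_conj.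
rewrite -cintD; [|exact/cintegrableZ/cintegrable_ev_conj|exact: cintegrable_ev_conj].
by congr cint; apply/funext => z; rewrite evD evZ mulrDl mulrA.
Qed.

Lemma inner_ev_cderive v P phi : coord_dir v -> nice phi -> nice (cderive v phi) ->
  inner (ev c P) (cderive v phi) = - inner (ev c (gder c v P)) phi.
Proof.
move=> dv h h'; apply/eqP; rewrite -addr_eq0 addrC; apply/eqP.
rewrite !innerE -cintD; [|exact: cintegrable_ev_conj..].
set F := fun z => ev c P z * conjc (phi z).
have e : cderive v F =
    fun z => ev c (gder c v P) z * conjc (phi z) + ev c P z * conjc (cderive v phi z).
  apply/funext => z; apply: is_cderive_val; apply: is_cderiveM.
    exact: is_cderive_ev.
  by apply: is_cderive_conj; apply: cdiff_is_cderive; exact: h.1.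
rewrite -e; apply: cint_cderive0 => //.
- exact: cdiff_ev_conj.
- by rewrite e; apply: cdiffD; exact: cdiff_ev_conj.
- exact: vbd_ev_conj.
- have [K hK] := vbd_ev_conj (gder c v P) h; have [M hM] := vbd_ev_conj P h'.
  exists (K + M) => z; rewrite e mulrDl; apply: le_trans (le_normcD _ _) _.
  exact: lerD.
Qed.

(** The coefficient x_j does not depend on y_j, so moving the derivative past it leaves no
    correction term. *)
Lemma gder_xpol j P :
  gder c (diry R j) (xpol j * P) = xpol j * gder c (diry R j) P.
Proof.
rewrite !gder_yE -scalerAr; congr (_ *: _); rewrite /gz /gzb /xpol.
rewrite !mderivM !mderivZ !mderivD !mderivXU !eqxx eq_lrshift eq_rlshift.
rewrite addr0 add0r -!mul_mpolyC; ring.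
Qed.

Lemma gder_ypol j P :
  gder c (dirx R j) (ypol j * P) = ypol j * gder c (dirx R j) P.
Proof.
rewrite !gder_xE -scalerAr; congr (_ *: _); rewrite /gz /gzb /ypol.
rewrite !mderivM !mderivZ !mderivB !mderivXU !eqxx eq_lrshift eq_rlshift.
rewrite subr0 sub0r -!mul_mpolyC; ring.
Qed.

Let conjc_sum (F : 'I_n -> R[i]) : conjc (\sum_j F j) = \sum_j conjc (F j).
Proof. exact: rmorph_sum. Qed.

Let conjc_hermite_term (p q : R) (e a b d f : R[i]) :
  (-1 * (e * conjc a) + -1 * (e * conjc b)) +
    ('i * (p%:C * e * conjc d) + - 'i * (q%:C * e * conjc f)) =
  - (e * conjc (a + b)) + 'i * (e * conjc (p%:C * d - q%:C * f)).
Proof.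
case: e a b d f => [e e'] [a a'] [b b'] [d d'] [f f'].
by apply/eqP; rewrite eq_complex /=; apply/andP; split; apply/eqP; ring.
Qed.

Let conjc_hermite (p : R) (e a b d : R[i]) :
  e * conjc (- a + p%:C * d - 'i * b) =
  - (e * conjc a) + 'i * (e * conjc b) + 1 * (p%:C * e * conjc d).
Proof.
case: e a b d => [e e'] [a a'] [b b'] [d d'].
by apply/eqP; rewrite eq_complex /=; apply/andP; split; apply/eqP; ring.
Qed.

(** Symmetry by parts: each derivative moved off phi changes sign and becomes [gder]. The Laplacian
    takes two moves; the rotation term takes one, and its sign is restored by the conjugation of
    i. *)
Lemma inner_special_hermite P phi : schwartz phi ->
  inner (ev c P) (special_hermite phi) = inner (ev c (hermite_pol P)) phi.
Proof.
move=> sp.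
have n0 : nice phi by exact: (schwartz_nice [::] sp).
have n1 v : nice (cderive v phi) by exact: (schwartz_nice [:: v] sp).
have n2 v : nice (cderive v (cderive v phi)) by exact: (schwartz_nice [:: v; v] sp).
have dx (j : 'I_n) : coord_dir (dirx R j) by exists j; left.
have dy (j : 'I_n) : coord_dir (diry R j) by exists j; right.
have Lin := inner_ev_linear n0.
have LD Q Q' : inner (ev c (Q + Q')) phi = inner (ev c Q) phi + inner (ev c Q') phi.
  by have := Lin 1 Q Q'; rewrite scale1r mul1r.
have L0 : inner (ev c 0) phi = 0.
  by apply: (addrI (inner (ev c 0) phi)); rewrite -LD !addr0.
have LZ a Q : inner (ev c (a *: Q)) phi = a * inner (ev c Q) phi.
  by have := Lin a Q 0; rewrite L0 !addr0.
have LN Q : inner (ev c (- Q)) phi = - inner (ev c Q) phi.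
  by rewrite -scaleN1r LZ mulN1r.
have Lsum (F : 'I_n -> MP) :
    inner (ev c (\sum_j F j)) phi = \sum_j inner (ev c (F j)) phi.
  exact: (big_morph (fun Q => inner (ev c Q) phi) LD L0).
have int Q psi : nice psi -> cintegrable (fun z => ev c Q z * conjc (psi z)).
  exact: cintegrable_ev_conj.
have I1 v Q : coord_dir v ->
    inner (ev c Q) (cderive v phi) = - inner (ev c (gder c v Q)) phi.
  by move=> dv; exact: inner_ev_cderive dv n0 (n1 v).
have I2 v Q : coord_dir v -> inner (ev c Q) (cderive v (cderive v phi)) =
    inner (ev c (gder c v (gder c v Q))) phi.
  by move=> dv; rewrite (inner_ev_cderive Q dv (n1 v) (n2 v)) (I1 _ _ dv) opprK.
(* [T] is kept opaque to prevent unification from unfolding it. *)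
have [T TE] : exists T : R[i] -> MP -> (Cn R n -> R[i]) -> Cn R n -> R[i],
    forall a Q psi, T a Q psi = fun z => a * (ev c Q z * conjc (psi z)).
  by exists (fun a Q psi z => a * (ev c Q z * conjc (psi z))).
have TEz a Q psi z : T a Q psi z = a * (ev c Q z * conjc (psi z)) by rewrite TE.
have Tint a Q psi : nice psi -> cintegrable (T a Q psi).
  by move=> h; rewrite TE; apply: cintegrableZ; exact: int.
have Tval a Q psi : nice psi -> cint (T a Q psi) = a * inner (ev c Q) psi.
  by move=> h; rewrite TE innerE -cintZ//; exact: int.
(* The j-th summand, cut into four separately integrable pieces; conjugation has turned - i into
   i. *)
pose G j := fun z =>
  (T (- 1) P (cderive (dirx R j) (cderive (dirx R j) phi)) z +
   T (- 1) P (cderive (diry R j) (cderive (diry R j) phi)) z) +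
  (T 'i (xpol j * P) (cderive (diry R j) phi) z +
   T (- 'i) (ypol j * P) (cderive (dirx R j) phi) z).
have Gint j : cintegrable (G j).
  by apply: cintegrableD; apply: cintegrableD; apply: Tint.
have -> : inner (ev c P) (special_hermite phi) =
    cint (fun z => (\sum_j G j z) + T 1 (npol * P) phi z).
  rewrite innerE; congr cint; apply/funext => z.
  have Tx j psi : T 'i (xpol j * P) psi z =
      'i * ((z.1 ord0 j)%:C * ev c P z * conjc (psi z)).
    by rewrite TEz; congr (_ * (_ * _)); rewrite /ev pevM mulrA pev_xpol.
  have Ty j psi : T (- 'i) (ypol j * P) psi z =
      - 'i * ((z.2 ord0 j)%:C * ev c P z * conjc (psi z)).
    by rewrite TEz; congr (_ * (_ * _)); rewrite /ev pevM mulrA pev_ypol.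
  have evn : ev c (npol * P) z = (4^-1 * normsq z)%:C * ev c P z.
    by rewrite /ev pevM mulrA pev_npol.
  rewrite (eq_bigr (fun j => - (ev c P z *
        conjc (cderive (dirx R j) (cderive (dirx R j) phi) z +
               cderive (diry R j) (cderive (diry R j) phi) z)) +
     'i * (ev c P z * conjc ((z.1 ord0 j)%:C * cderive (diry R j) phi z -
                      (z.2 ord0 j)%:C * cderive (dirx R j) phi z)))); last first.
    move=> j _; apply: etrans (conjc_hermite_term _ _ _ _ _ _ _).
    by congr (_ + _ + (_ + _)); [exact: TEz|exact: TEz|exact: Tx|exact: Ty].
  rewrite big_split; cbv beta; rewrite sumrN -!mulr_sumr -!conjc_sum TEz evn.
  exact: conjc_hermite.
rewrite cintD; [|exact: cintegrable_sum|exact: Tint].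
rewrite cint_sum// Tval// mul1r.
have Gval j : cint (G j) =
    - inner (ev c (gder c (dirx R j) (gder c (dirx R j) P) +
                  gder c (diry R j) (gder c (diry R j) P))) phi
    - 'i * inner (ev c (xpol j * gder c (diry R j) P - ypol j * gder c (dirx R j) P)) phi.
  have -> : cint (G j) = (cint (T (- 1) P (cderive (dirx R j) (cderive (dirx R j) phi))) +
   cint (T (- 1) P (cderive (diry R j) (cderive (diry R j) phi)))) +
  (cint (T 'i (xpol j * P) (cderive (diry R j) phi)) +
   cint (T (- 'i) (ypol j * P) (cderive (dirx R j) phi))).
    rewrite /G cintD; [congr (_ + _)|by apply: cintegrableD; apply: Tint..].
      by apply: cintD; apply: Tint.
    by apply: cintD; apply: Tint.
  have v1 v Q : coord_dir v -> cint (T (- 1) Q (cderive v (cderive v phi))) =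
      - 1 * inner (ev c (gder c v (gder c v Q))) phi.
    by move=> dv; apply: etrans (Tval _ _ _ (n2 _)) _; congr (_ * _); exact: I2.
  have v2 a v Q : coord_dir v -> cint (T a Q (cderive v phi)) =
      a * - inner (ev c (gder c v Q)) phi.
    by move=> dv; apply: etrans (Tval _ _ _ (n1 _)) _; congr (_ * _); exact: I1.
  have comb A B X Y : - 1 * inner (ev c A) phi + - 1 * inner (ev c B) phi +
      ('i * - inner (ev c X) phi + - 'i * - inner (ev c Y) phi) =
      - inner (ev c (A + B)) phi - 'i * inner (ev c (X - Y)) phi.
    rewrite (LD A B) (LD X (- Y)) (LN Y).
    move: (inner (ev c A) phi) (inner (ev c B) phi) (inner (ev c X) phi).
    by move: (inner (ev c Y) phi) => *; ring.
  apply: etrans (comb _ _ _ _).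
  have h3 := v2 'i (diry R j) (xpol j * P) (dy j); rewrite gder_xpol in h3.
  have h4 := v2 (- 'i) (dirx R j) (ypol j * P) (dx j); rewrite gder_ypol in h4.
  by congr (_ + _ + (_ + _)); [exact: v1|exact: v1|exact: h3|exact: h4].
under eq_bigr do rewrite Gval.
have sumE (A B : 'I_n -> R[i]) :
    \sum_j (- A j - 'i * B j) = - (\sum_j A j) - 'i * \sum_j B j.
  by rewrite big_split /= !sumrN mulr_sumr.
rewrite sumE -Lsum -Lsum.
by rewrite /hermite_pol !LD !LN LZ addrAC.
Qed.

End special_hermite_symmetry.

(** * Eigenfunctions and their evolution *)

Section eigenfunctions.
Context (R : realType) (n : nat).
Local Notation MP := (mpoly (n + n) R[i]).
Implicit Types (P Q : MP) (z : Cn R n) (f g h phi : Cn R n -> R[i]) (k : nat).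

Definition hf P := ev (4^-1 : R) P.

Let c0 : 0 < 4^-1 :> R. Proof. by rewrite invr_gt0. Qed.
Lemma half_gt0 : 0 < 2^-1 :> R. Proof. by rewrite invr_gt0. Qed.

Lemma hf_conj P Q z : hf P z * conjc (hf Q z) = ev 2^-1 (P * star Q) z.
Proof.
have e : (2^-1 : R) = 4^-1 + 4^-1 by lra.
rewrite /hf /ev pevM pev_star rmorphM /= {1}e mulrDl opprD expRD.
set r := expR _; rewrite [X in _ * (_ * X)](_ : _ = r%:C); last exact: conjc_real.
by rewrite mulrACA -rmorphM.
Qed.

Lemma hf_normc_sqr P z :
  Normc.normc (hf P z) ^+ 2 = complex.Re (ev 2^-1 (P * star P) z).
Proof. by rewrite -hf_conj -sqr_normcE. Qed.

Lemma inner_hf P Q : inner (hf P) (hf Q) = hform (gfunctional n half_gt0) P Q.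
Proof.
rewrite innerE /hform gfunctionalE; congr cint; apply/funext => z.
exact: hf_conj.
Qed.

Lemma L2_hf P : L2 (hf P).
Proof.
have [d1 d2] := cdiff_continuous (cdiff_ev (4^-1 : R) P); split.
- exact: continuous_measurable_Cn.
- exact: continuous_measurable_Cn.
- have [/integrableP[_ i1] _] := cintegrable_ev half_gt0 (P * star P).
  rewrite (le_lt_trans _ i1)// le_eqVlt; apply/orP; left; apply/eqP.
  apply: eq_integral => z _; rewrite hf_normc_sqr gee0_abs// lee_fin.
  by rewrite -hf_normc_sqr sqr_ge0.
Qed.

Lemma hfZ a P : hf (a *: P) = fun z => a * hf P z.
Proof. by apply/funext => z; exact: evZ. Qed.

Lemma hermite_pol_eig k y P : eig k%:R y P ->
  hermite_pol P = (eigenvalue_of R n k)%:C *: P.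
Proof.
move=> [e _]; rewrite hermite_polE e scalerA -scalerDl; congr (_ *: _).
by rewrite /eigenvalue_of natrD natrM rmorphD rmorphM !(rmorph_nat (real_complex R)).
Qed.

Lemma special_hermite_hf k y P : eig k%:R y P ->
  special_hermite (hf P) = fun z => (eigenvalue_of R n k)%:C * hf P z.
Proof. by move=> e; rewrite special_hermite_ev (hermite_pol_eig e) -hfZ. Qed.

Lemma hermite_eigenspace_hf k y P : eig k%:R y P -> hermite_eigenspace k (hf P).
Proof.
move=> e; have hE := hfZ (eigenvalue_of R n k)%:C P.
split; first exact: L2_hf.
  by rewrite -hE; exact: L2_hf.
move=> phi sp; apply: etrans (inner_special_hermite P sp) _.
by congr (inner _ phi); rewrite -hE /hf; congr (ev _ _); exact: hermite_pol_eig e.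
Qed.

Lemma L2_cintegrable f g : L2 f -> L2 g -> cintegrable (fun z => f z * conjc (g z)).
Proof.
move=> [f1 f2 f3] [g1 g2 g3].
have mE (r : Cn R n -> R[i]) :
    measurable_fun setT (fun z => complex.Re (r z) : measurableTypeR R) ->
    measurable_fun setT (fun z => complex.Im (r z) : measurableTypeR R) ->
    measurable_fun setT (fun z => Normc.normc (r z) ^+ 2 : measurableTypeR R).
  move=> r1 r2.
  rewrite (_ : (fun z => _) = fun z => complex.Re (r z) ^+ 2 + complex.Im (r z) ^+ 2).
    by apply: measurable_funD; apply: measurable_funX.
  by apply/funext => z; case: (r z) => a b /=; rewrite sqr_sqrtr// addr_ge0 ?sqr_ge0.
have iE (r : Cn R n -> R[i]) : L2 r ->
    (vol R n).-integrable setT (fun z => (Normc.normc (r z) ^+ 2)%:E).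
  move=> [r1 r2 r3]; apply/integrableP; split; first by apply/measurable_EFinP; exact: mE.
  by under eq_integral do rewrite gee0_abs ?lee_fin ?sqr_ge0//.
have ifg : (vol R n).-integrable setT
    (fun z => (Normc.normc (f z) ^+ 2)%:E + (Normc.normc (g z) ^+ 2)%:E)%E.
  by apply: integrableD => //; apply: iE.
have bound z (r : R) : `|r| <= Normc.normc (f z * conjc (g z)) ->
    (`|r%:E| <= `|(Normc.normc (f z) ^+ 2)%:E + (Normc.normc (g z) ^+ 2)%:E|)%E.
  rewrite Normc.normcM normc_conj -EFinD lee_fin => h; apply: le_trans h _.
  rewrite [leRHS]ger0_norm ?addr_ge0 ?sqr_ge0//.
  by have := normc_ge0 (f z); have := normc_ge0 (g z); nra.
split; apply: (le_integrable measurableT _ _ ifg).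
- apply/measurable_EFinP.
  rewrite (_ : (fun z => _) = fun z =>
      complex.Re (f z) * complex.Re (g z) + complex.Im (f z) * complex.Im (g z)).
    by apply: measurable_funD; apply: measurable_funM.
  by apply/funext => z; rewrite cReM; case: (g z) => a b /=; rewrite mulrN opprK.
- by move=> z _; apply: bound; exact: le_Re_normc.
- apply/measurable_EFinP.
  rewrite (_ : (fun z => _) = fun z =>
      complex.Im (f z) * complex.Re (g z) - complex.Re (f z) * complex.Im (g z)).
    by apply: measurable_funB; apply: measurable_funM.
  by apply/funext => z; rewrite cImM; case: (g z) => a b /=; rewrite mulrN addrC.
- by move=> z _; apply: bound; exact: le_Im_normc.
Qed.

Lemma innerC f g : inner g f = conjc (inner f g).
Proof.
rewrite !innerE -cint_conj; congr cint; apply/funext => z.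
by rewrite rmorphM /= conjcK mulrC.
Qed.

Lemma eigenvalue_inj k k' : eigenvalue_of R n k = eigenvalue_of R n k' -> k = k'.
Proof.
move=> /eqP; rewrite /eigenvalue_of eqr_nat => /eqP; lia.
Qed.

Lemma conjcZl (r : R) (w : R[i]) : conjc (r%:C * w) = r%:C * conjc w.
Proof. by rewrite rmorphM; congr (_ * _); exact: conjc_real. Qed.

(** [h] is an eigenfunction in the weak sense only, but [hf P] is Schwartz and may be used as the
    test function in the graph condition of [h]. *)
Lemma hermite_eigenspace_orth k k' y P h : eig k%:R y P -> k != k' ->
  hermite_eigenspace k' h -> inner (hf P) h = 0.
Proof.
move=> e kk' [Lh _ hh]; rewrite innerC.
have := hh (hf P) (schwartz_ev P c0); rewrite (special_hermite_hf e).
rewrite !innerE.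
have ihf := L2_cintegrable Lh (L2_hf P).
have -> : (fun z => h z * conjc ((eigenvalue_of R n k)%:C * hf P z)) =
    fun z => (eigenvalue_of R n k)%:C * (h z * conjc (hf P z)).
  apply/funext => z; rewrite conjcZl; exact: mulrCA.
have -> : (fun z => (eigenvalue_of R n k')%:C * h z * conjc (hf P z)) =
    fun z => (eigenvalue_of R n k')%:C * (h z * conjc (hf P z)).
  by apply/funext => z; rewrite mulrA.
rewrite !cintZ// => /eqP; rewrite -subr_eq0 -mulrBl mulf_eq0 => /orP[|/eqP ->]; last first.
  exact: conjc0.
rewrite subr_eq0 => /eqP/complexI/eigenvalue_inj kE.
by rewrite kE eqxx in kk'.
Qed.

Lemma normc_expi (x : R) : Normc.normc (expi x) = 1.
Proof. by rewrite /= cos2Dsin2 sqrtr1. Qed.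

Lemma inner0l f : inner (fun=> 0) f = 0.
Proof. by rewrite innerE; under eq_fun do rewrite mul0r; exact: cint0. Qed.

(** The projections of [hf P] are itself at k and 0 elsewhere, by the orthogonality just proved, so
    the partial sums are exact once N > k. *)
Lemma is_propagator_hf k y P t : eig k%:R y P ->
  is_propagator t (hf P) (fun z => expi (- (t * eigenvalue_of R n k)) * hf P z).
Proof.
move=> e; split; first by rewrite -hfZ; exact: L2_hf.
have hf0 : hf 0 = fun=> 0 by apply/funext => z; rewrite /hf /ev pev0 mul0r.
exists (fun k' => if k' == k then hf P else fun=> 0) => [k'|].
  case: eqVneq => [->|kk']; split.
  - exact: hermite_eigenspace_hf e.
  - by move=> h _; under eq_fun do rewrite subrr; exact: inner0l.
  - rewrite -hf0; split; rewrite -?hfZ ?scaler0; [exact: L2_hf|exact: L2_hf|].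
    by move=> phi _; rewrite hf0 !inner0l.
  - move=> h hh; under eq_fun do rewrite subr0.
    by apply: hermite_eigenspace_orth e _ hh; rewrite eq_sym.
apply: cvg_near_cst; near=> N.
have kN : (k < N)%N by near: N; exact: nbhs_infty_gt.
apply: integral0_eq => z _; rewrite (bigD1 (Ordinal kN))//= eqxx big1.
  by rewrite addr0 subrr Normc.normc0 expr0n.
move=> i; rewrite -val_eqE /= => /negbTE ->.
by rewrite mulr0.
Unshelve. all: by end_near. Qed.

End eigenfunctions.

(** * Concentrating eigenfunctions *)

Section concentrating_family.
Context (R : realType) (n' : nat).
Local Notation n := n'.+1.
Local Notation MP := (mpoly (n + n) R[i]).
Implicit Types (P Q : MP) (d a b j k m : nat).

Let E := gfunctional n (half_gt0 R).
Let E' := gfunctional n (@ltr01 R).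

Let E_ibp (k : 'I_(n + n)) P : E (mpolyX R[i] (mnm1 k) * P) = E (mderiv (tau k) P).
Proof.
by rewrite -gfunctional_ibp fmorphV (rmorph_nat (real_complex R)) divff ?mul1r//.
Qed.

Let E'_ibp (k : 'I_(n + n)) P : 2 * E' (mpolyX R[i] (mnm1 k) * P) = E' (mderiv (tau k) P).
Proof. by rewrite -gfunctional_ibp rmorph1 mulr1. Qed.

Let E1_gt0 : 0 < complex.Re (E 1).
Proof. by have [e e0 ->] := gfunctional1 n (half_gt0 R). Qed.

Definition block_rank d := (n * d * (n * d))%N.

(** The integers (nd)^2 + nd + a with a < d lie in disjoint intervals for different d, so one of the
    two degrees already determines d. *)
Lemma block_rank_inj d d' a a' : (a < d)%N -> (a' < d')%N ->
  (block_rank d + (n * d + a) = block_rank d' + (n * d' + a'))%N ->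
  d = d' /\ a = a'.
Proof.
rewrite /block_rank => ad ad' h.
have lt x x' y y' : (y < x)%N -> (y' < x')%N -> (x < x')%N ->
    (n * x * (n * x) + (n * x + y) < n * x' * (n * x') + (n * x' + y'))%N.
  move=> yx y'x' xx'.
  have h1 : (n * x.+1 <= n * x')%N by rewrite leq_mul2l.
  have h2 : (n * x.+1 * (n * x.+1) <= n * x' * (n * x'))%N by exact: leq_mul.
  have h3 : (x <= n * (n * x))%N by rewrite mulnA leq_pmull ?muln_gt0.
  nia.
have dd' : d = d'.
  case: (ltngtP d d') => // l.
    by have := lt _ _ _ _ ad ad' l; rewrite h ltnn.
  by have := lt _ _ _ _ ad' ad l; rewrite h ltnn.
by split => //; move: h; rewrite dd' => /addnI/addnI.
Qed.

Lemma block_mass : exists2 c : R, 0 < c & forall d a b P Q,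
  (a < d)%N -> (b < d)%N -> fock (n * d + a) (n * d + b) P ->
  Q = iter (block_rank d) (@rai R n) P -> hform E Q Q = 1 ->
  c / d%:R <= complex.Re (E' (Q * star Q)).
Proof.
have [e e0 eE] := gfunctional1 n (half_gt0 R).
have [e' e'0 eE'] := gfunctional1 n (@ltr01 R).
(* The quotient e' / e compares the two functionals at 1; the rest is [square_binomial_lower] at r =
   n d, apart from the factor 1/d. *)
exists (e^-1 * (e' * (expR (- (25 / 2)) / (2 * n%:R)))).
  by rewrite mulr_gt0 ?invr_gt0// mulr_gt0// divr_gt0 ?expR_gt0// mulr_gt0// ltr0n.
move=> d a b P Q ad bd fP QE Q1.
have d0 : (0 < d)%N by exact: leq_trans ad.
set al := (n * d + a + (n * d + b) + n').
have alE : (n * d + a + (n * d + b) + n = al.+1)%N by rewrite /al addnS.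
(* The base degrees give 2nd, the offsets less than 2d, and n - 1 is below nd: hence the 5. *)
have al5 : (al <= 5 * (n * d))%N.
  have h1 : (d <= n * d)%N by rewrite leq_pmull.
  have h2 : (n' <= n * d)%N by rewrite (leq_trans (leqnSn _))// leq_pmulr.
  rewrite /al; lia.
have := weight_rai E_ibp (gfunctional_star (half_gt0 R)) (gfunctional_ge0 (half_gt0 R))
  (rt_sqr R) (rt_conj R) E'_ibp eE eE' (ltW e'0) fP alE QE.
have -> : nrm E Q = 1 by rewrite /nrm Q1.
rewrite mulr1 -(mulrC (complex.Re _)) => hw.
rewrite -mulrA mulrC ler_pdivrMr//.
apply: le_trans hw.
rewrite -mulrA ler_pM2l// -mulrA -invfM -mulrA -natrM.
have nd0 : (0 < n * d)%N by rewrite muln_gt0.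
apply: le_trans (square_binomial_lower R nd0 al5) _.
(* The power of 2 in [weight_rai] is smaller by n - 1 in its exponent than the one normalising the
   binomial, which only helps. *)
rewrite mulrC -/(block_rank d) ler_wpM2r ?ler0n//.
rewrite lef_pV2 ?posrE ?exprn_gt0// ler_weXn2l ?ler1n//.
by rewrite leq_add2l /al leq_addr.
Qed.

(** The tag d stands for the parameter d + 1, so no block is empty. The two middle entries are the
    offsets of the bidegree and the last numbers the states in it: (d + 1)^(2n) indices per tag. *)
Definition concentrating_index M :=
  {d : 'I_M & ('I_d.+1 * 'I_d.+1 * 'I_(d.+1 ^ n' * d.+1 ^ n'))%type}.

Lemma concentrating_family : exists2 c : R, 0 < c &
  forall M, exists P : concentrating_index M -> MP,
  [/\ forall x, exists k m, eig k%:R m%:R (P x),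
      forall x y, hform E (P x) (P y) = (x == y)%:R &
      forall x, c / (tag x : 'I_M).+1%:R <= complex.Re (E' (P x * star (P x)))].
Proof.
have [c c0 hc] := block_mass.
exists c => // M.
have : forall t : nat * nat * nat, exists e : nat -> MP,
    (0 < t.1.1)%N ->
    (forall i, (i < t.1.1 ^ n' * t.1.1 ^ n')%N ->
      exists2 P, fock (n * t.1.1 + t.1.2) (n * t.1.1 + t.2) P &
        e i = iter (block_rank t.1.1) (@rai R n) P) /\
    (forall i l, (i < t.1.1 ^ n' * t.1.1 ^ n')%N -> (l < t.1.1 ^ n' * t.1.1 ^ n')%N ->
      hform E (e i) (e l) = (i == l)%:R).
  move=> [[d a] b] /=; have [d0|d0] := posnP d; first by exists (fun=> 0).
  have [||e he] := block_family E_ibp (gfunctional_star (half_gt0 R))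
    (gfunctional_ge0 (half_gt0 R)) E1_gt0 (q := n * d + a) (p := n * d + b) (block_rank d) d0.
  - by rewrite (leq_trans _ (leq_addr _ _))// leq_mul2r leqnSn orbT.
  - by rewrite (leq_trans _ (leq_addr _ _))// leq_mul2r leqnSn orbT.
  by exists e.
move=> /choice[e he].
pose P (x : concentrating_index M) : MP :=
  let: existT d (a, b, i) := x in e (d.+1, val a, val b) i.
have fP (d a b i : nat) : (a < d)%N -> (i < d ^ n' * d ^ n')%N ->
    exists2 P0, fock (n * d + a) (n * d + b) P0 &
      e (d, a, b) i = iter (block_rank d) (@rai R n) P0.
  by move=> ad; have [|h _] := he (d, a, b); [exact: leq_trans ad|exact: h].
have eP (d a b i : nat) : (a < d)%N -> (i < d ^ n' * d ^ n')%N ->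
    eig (block_rank d + (n * d + a))%:R (block_rank d + (n * d + b))%:R (e (d, a, b) i).
  by move=> ad id; have [P0 h ->] := fP d a b i ad id; exact/fock_eig/fock_iter_rai.
exists P; split.
- move=> [d [[a b] i]]; do 2!eexists.
  exact: (eP _ _ b _ (ltn_ord a) (ltn_ord i)).
- move=> [d [[a b] i]] [d' [[a' b'] i']].
  have ex := eP _ _ b _ (ltn_ord a) (ltn_ord i).
  have ey := eP _ _ b' _ (ltn_ord a') (ltn_ord i').
  (* Either the bidegrees differ and the functions are orthogonal, or d, a and b agree and both
     belong to one Gram-Schmidt family. *)
  have [/orP ne|] := boolP
    ((block_rank d.+1 + (n * d.+1 + a) != block_rank d'.+1 + (n * d'.+1 + a'))%N ||
     (block_rank d.+1 + (n * d.+1 + b) != block_rank d'.+1 + (n * d'.+1 + b'))%N).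
    rewrite (form_eig E_ibp (gfunctional_star (half_gt0 R)) ex ey) ?eqr_nat; last exact/orP.
    case: eqP => // xy; exfalso; move: ne => [] /eqP; apply.
      by have := congr1 (fun x : concentrating_index M =>
        let: existT d (a, b, i) := x in (block_rank d.+1 + (n * d.+1 + a))%N) xy.
    by have := congr1 (fun x : concentrating_index M =>
        let: existT d (a, b, i) := x in (block_rank d.+1 + (n * d.+1 + b))%N) xy.
  rewrite negb_or !negbK => /andP[/eqP h1 /eqP h2].
  have [[dd] aa] := block_rank_inj (ltn_ord a) (ltn_ord a') h1.
  have [_ bb] := block_rank_inj (ltn_ord b) (ltn_ord b') h2.
  have {}dd : d = d' by exact: val_inj.
  subst d'; have {}aa := val_inj aa; have {}bb := val_inj bb; subst a' b'.
  have [_ h] := he (d.+1, val a, val b) (ltn0Sn d).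
  rewrite [LHS]h//; congr (_ %:R); congr nat_of_bool.
  by rewrite -tag_eqE /tag_eq /= eqxx tagged_asE /= !xpair_eqE !eqxx.
- move=> [d [[a b] i]] /=.
  have [P0 h hQ] := fP d.+1 a b i (ltn_ord a) (ltn_ord i).
  have [_ h'] := he (d.+1, val a, val b) (ltn0Sn d).
  apply: hc (ltn_ord a) (ltn_ord b) h hQ _.
  by rewrite h'// eqxx.
Qed.

End concentrating_family.

(** * Consequences of the estimate *)

Section finite_families.
Context (R : realType) (J : finType).
Implicit Types (a : J -> R).

Lemma esum_finType (a : J -> \bar R) : (forall j, 0 <= a j)%E ->
  \esum_(j in [set: J]) a j = (\sum_j a j)%E.
Proof.
move=> a0; rewrite esum_fset//.
  rewrite (fsbigE (index_enum J)) ?index_enum_uniq//.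
    by apply: eq_bigl => j; rewrite in_setT.
  by move=> j _; rewrite mem_index_enum.
exact: finite_finset.
Qed.

Lemma rsum_ge0 a : (forall j, 0 <= a j) -> rsum a = \sum_j a j.
Proof.
move=> a0; rewrite /rsum !esum_finType//.
- rewrite [X in _ - fine X]big1 ?subr0; last first.
    by move=> j _; rewrite (@ge0_funenegE _ _ setT) ?inE// => i _; rewrite lee_fin.
  rewrite (eq_bigr (fun j => (a j)%:E)) ?sumEFin// => j _.
  by rewrite (@ge0_funeposE _ _ setT) ?inE// => i _; rewrite lee_fin.
Qed.

Lemma csum_real_ge0 a : (forall j, 0 <= a j) ->
  csum (fun j => (a j)%:C) = (\sum_j a j)%:C.
Proof.
move=> a0; rewrite /csum /= rsum_ge0//.
by congr (_ +i* _); rewrite rsum_ge0//; exact: big1.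
Qed.

Lemma ell_norm_finType b (nu : J -> R[i]) :
  ell_norm b nu = ((\sum_j Normc.normc (nu j) `^ b) `^ b^-1)%:E.
Proof.
rewrite /ell_norm esum_finType; last by move=> j; rewrite lee_fin powR_ge0.
by rewrite sumEFin.
Qed.

End finite_families.

Section stationary_mixed_norm.
Context (R : realType) (n : nat).
Local Notation MP := (mpoly (n + n) R[i]).
Implicit Types (P Q : MP) (z : Cn R n) (rho : Cn R n -> R).

(** The density does not depend on time and the interval has length 2 pi, at least 1, so integrating
    in time can only increase the norm. *)
Lemma Lnorm_le_mixed_norm (p q : R) (F : R -> Cn R n -> R[i]) rho : 0 < p ->
  (forall t z, F t z = (rho z)%:C) -> (forall z, 0 <= rho z) ->
  (Lnorm (vol R n) q%:E (EFin \o rho) <= mixed_norm p q F)%E.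
Proof.
move=> p0 FE rho0; rewrite /mixed_norm.
have LE t : Lnorm (vol R n) q%:E (fun z => (Normc.normc (F t z))%:E) =
    Lnorm (vol R n) q%:E (EFin \o rho).
  by apply: eq_Lnorm => z /=; rewrite FE normc_real ger0_norm.
under eq_integral => t _ do rewrite LE.
set A := Lnorm _ _ _; have A0 : (0 <= A)%E by exact: Lnorm_ge0.
have pi1 : 1 <= pi + pi :> R by have := pi_ge2 R; lra.
rewrite integral_cst//= lebesgue_measure_itv /= lte_fin gt0_cp ?pi_gt0//.
rewrite opprK.
have {1}-> : A = ((A `^ p) `^ p^-1)%E by rewrite -poweRrM mulfV ?gt_eqF// poweRe1.
have pi1E : (1 <= pi%:E + pi%:E :> \bar R)%E by rewrite -EFinD lee_fin.
apply: gt0_ler_poweR; first by rewrite invr_ge0 ltW.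
- by rewrite in_itv /= poweR_ge0 leey.
- by rewrite in_itv /= mule_ge0 ?poweR_ge0 ?leey// (le_trans _ pi1E).
- by rewrite lee_pemulr// poweR_ge0.
Qed.

Definition gauss z : R := expR (- (2^-1 * normsq z)).

Lemma measurable_gauss : measurable_fun setT (gauss : Cn R n -> measurableTypeR R).
Proof.
have [h _] := cdiff_continuous (cdiff_ev (2^-1 : R) (1 : MP)).
rewrite (_ : gauss = fun z => complex.Re (ev 2^-1 1 z)).
  exact: continuous_measurable_Cn.
by apply/funext => z; rewrite /ev -(mpolyC1 _ R[i]) pevC mul1r.
Qed.

Lemma Lnorm_gauss (r : R) : 0 < r -> exists2 K : R, 0 <= K &
  Lnorm (vol R n) r%:E (EFin \o gauss) = K%:E.
Proof.
move=> r0; have c0 : 0 < r * 2^-1 by rewrite mulr_gt0// invr_gt0.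
have [i1 _] := cintegrable_ev c0 (1 : MP).
exists (fine (Lnorm (vol R n) r%:E (EFin \o gauss))).
  by rewrite fine_ge0// Lnorm_ge0.
rewrite fineK// ge0_fin_numE ?Lnorm_ge0//.
rewrite unlock poweR_lty//.
have [_] := integrableP _ _ _ i1; apply: le_lt_trans.
rewrite le_eqVlt; apply/orP; left; apply/eqP; apply: eq_integral => z _.
rewrite /ev -(mpolyC1 _ R[i]) pevC mul1r /= ger0_norm ?expR_ge0//.
by rewrite [in RHS]ger0_norm ?expR_ge0// /gauss -expRM; congr (expR _)%:E; ring.
Qed.

Lemma ev1_gauss P z : ev 1 P z = (gauss z)%:C * ev 2^-1 P z.
Proof.
rewrite /ev mulrCA -rmorphM -expRD; congr (_ * (expR _)%:C); lra.
Qed.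

Lemma gauss_pairing_le (q r : R) rho : 0 < q -> 0 < r -> r^-1 + q^-1 = 1 ->
  measurable_fun setT (rho : Cn R n -> measurableTypeR R) -> (forall z, 0 <= rho z) ->
  (\int[vol R n]_z (gauss z * rho z)%:E <=
   Lnorm (vol R n) r%:E (EFin \o gauss) * Lnorm (vol R n) q%:E (EFin \o rho))%E.
Proof.
move=> q0 r0 rq mrho rho0.
apply: le_trans (hoelder (vol R n) measurable_gauss mrho r0 q0 rq).
rewrite Lnorm1 le_eqVlt; apply/orP; left; apply/eqP; apply: eq_integral => z _ /=.
by rewrite ger0_norm// mulr_ge0 ?expR_ge0.
Qed.

Definition strichartz_bound (p q beta C : R) :=
  forall (J : choiceType) (f : J -> Cn R n -> R[i]) (nu : J -> R[i])
         (u : J -> R -> Cn R n -> R[i]),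
    orthonormal_system f ->
    (forall j t, is_propagator t (f j) (u j t)) ->
    (mixed_norm p q (fun t z =>
       csum (fun j => nu j * (Normc.normc (u j t z) ^+ 2)%:C)%R)
     <= C%:E * ell_norm beta nu)%E.

(* For eigenfunctions the density does not depend on time, so Hoelder's
   inequality in space turns the estimate into a bound on Gaussian masses. *)
Lemma strichartz_bound_mass (p q r beta C : R) :
  0 < p -> 0 < q -> 0 < r -> r^-1 + q^-1 = 1 -> strichartz_bound p q beta C ->
  exists2 K : R, 0 <= K &
  forall (J : finType) (P : J -> MP) (nu : J -> R),
  (forall x, exists k m : nat, eig k%:R m%:R (P x)) ->
  (forall x y, hform (gfunctional n (half_gt0 R)) (P x) (P y) = (x == y)%:R) ->
  (forall x, 0 <= nu x) ->
  \sum_x nu x * complex.Re (gfunctional n (@ltr01 R) (P x * star (P x))) <=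
  K * (C * (\sum_x nu x `^ beta) `^ beta^-1).
Proof.
move=> p0 q0 r0 rq bound; have [K K0 KE] := Lnorm_gauss r0.
exists K => // J P nu Peig Porth nu0.
have /choice[k hk] : forall x, exists k : nat, exists m : nat, eig k%:R m%:R (P x).
  by [].
pose S := \sum_x (nu x)%:C *: (P x * star (P x)).
pose rho z := \sum_x nu x * Normc.normc (hf (P x) z) ^+ 2.
have rho0 z : 0 <= rho z by apply: sumr_ge0 => x _; rewrite mulr_ge0// sqr_ge0.
have SE z : ev 2^-1 S z = (rho z)%:C.
  rewrite /ev /S pev_sum mulr_suml /rho rmorph_sum; apply: eq_bigr => x _.
  rewrite pevZ -mulrA rmorphM; congr (_ * _).
  exact: etrans (esym (hf_conj _ _ _)) (esym (sqr_normcE _)).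
have mrho : measurable_fun setT (rho : Cn R n -> measurableTypeR R).
  have [h _] := cdiff_continuous (cdiff_ev (2^-1 : R) S).
  rewrite (_ : rho = fun z => complex.Re (ev 2^-1 S z)).
    exact: continuous_measurable_Cn.
  by apply/funext => z; rewrite SE.
have -> : \sum_x nu x * complex.Re (gfunctional n (@ltr01 R) (P x * star (P x))) =
    complex.Re (gfunctional n (@ltr01 R) S).
  rewrite /S linear_sum raddf_sum; apply: eq_bigr => x _.
  have ReZ (a : R) (w : R[i]) : complex.Re (a%:C * w) = a * complex.Re w.
    by case: w => w1 w2 /=; rewrite mul0r subr0.
  by apply: etrans (esym (ReZ _ _)) _; congr complex.Re; rewrite linearZ_LR.
rewrite -lee_fin gfunctionalE /cint /= /Rintegral fineK; last first.
  by apply: integrable_fin_num => //; have [] := cintegrable_ev (@ltr01 R) S.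
under eq_integral => z _ do rewrite ev1_gauss SE -rmorphM /=.
apply: le_trans (gauss_pairing_le q0 r0 rq mrho rho0) _.
rewrite KE EFinM lee_wpmul2l ?lee_fin//.
have orth : orthonormal_system (fun x => hf (P x)).
  by split => [x|x y]; [exact: L2_hf|rewrite inner_hf Porth].
have prop x t : is_propagator t (hf (P x))
    (fun z => expi (- (t * eigenvalue_of R n (k x))) * hf (P x) z).
  by have [m e] := hk x; exact: is_propagator_hf e.
have := bound J _ (fun x => (nu x)%:C) _ orth prop.
rewrite ell_norm_finType -EFinM => h.
apply: le_trans (le_trans h _); last first.
  rewrite le_eqVlt; apply/orP; left; apply/eqP; congr (_ * _ `^ _)%:E.
  by apply: eq_bigr => x _; rewrite normc_real ger0_norm.
apply: Lnorm_le_mixed_norm => // t z.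
under [in LHS]eq_fun => x.
  rewrite Normc.normcM normc_expi mul1r -rmorphM.
  over.
by rewrite csum_real_ge0// => x; rewrite mulr_ge0// sqr_ge0.
Qed.

End stationary_mixed_norm.

Lemma harmonic_unbounded (R : realType) (B : R) :
  exists M, B < \sum_(d < M) d.+1%:R^-1.
Proof.
apply/not_existsP => h; apply: (@dvg_harmonic R).
apply: nondecreasing_is_cvgn.
  by apply: nondecreasing_series => i _ _; exact: harmonic_ge0.
exists B => _ [M _ <-]; rewrite /series /= big_mkord leNgt.
by apply/negP; exact: h.
Qed.

Lemma sum_block_index (R : realType) n' M (F : nat -> R) :
  \sum_(x : concentrating_index n' M) F (tag x : 'I_M) =
  \sum_(d < M) d.+1%:R ^+ (2 * n'.+1) * F d.
Proof.
transitivity (\sum_(d < M) \sum_(y : 'I_d.+1 * 'I_d.+1 * 'I_(d.+1 ^ n' * d.+1 ^ n')) F d).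
  by rewrite (sig_big_dep xpredT (fun _ => xpredT) (fun d _ => F (d : 'I_M))).
apply: eq_bigr => d _.
rewrite sumr_const !card_prod !card_ord -[LHS]mulr_natl; congr (_ * _).
by rewrite !natrM !natrX mulnS exprD expr2 mul2n -addnn exprD.
Qed.

Theorem theorem1p6 (R : realType) (n : nat) (hn : (1 <= n)%N)
    (q p beta : R)
    (hq : q = (2 * n%:R + 1) / (2 * n%:R - 1))
    (hp : p^-1 + n%:R / q = n%:R)
    (hbeta : beta = 2 * q / (q + 1)) :
  ~ (exists2 C : R, 0 < C &
      forall (J : choiceType) (f : J -> Cn R n -> R[i]) (nu : J -> R[i])
             (u : J -> R -> Cn R n -> R[i]),
        orthonormal_system f ->
        (forall j t, is_propagator t (f j) (u j t)) ->
        (mixed_norm p q (fun t z =>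
           csum (fun j => nu j * (Normc.normc (u j t z) ^+ 2)%:C)%R)
         <= C%:E * ell_norm beta nu)%E).
Proof.
case: n hn q p beta hq hp hbeta => // n' _ q p beta hq hp hbeta [C C0 bound].
set n := n'.+1 in hq hp hbeta bound *.
have n1 : 1 <= n%:R :> R by rewrite ler1n.
have q0 : 0 < q by rewrite hq divr_gt0//; lra.
have pE : p = (2 * n%:R + 1) / (2 * n%:R).
  rewrite -[p]invrK; have -> : p^-1 = n%:R - n%:R / q by apply/eqP; rewrite eq_sym subr_eq hp.
  by rewrite hq; field; apply/and3P; split; lra.
have p0 : 0 < p by rewrite pE divr_gt0//; lra.
have bE : beta = (2 * n%:R + 1) / (2 * n%:R).
  by rewrite hbeta hq; field; apply/and3P; split; lra.
have b1 : 1 < beta by rewrite bE ltr_pdivlMr; lra.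
(* The exponent conjugate to q, for Hoelder's inequality. *)
pose r : R := (2 * n%:R + 1) / 2.
have r0 : 0 < r by rewrite divr_gt0//; lra.
have rq : r^-1 + q^-1 = 1 by rewrite hq /r; field; apply/andP; split; lra.
have [K K0 hK] := strichartz_bound_mass p0 q0 r0 rq bound.
have [c c0 hc] := concentrating_family R n'.
pose s := beta^-1.
have s1 : 0 < 1 - s by rewrite subr_gt0 invf_lt1; lra.
(* The estimate will give c H <= K C H^s with s < 1, hence H at most (K C / c)^(1 / (1 - s)); M
   makes the harmonic sum exceed this. *)
have [M hM] := harmonic_unbounded ((K * C / c) `^ (1 - s)^-1).
pose H := \sum_(d < M) (d.+1%:R : R)^-1.
have KC0 : 0 <= K * C / c by rewrite divr_ge0 ?mulr_ge0 // ltW.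
have H0 : 0 < H by apply: le_lt_trans hM; exact: powR_ge0.
have [P [Peig Porth Pmass]] := hc M.
(* With (d + 1)^(2n) indices at tag d, both sides reduce to H: nu^beta is (d + 1)^-(2n + 1), and nu
   times the mass is at least c times that. *)
pose nu (x : concentrating_index n' M) : R := (tag x : 'I_M).+1%:R ^- (2 * n).
have nu0 x : 0 <= nu x by rewrite invr_ge0 exprn_ge0.
have := hK _ P nu Peig Porth nu0.
have -> : \sum_x nu x `^ beta = H.
  rewrite (eq_bigr (fun x : concentrating_index n' M =>
      ((tag x : 'I_M).+1%:R : R) ^- (2 * n).+1)); last first.
    move=> x _; rewrite /nu -!exprVn -!powR_mulrn ?invr_ge0// -powRrM; congr (_ `^ _).
    by rewrite bE -natr1 natrM; field; lra.
  rewrite (sum_block_index n' M (fun d => (d.+1%:R : R) ^- (2 * n).+1)).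
  by apply: eq_bigr => d _; rewrite exprS invfM mulrCA divff ?mulr1// expf_neq0// pnatr_eq0.
apply/negP; rewrite -ltNge.
apply: (@lt_le_trans _ _ (c * H)); last first.
  rewrite mulr_sumr -/n.
  have -> : \sum_(d < M) c * (d.+1%:R : R)^-1 =
      \sum_(x : concentrating_index n' M) nu x * (c / (tag x : 'I_M).+1%:R).
    rewrite (sum_block_index n' M (fun d => (d.+1%:R : R) ^- (2 * n) * (c / d.+1%:R))).
    by apply: eq_bigr => d _; rewrite mulrA divff ?mul1r// expf_neq0// pnatr_eq0.
  by apply: ler_sum => x _; rewrite ler_wpM2l.
rewrite mulrA -ltr_pdivrMl// mulrA [c^-1 * _]mulrC.
have HE : H = H `^ (1 - s) * H `^ s.
  by rewrite -powRD ?subrK ?powRr1 ?ltW//; apply/implyP => _; rewrite gt_eqF.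
rewrite [X in _ < X]HE ltr_pM2r ?powR_gt0//.
have -> : K * C / c = ((K * C / c) `^ (1 - s)^-1) `^ (1 - s).
  by rewrite -powRrM mulVf ?gt_eqF// powRr1.
by rewrite gt0_ltr_powR// ?nnegrE ?powR_ge0 ?ltW.
Qed.
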